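(* Let $d\ge 2$, $\epsilon>0$, $C=5\pi$ and $\tau(\epsilon,d)=\log\!\left(\tfrac{6C}{\epsilon}\right)^{1/2}\sqrt{\tfrac{1}{32}\log\!\left(\tfrac{6C}{\epsilon}\right)^{1/2}+\log\!\left(\tfrac{d}{\epsilon}\log\!\left(\tfrac{6C}{\epsilon}\right)^{1/2}\right)}$. Suppose a probability measure $\nu$ on $\mathrm{U}(d)$ is a $\delta$-approximate unitary $t$-expander with $$t\ge 5\frac{d^{5/2}}{\epsilon}\tau(\epsilon,d),\qquad \delta\le\frac{1}{32}\left(\frac{\epsilon^{3/2}}{4C\log\left(\frac{6C}{\epsilon}\right)^{1/2}d}\right)^{d^2-1}.$$ Then the set of unitary channels $\{\mathcal{V}:V\in\mathrm{supp}(\nu)\}$ forms an $\epsilon$-net in $\mathcal{U}(d)$ with respect to the distance $\mathrm{D}$.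
   Context: $\mathcal{U}(d)$ is the set of unitary channels $\rho\mapsto U\rho U^\dagger$ on $\mathbb{C}^d$; $\mathcal{V}$ is the channel of $V$. $\mathrm{D}(\mathcal{U},\mathcal{V})=\min_{\varphi\in[0,2\pi)}\|U-e^{i\varphi}V\|_\infty$. $S\subset\mathcal{U}(d)$ is an $\epsilon$-net if every channel is within $\mathrm{D}$-distance $\epsilon$ of some element of $S$. For a probability measure $\nu$ on $\mathrm{U}(d)$ the moment operator is $T_{\nu,t}=\int\mathrm{d}\nu(U)\,U^{\otimes t}\otimes\bar U^{\otimes t}$; with $\mu$ the Haar probability measure, $\nu$ is a $\delta$-approximate $t$-expander if $\|T_{\nu,t}-T_{\mu,t}\|_\infty\le\delta$. $\log$ is the natural logarithm. *)

(* Defs.v *)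
From HB Require Import structures.
From mathcomp Require Import all_boot all_order all_algebra.
From mathcomp Require Import all_classical all_reals all_analysis.
From mathcomp Require Import complex.
Unset Printing Implicit Defensive.
Import Order.TTheory GRing.Theory Num.Theory.
Import numFieldNormedType.Exports.
Local Open Scope classical_set_scope.
Local Open Scope ring_scope.

Section UnitaryDefs.
Variable R : realType.
Local Notation C := (complex R).

Definition cabs2 (z : C) : R := @complex.Re R z ^+ 2 + @complex.Im R z ^+ 2.

Definition vnorm {I : finType} (x : I -> C) : R :=
  Num.sqrt (\sum_(i : I) cabs2 (x i)).

Definition opnorm {I : finType} (A : I -> I -> C) : R :=
  sup [set r : R | exists x : I -> C,
         vnorm x <= 1 /\ r = vnorm (fun i => \sum_(j : I) A i j * x j)].

Definition mx_opnorm {d : nat} (M : 'M[C]_d) : R := opnorm (fun i j => M i j).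

Definition adjmx {d : nat} (M : 'M[C]_d) : 'M[C]_d := (map_mx (@conjc R) M)^T.

Definition unitary (d : nat) := {M : 'M[C]_d | M *m adjmx M == 1%:M}.

HB.instance Definition _ d := [isSub for (@sval _ (fun M : 'M[C]_d => M *m adjmx M == 1%:M))].
HB.instance Definition _ d := [Choice of unitary d by <:].

Lemma unitary1_proof d : (1%:M : 'M[C]_d) *m adjmx 1%:M == 1%:M.
Proof.
by rewrite /adjmx map_mx1 trmx1 mulmx1.
Qed.

HB.instance Definition _ d :=
  isPointed.Build (unitary d) (exist _ 1%:M (unitary1_proof d) : unitary d).

Definition uball {d : nat} (V : unitary d) (r : R) : set (unitary d) :=
  [set W | mx_opnorm (val W - val V) < r].

Definition uballs (d : nat) : set (set (unitary d)) :=
  [set B | exists V r, B = uball V r].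

(* U(d) with its Borel sigma-algebra (generated by the open balls; U(d) is
   a separable metric space, so this is the Borel sigma-algebra) *)
Definition Umeas (d : nat) := g_sigma_algebraType (@uballs d).

Definition is_haar {d : nat} (mu : probability (Umeas d) R) : Prop :=
  forall (V : Umeas d) (A : set (Umeas d)), measurable A ->
    mu [set W : Umeas d | exists2 W' : Umeas d, A W' & val W = val V *m val W'] = mu A.

Definition cintegral {d : nat} (nu : probability (Umeas d) R) (f : Umeas d -> C) : C :=
  (fine (\int[nu]_x (@complex.Re R (f x))%:E) +i* fine (\int[nu]_x (@complex.Im R (f x))%:E))%C.

(* index set of (C^d)^{(x) t} (x) (C^d)^{(x) t} *)
Definition tidx (t d : nat) := ({ffun 'I_t -> 'I_d} * {ffun 'I_t -> 'I_d})%type.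

(* entries of U^{(x) t} (x) conj(U)^{(x) t} *)
Definition tens_entry {t d : nat} (U : 'M[C]_d) (a b : tidx t d) : C :=
  (\prod_(k < t) U (a.1 k) (b.1 k)) * \prod_(k < t) conjc (U (a.2 k) (b.2 k)).

Definition moment_op {d : nat} (t : nat) (nu : probability (Umeas d) R) :
    tidx t d -> tidx t d -> C :=
  fun a b => cintegral nu (fun U => tens_entry (val U) a b).

Definition approx_expander {d : nat} (t : nat) (nu mu : probability (Umeas d) R) (delta : R) :=
  opnorm (fun a b => moment_op t nu a b - moment_op t mu a b) <= delta.

Definition msupport {d : nat} (nu : probability (Umeas d) R) : set (unitary d) :=
  [set V | forall r : R, 0 < r -> (0 < nu (uball V r))%E].

Definition Dchan {d : nat} (U V : 'M[C]_d) : R :=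
  inf [set r : R | exists phi : R, 0 <= phi < 2 * pi /\
         r = mx_opnorm (U - (cos phi +i* sin phi)%C *: V)].

Definition is_eps_net {d : nat} (S : set (unitary d)) (eps : R) : Prop :=
  forall U : unitary d, exists2 V, S V & Dchan (val U) (val V) <= eps.

Definition Cconst : R := 5 * pi.

Definition tau (eps : R) (d : nat) : R :=
  Num.sqrt (ln (6 * Cconst / eps)) *
  Num.sqrt (1 / 32 * Num.sqrt (ln (6 * Cconst / eps))
            + ln (d%:R / eps * Num.sqrt (ln (6 * Cconst / eps)))).

End UnitaryDefs.

Arguments is_haar {R d}.
Arguments approx_expander {R d}.
Arguments msupport {R d}.
Arguments is_eps_net {R d}.
Arguments tau {R}.
Arguments Dchan {R d}.
Arguments mx_opnorm {R d}.
Arguments opnorm {R I}.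
Arguments moment_op {R d}.
Arguments cintegral {R d}.
Arguments uball {R d}.

(* Main.v *)
(* Let x(V) = |tr V|^2 / d^2, l = log (6 C / eps), N ~ (19/6) d^3 l / eps^2, m = E_mu x^N,
   and suppose that no channel of supp nu is within eps of U0. Let B be the ball of radius
   eps/6 around U0 and v = mu(B).
   Expanding x^N in shifted Chebyshev polynomials and dropping the degrees above t gives a
   polynomial q of degree t with |q - x^N| <= 2 exp(-t^2/N) on [0, 1] (Chernoff bound for
   binomial coefficients), and q(x(V)) is a matrix coefficient of V^{t,t}. On such functions
   convolution by nu - mu has L^2(mu) norm at most delta, so V -> E_nu q(x(W^* V)) differs
   from its mean, about m, by at most delta sqrt(2m) in L^2. But for V in B and W in supp nu,
   W^* V stays at distance 5 eps/6 from all phases, where x^N has Haar integral at most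
   v m / 4. Integrating over B yields v m <= 8 delta^2, contradicting the lower bounds on v
   and m.
   Those bounds, and the bound on the tail of x^N, use the map K -> ((1 + iK)/(1 - iK))^2,
   which is 4-Lipschitz from Hermitian matrices and sends the unit ball onto U(d): points of
   a lattice of Hermitian matrices are mapped to a net of U(d) and counted. *)
Require Import Defs.
From HB Require Import structures.
From mathcomp Require Import all_boot all_order all_algebra.
From mathcomp Require Import all_classical all_reals all_analysis.
From mathcomp Require Import complex.
From mathcomp Require Import measurable_realfun ring lra zify.
Import Order.TTheory GRing.Theory Num.Theory.
Import numFieldNormedType.Exports.
Set Implicit Arguments.
Unset Strict Implicit.
Unset Printing Implicit Defensive.
Local Open Scope classical_set_scope.
Local Open Scope ring_scope.

Arguments cabs2 {R}.
Arguments vnorm {R I}.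
Arguments adjmx {R d}.

(** Put n = d^2. The lower bounds on v and m are n-th powers, so every error has to be one too.
    Since 2 d - 2 |tr V| is the squared Frobenius distance from 1 to the phase multiples of V, x^N
    is at most exp(-N e^2 / d) at distance e from all phases; with N of order d^3 l / eps^2 this is
    exp(-c n l), which beats v >= (eps/54)^n. The bound obtained for m is of order S^-n with S =
    sqrt(d l) / eps, and exp(-t^2/N) falls below it because t^2/N >= (15/2) n log Q with Q = d
    sqrt(l) / eps: this is where t of order d^(5/2) tau / eps enters. The tail of x^N is bounded by
    a multiple of m itself, not by an absolute number: on the tail, x^N is dominated by a weighted
    sum of its own translates, each of integral m, so both sides of the comparison carry the factor
    m. The numerical margins rely on eps < 2; for larger eps any two channels are within eps of each
    other. *)

Lemma discr_le (R : realType) (a b c : R) : 0 <= c ->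
  (forall s, 0 <= a + 2 * s * b + s ^+ 2 * c) -> b ^+ 2 <= a * c.
Proof.
rewrite le_eqVlt => /predU1P[<-|c0] H.
  rewrite mulr0; have [->|b0] := eqVneq b 0; first by rewrite expr0n.
  have bb : b * b^-1 = 1 by rewrite mulfV.
  (* For c = 0 the quadratic is affine in s; at this point it equals -a - 2, while its value a at 0
     is nonnegative. *)
  have := H (- (a + 1) / b); rewrite mulr0 addr0.
  have -> : 2 * (- (a + 1) / b) * b = - 2 * (a + 1) * (b * b^-1) by ring.
  by rewrite bb; have := H 0; rewrite !(mulr0, mul0r, expr0n, addr0) /=; lra.
have cc : c * c^-1 = 1 by rewrite mulfV // gt_eqF.
have := H (- b / c).
have -> : a + 2 * (- b / c) * b + (- b / c) ^+ 2 * c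
   = a - 2 * b ^+ 2 * c^-1 + b ^+ 2 * c^-1 * (c * c^-1) by ring.
rewrite cc mulr1.
have -> : a - 2 * b ^+ 2 * c^-1 + b ^+ 2 * c^-1 = a - b ^+ 2 / c by ring.
by rewrite subr_ge0 ler_pdivrMr.
Qed.

(** * Norms of complex matrices *)

Section Vectors.
Variable R : realType.
Local Notation C := (complex R).
Local Notation Re := (@complex.Re R).
Local Notation Im := (@complex.Im R).

Lemma cabs2_ge0 (z : C) : 0 <= cabs2 z.
Proof. by rewrite addr_ge0 ?sqr_ge0. Qed.

Lemma cabs2M (z w : C) : cabs2 (z * w) = cabs2 z * cabs2 w.
Proof. by case: z w => [a b] [c e]; rewrite /cabs2 /=; ring. Qed.

Lemma cabs2_conj (z : C) : cabs2 (conjc z) = cabs2 z.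
Proof. by case: z => [a b]; rewrite /cabs2 /= sqrrN. Qed.

Lemma cabs2N (z : C) : cabs2 (- z) = cabs2 z.
Proof. by case: z => [a b]; rewrite /cabs2 /= !sqrrN. Qed.

Lemma cabs2_real (a : R) : cabs2 (a%:C)%C = a ^+ 2.
Proof. by rewrite /cabs2 /= expr0n addr0. Qed.

Lemma mulcJ (z : C) : conjc z * z = ((cabs2 z)%:C)%C.
Proof.
by case: z => [a b]; apply/eqP; rewrite eq_complex /cabs2 /=; apply/andP; split;
  apply/eqP; ring.
Qed.

Lemma cabs2_eq0 (z : C) : (cabs2 z == 0) = (z == 0).
Proof.
case: z => [a b]; rewrite /cabs2 eq_complex /= paddr_eq0 ?sqr_ge0 //.
by rewrite !sqrf_eq0.
Qed.

Lemma ReD (z w : C) : Re (z + w) = Re z + Re w. Proof. by case: z w => [a b] [c e]. Qed.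
Lemma ImD (z w : C) : Im (z + w) = Im z + Im w. Proof. by case: z w => [a b] [c e]. Qed.

Lemma Re_sum (I : Type) (r : seq I) (P : pred I) (F : I -> C) :
  Re (\sum_(i <- r | P i) F i) = \sum_(i <- r | P i) Re (F i).
Proof. by rewrite (big_morph Re ReD (erefl : Re 0 = 0)). Qed.

Variable I : finType.
Implicit Types x y : I -> C.

Lemma vnorm_ge0 x : 0 <= vnorm x.
Proof. exact: sqrtr_ge0. Qed.

Lemma vnorm2 x : vnorm x ^+ 2 = \sum_i cabs2 (x i).
Proof. by rewrite sqr_sqrtr // sumr_ge0 // => i _; exact: cabs2_ge0. Qed.

Lemma vnorm_eq x y : (forall i, cabs2 (x i) = cabs2 (y i)) -> vnorm x = vnorm y.
Proof. by move=> h; rewrite /vnorm (eq_bigr _ (fun i _ => h i)). Qed.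

Lemma vnorm0 : vnorm (fun _ : I => 0 : C) = 0.
Proof. by rewrite /vnorm big1 ?sqrtr0 // => i _; rewrite /cabs2 /= expr0n addr0. Qed.

Lemma vnormZ (c : C) x : vnorm (fun i => c * x i) = Num.sqrt (cabs2 c) * vnorm x.
Proof.
rewrite /vnorm -sqrtrM ?cabs2_ge0 // big_distrr /=; congr Num.sqrt.
by apply: eq_bigr => i _; rewrite cabs2M.
Qed.

Lemma vnorm_conj x : vnorm (fun i => conjc (x i)) = vnorm x.
Proof. by apply: vnorm_eq => i; rewrite cabs2_conj. Qed.

Lemma vnormN x : vnorm (fun i => - x i) = vnorm x.
Proof. by apply: vnorm_eq => i; rewrite cabs2N. Qed.

Lemma vnorm0_eq0 x i : vnorm x = 0 -> x i = 0.
Proof.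
move=> /(congr1 (fun r => r ^+ 2)); rewrite vnorm2 expr0n /= => /eqP.
rewrite psumr_eq0 => [|j _]; last exact: cabs2_ge0.
by move=> /allP/(_ i); rewrite mem_index_enum => /(_ isT); rewrite cabs2_eq0 => /eqP.
Qed.

Lemma vnorm_comp x i : cabs2 (x i) <= vnorm x ^+ 2.
Proof. by rewrite vnorm2 (bigD1 i) //= lerDl sumr_ge0 // => j _; exact: cabs2_ge0. Qed.

Lemma vnorm_dotR x y :
  (Re (\sum_i conjc (x i) * y i)) ^+ 2 <= vnorm x ^+ 2 * vnorm y ^+ 2.
Proof.
apply: discr_le => [|s]; first exact: sqr_ge0.
have -> : vnorm x ^+ 2 + 2 * s * Re (\sum_i conjc (x i) * y i) + s ^+ 2 * vnorm y ^+ 2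
   = \sum_i cabs2 (x i + (s%:C)%C * y i).
  rewrite !vnorm2 Re_sum !big_distrr /= -!big_split /=; apply: eq_bigr => i _.
  by case: (x i) (y i) => [a b] [c e]; rewrite /cabs2 /=; ring.
by rewrite sumr_ge0 // => i _; exact: cabs2_ge0.
Qed.

(** Reduced to the real part: rotating [x] by the sum [z] itself turns the sum into |z|^2, and one
    factor [cabs2 z] cancels. *)
Lemma vnorm_dot x y :
  cabs2 (\sum_i x i * y i) <= vnorm x ^+ 2 * vnorm y ^+ 2.
Proof.
set z := \sum_i _.
have := vnorm_dotR (fun i => z * conjc (x i)) y.
rewrite vnormZ vnorm_conj exprMn sqr_sqrtr ?cabs2_ge0 //.
have -> : \sum_i conjc (z * conjc (x i)) * y i = conjc z * z.
  rewrite big_distrr /=; apply: eq_bigr => i _.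
  by rewrite rmorphM /= conjcK mulrA.
rewrite mulcJ /= expr2 -mulrA.
have := cabs2_ge0 z; rewrite le_eqVlt => /predU1P[<- _|z0].
  by rewrite mulr_ge0 ?sqr_ge0.
by rewrite ler_pM2l.
Qed.

Lemma vnormD x y : vnorm (fun i => x i + y i) <= vnorm x + vnorm y.
Proof.
rewrite -(ler_pXn2r (_ : 0 < 2)%N) ?nnegrE ?addr_ge0 ?vnorm_ge0 //.
have h : vnorm (fun i => x i + y i) ^+ 2 =
   vnorm x ^+ 2 + 2 * Re (\sum_i conjc (x i) * y i) + vnorm y ^+ 2.
  rewrite !vnorm2 Re_sum big_distrr /= -!big_split /=; apply: eq_bigr => i _.
  by case: (x i) (y i) => [a b] [c e]; rewrite /cabs2 /=; ring.
have h2 := vnorm_dotR x y.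
have h3 : Re (\sum_i conjc (x i) * y i) <= vnorm x * vnorm y.
  apply: (le_trans (ler_norm _)).
  rewrite -(ler_pXn2r (_ : 0 < 2)%N) ?nnegrE ?mulr_ge0 ?vnorm_ge0 //.
  by rewrite -normrX ger0_norm ?sqr_ge0 // exprMn.
by rewrite h sqrrD; lra.
Qed.

End Vectors.

Section Operators.
Variables (R : realType) (I : finType).
Local Notation C := (complex R).
Local Notation Re := (@complex.Re R).
Implicit Types x y : I -> C.

Definition fapp (A : I -> I -> C) x := fun i => \sum_j A i j * x j.

Definition frob (A : I -> I -> C) : R := vnorm (fun p : I * I => A p.1 p.2).

Lemma frobE (A : I -> I -> C) : frob A ^+ 2 = \sum_i \sum_j cabs2 (A i j).
Proof. by rewrite /frob vnorm2 pair_big. Qed.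

Lemma fapp_frob (A : I -> I -> C) x : vnorm (fapp A x) <= frob A * vnorm x.
Proof.
rewrite -(ler_pXn2r (_ : 0 < 2)%N) ?nnegrE ?mulr_ge0 ?vnorm_ge0 //.
rewrite exprMn frobE vnorm2 big_distrl /=; apply: ler_sum => i _.
by apply: (le_trans (vnorm_dot _ _)); rewrite vnorm2.
Qed.

Lemma fappZ (A : I -> I -> C) (c : C) x i : fapp A (fun j => c * x j) i = c * fapp A x i.
Proof. by rewrite /fapp big_distrr /=; apply: eq_bigr => j _; rewrite mulrCA. Qed.

(** Makes the [sup] in [opnorm] a genuine supremum; the Frobenius norm is the bound. *)
Lemma opnorm_has_ub (A : I -> I -> C) : has_ubound [set r : R | exists x : I -> C,
         vnorm x <= 1 /\ r = vnorm (fun i => \sum_(j : I) A i j * x j)].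
Proof.
exists (frob A) => _ [x [x1 ->]]; apply: (le_trans (fapp_frob _ _)).
by rewrite ler_piMr ?vnorm_ge0.
Qed.

Lemma opnorm_ge0 (A : I -> I -> C) : 0 <= opnorm A.
Proof.
apply: (ub_le_sup (opnorm_has_ub A)); exists (fun=> 0); rewrite vnorm0; split => //.
by rewrite -[LHS](vnorm0 R I); apply: vnorm_eq => i; rewrite big1 // => j _; rewrite mulr0.
Qed.

Lemma fapp_opnorm (A : I -> I -> C) x : vnorm (fapp A x) <= opnorm A * vnorm x.
Proof.
have := vnorm_ge0 x; rewrite le_eqVlt => /predU1P[x0|x0].
  rewrite -x0 mulr0 -(vnorm0 R I) le_eqVlt; apply/orP; left; apply/eqP.
  apply: vnorm_eq => i; rewrite /fapp big1 // => j _.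
  by rewrite (vnorm0_eq0 j (esym x0)) mulr0.
pose c := ((vnorm x)^-1%:C)%C.
have cE : Num.sqrt (cabs2 c) = (vnorm x)^-1.
  by rewrite cabs2_real sqrtr_sqr ger0_norm // invr_ge0 ltW.
have : vnorm (fapp A (fun j => c * x j)) <= opnorm A.
  apply: (ub_le_sup (opnorm_has_ub A)); exists (fun j => c * x j); split => //.
  by rewrite vnormZ cE mulVf // gt_eqF.
rewrite (vnorm_eq (y := fun i => c * fapp A x i)); last by move=> i; rewrite fappZ.
by rewrite vnormZ cE mulrC ler_pdivrMr.
Qed.

Lemma opnorm_le (A : I -> I -> C) (c : R) : 0 <= c ->
  (forall x, vnorm (fapp A x) <= c * vnorm x) -> opnorm A <= c.
Proof.
move=> c0 H; apply: ge_sup.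
  exists 0, (fun=> 0); rewrite vnorm0; split => //.
  by rewrite -[LHS](vnorm0 R I); apply: vnorm_eq => i; rewrite big1 // => j _; rewrite mulr0.
move=> _ [x [x1 ->]]; apply: (le_trans (H x)).
by rewrite ler_piMr.
Qed.

Lemma opnorm_frob (A : I -> I -> C) : opnorm A <= frob A.
Proof. by apply: opnorm_le (fapp_frob A); exact: vnorm_ge0. Qed.

Definition fadj (A : I -> I -> C) := fun i j => conjc (A j i).

Lemma dot_fadj (A : I -> I -> C) x y :
  \sum_i conjc (fapp (fadj A) x i) * y i = \sum_i conjc (x i) * fapp A y i.
Proof.
rewrite /fapp /fadj.
under eq_bigr do rewrite rmorph_sum big_distrl /=.
rewrite exchange_big /=; apply: eq_bigr => i _.
rewrite big_distrr /=; apply: eq_bigr => j _.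
by rewrite rmorphM /= conjcK; ring.
Qed.

Lemma dot_self x : \sum_i conjc (x i) * x i = ((vnorm x ^+ 2)%:C)%C.
Proof. by rewrite vnorm2 rmorph_sum; apply: eq_bigr => i _; rewrite mulcJ. Qed.

(** With z = A^* x, |z|^2 = <x, A z> <= |x| c |z|; divide by |z|. *)
Lemma fadj_bound (A : I -> I -> C) (c : R) : 0 <= c ->
  (forall x, vnorm (fapp A x) <= c * vnorm x) ->
  forall x, vnorm (fapp (fadj A) x) <= c * vnorm x.
Proof.
move=> c0 H x; set z := fapp (fadj A) x.
have e := dot_fadj A x z; rewrite dot_self in e.
have := vnorm_dotR x (fapp A z); rewrite -e /=.
have := vnorm_ge0 z; rewrite le_eqVlt => /predU1P[<- _|z0].
  by rewrite mulr_ge0 ?vnorm_ge0.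
rewrite -exprMn ler_pXn2r ?nnegrE ?mulr_ge0 ?sqr_ge0 ?vnorm_ge0 // => h.
rewrite -(ler_pM2r z0) -expr2; apply: (le_trans h).
have -> : c * vnorm x * vnorm z = vnorm x * (c * vnorm z) by ring.
by rewrite ler_wpM2l ?vnorm_ge0.
Qed.

End Operators.

Section Matrices.
Variables (R : realType) (d : nat).
Local Notation C := (complex R).
Local Notation Re := (@complex.Re R).
Implicit Types (A B M U : 'M[C]_d) (x : 'I_d -> C).

Definition mv M x := fapp (fun i j => M i j) x.
Definition mfrob M := frob (fun i j => M i j).

Lemma mvM A B x : mv (A *m B) x = mv A (mv B x).
Proof.
apply/funext => i; rewrite /mv /fapp.
under eq_bigr do rewrite mxE big_distrl /=.
rewrite exchange_big /=; apply: eq_bigr => j _; rewrite big_distrr /=.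
by apply: eq_bigr => k _; rewrite mulrA.
Qed.

Lemma mvD A B x : mv (A + B) x = (fun i => mv A x i + mv B x i).
Proof.
by apply/funext => i; rewrite /mv /fapp -big_split; apply: eq_bigr => j _; rewrite mxE mulrDl.
Qed.

Lemma mvN A x : mv (- A) x = (fun i => - mv A x i).
Proof.
by apply/funext => i; rewrite /mv /fapp -sumrN; apply: eq_bigr => j _; rewrite mxE mulNr.
Qed.

Lemma mvZ (c : C) A x : mv (c *: A) x = (fun i => c * mv A x i).
Proof.
apply/funext => i; rewrite /mv /fapp big_distrr; apply: eq_bigr => j _ /=.
by rewrite mxE mulrA.
Qed.

Lemma mv1 x : mv 1%:M x = x.
Proof.
apply/funext => i; rewrite /mv /fapp (bigD1 i) //= mxE eqxx mul1r big1 ?addr0 // => j ji.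
by rewrite mxE eq_sym (negbTE ji) mul0r.
Qed.

Lemma mv_le M x : vnorm (mv M x) <= mx_opnorm M * vnorm x.
Proof. exact: fapp_opnorm. Qed.

Lemma mx_opnorm_le M (c : R) : 0 <= c ->
  (forall x, vnorm (mv M x) <= c * vnorm x) -> mx_opnorm M <= c.
Proof. exact: opnorm_le. Qed.

Lemma mx_opnorm_ge0 M : 0 <= mx_opnorm M.
Proof. exact: opnorm_ge0. Qed.

Lemma mx_opnormM A B : mx_opnorm (A *m B) <= mx_opnorm A * mx_opnorm B.
Proof.
apply: mx_opnorm_le => [|x]; first by rewrite mulr_ge0 ?mx_opnorm_ge0.
rewrite mvM; apply: (le_trans (mv_le _ _)).
by rewrite -mulrA ler_wpM2l ?mx_opnorm_ge0 ?mv_le.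
Qed.

Lemma mx_opnormD A B : mx_opnorm (A + B) <= mx_opnorm A + mx_opnorm B.
Proof.
apply: mx_opnorm_le => [|x]; first by rewrite addr_ge0 ?mx_opnorm_ge0.
by rewrite mvD; apply: (le_trans (vnormD _ _)); rewrite mulrDl lerD ?mv_le.
Qed.

Lemma mx_opnormZ (c : C) A : mx_opnorm (c *: A) <= Num.sqrt (cabs2 c) * mx_opnorm A.
Proof.
apply: mx_opnorm_le => [|x]; first by rewrite mulr_ge0 ?mx_opnorm_ge0 ?sqrtr_ge0.
by rewrite mvZ vnormZ -mulrA ler_wpM2l ?sqrtr_ge0 ?mv_le.
Qed.

Lemma mx_opnormN A : mx_opnorm (- A) = mx_opnorm A.
Proof.
apply/eqP; rewrite eq_le; apply/andP; split; apply: mx_opnorm_le => [|x];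
  rewrite ?mx_opnorm_ge0 //.
  by rewrite mvN vnormN mv_le.
by rewrite -[A]opprK mvN vnormN opprK mv_le.
Qed.

Lemma mx_opnormB A B : mx_opnorm (A - B) = mx_opnorm (B - A).
Proof. by rewrite -mx_opnormN opprB. Qed.

Lemma mx_opnorm0 : mx_opnorm (0 : 'M[C]_d) = 0.
Proof.
apply/eqP; rewrite eq_le mx_opnorm_ge0 andbT; apply: mx_opnorm_le => // x.
by rewrite mul0r -(scale0r 0) mvZ vnormZ /cabs2 /= !expr0n addr0 sqrtr0 mul0r.
Qed.

Lemma mx_opnorm_frob A : mx_opnorm A <= mfrob A.
Proof. exact: opnorm_frob. Qed.

Lemma adjmxE A i j : adjmx A i j = conjc (A j i).
Proof. by rewrite !mxE. Qed.

Lemma adjmxK A : adjmx (adjmx A) = A.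
Proof. by apply/matrixP => i j; rewrite !adjmxE conjcK. Qed.

Lemma adjmxM A B : adjmx (A *m B) = adjmx B *m adjmx A.
Proof. by rewrite /adjmx map_mxM trmx_mul. Qed.

Lemma adjmxD A B : adjmx (A + B) = adjmx A + adjmx B.
Proof. by rewrite /adjmx map_mxD raddfD. Qed.

Lemma adjmxN A : adjmx (- A) = - adjmx A.
Proof. by rewrite /adjmx map_mxN raddfN. Qed.

Lemma adjmxZ (c : C) A : adjmx (c *: A) = conjc c *: adjmx A.
Proof. by apply/matrixP => i j; rewrite !mxE rmorphM. Qed.

Lemma adjmx1 : adjmx (1%:M : 'M[C]_d) = 1%:M.
Proof. by rewrite /adjmx map_mx1 trmx1. Qed.

Lemma mv_adj_bound A (c : R) : 0 <= c ->
  (forall x, vnorm (mv A x) <= c * vnorm x) ->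
  forall x, vnorm (mv (adjmx A) x) <= c * vnorm x.
Proof.
move=> c0 H x; have := fadj_bound c0 H x.
suff -> : fadj (fun i j => A i j) = (fun i j => adjmx A i j) by [].
by apply/funext => i; apply/funext => j; rewrite adjmxE.
Qed.

Lemma dot_adj A x (y : 'I_d -> C) :
  \sum_i conjc (mv (adjmx A) x i) * y i = \sum_i conjc (x i) * mv A y i.
Proof.
rewrite -(dot_fadj (fun i j => A i j)).
suff -> : fadj (fun i j => A i j) = (fun i j => adjmx A i j) by [].
by apply/funext => i; apply/funext => j; rewrite adjmxE.
Qed.

Definition isunit U := U *m adjmx U = 1%:M.

Lemma isunitC U : isunit U -> adjmx U *m U = 1%:M.
Proof. exact: mulmx1C. Qed.

Lemma isunit_adj U : isunit U -> isunit (adjmx U).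
Proof. by move=> u; rewrite /isunit adjmxK isunitC. Qed.

Lemma isunitM U V : isunit U -> isunit V -> isunit (U *m V).
Proof. by move=> u v; rewrite /isunit adjmxM mulmxA -(mulmxA U) v mulmx1. Qed.

Lemma isunit1 : isunit 1%:M.
Proof. by rewrite /isunit adjmx1 mulmx1. Qed.

Lemma isunitZ (z : C) U : cabs2 z = 1 -> isunit U -> isunit (z *: U).
Proof.
move=> z1 u; rewrite /isunit adjmxZ -scalemxAl -scalemxAr u scalerA.
by rewrite mulrC mulcJ z1 scale1r.
Qed.

Lemma unit_vnorm U x : isunit U -> vnorm (mv U x) = vnorm x.
Proof.
move=> u; have := dot_adj U (mv U x) x; rewrite -mvM (isunitC u) mv1 !dot_self.
by case=> /eqP; rewrite eqrXn2 ?vnorm_ge0 // => /eqP.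
Qed.

Lemma opnorm_unit U : isunit U -> mx_opnorm U <= 1.
Proof. by move=> u; apply: mx_opnorm_le => // x; rewrite unit_vnorm ?mul1r. Qed.

Lemma opnorm_unitl U A : isunit U -> mx_opnorm (U *m A) = mx_opnorm A.
Proof.
move=> u; apply/eqP; rewrite eq_le; apply/andP; split; apply: mx_opnorm_le => [|x];
  rewrite ?mx_opnorm_ge0 //.
  by rewrite mvM unit_vnorm // mv_le.
by rewrite -(unit_vnorm _ u) -mvM mv_le.
Qed.

Lemma mfrob2 A : mfrob A ^+ 2 = \sum_j vnorm (fun i => A i j) ^+ 2.
Proof.
rewrite /mfrob frobE exchange_big /=; apply: eq_bigr => j _.
by rewrite vnorm2.
Qed.

Lemma mfrob_ge0 A : 0 <= mfrob A. Proof. exact: vnorm_ge0. Qed.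

(** Column by column. This keeps the Frobenius estimates of the Cayley map free of dimension
    factors. *)
Lemma mfrob_bound A B (c : R) : 0 <= c ->
  (forall x, vnorm (mv A x) <= c * vnorm x) -> mfrob (A *m B) <= c * mfrob B.
Proof.
move=> c0 H; rewrite -(ler_pXn2r (_ : 0 < 2)%N) ?nnegrE ?mulr_ge0 ?mfrob_ge0 //.
rewrite exprMn !mfrob2 big_distrr /=; apply: ler_sum => j _.
rewrite -exprMn ler_pXn2r ?nnegrE ?mulr_ge0 ?vnorm_ge0 //.
apply: le_trans (H _); rewrite le_eqVlt; apply/orP; left; apply/eqP.
by apply: vnorm_eq => i; rewrite mxE.
Qed.

Lemma mfrob_adj A : mfrob (adjmx A) = mfrob A.
Proof.
apply/eqP; rewrite -(eqrXn2 (_ : 0 < 2)%N) ?mfrob_ge0 //; apply/eqP.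
rewrite /mfrob !frobE exchange_big /=; apply: eq_bigr => i _; apply: eq_bigr => j _.
by rewrite adjmxE cabs2_conj.
Qed.

Lemma mfrob_boundr A B (c : R) : 0 <= c ->
  (forall x, vnorm (mv A x) <= c * vnorm x) -> mfrob (B *m A) <= c * mfrob B.
Proof.
move=> c0 H; rewrite -mfrob_adj -[mfrob B]mfrob_adj adjmxM; apply: mfrob_bound => //.
exact: mv_adj_bound.
Qed.

Lemma mfrobD A B : mfrob (A + B) <= mfrob A + mfrob B.
Proof.
apply: le_trans (vnormD _ _); rewrite le_eqVlt; apply/orP; left; apply/eqP.
by apply: vnorm_eq => i; rewrite mxE.
Qed.

Lemma mfrobZ (c : C) A : mfrob (c *: A) = Num.sqrt (cabs2 c) * mfrob A.
Proof. by rewrite -vnormZ; apply: vnorm_eq => i; rewrite mxE. Qed.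

Lemma mfrob_opnorm A : mfrob A ^+ 2 <= d%:R * mx_opnorm A ^+ 2.
Proof.
have -> : d%:R = mfrob 1%:M ^+ 2.
  rewrite /mfrob frobE -[d in LHS]card_ord -sum1_card natr_sum; apply: eq_bigr => i _.
  rewrite (bigD1 i) //= big1 => [|j ji]; last first.
    by rewrite mxE eq_sym (negbTE ji) /cabs2 /= expr0n addr0.
  by rewrite mxE eqxx /cabs2 /= expr0n expr1n !addr0.
rewrite -exprMn ler_pXn2r ?nnegrE ?mulr_ge0 ?mfrob_ge0 ?mx_opnorm_ge0 //.
rewrite mulrC -{1}[A]mulmx1; apply: mfrob_bound; first exact: mx_opnorm_ge0.
exact: mv_le.
Qed.

Lemma mfrob_tr A : ((mfrob A ^+ 2)%:C)%C = \tr (adjmx A *m A).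
Proof.
rewrite mfrob2 rmorph_sum /mxtrace; apply: eq_bigr => j _ /=.
by rewrite -dot_self mxE; apply: eq_bigr => i _; rewrite adjmxE.
Qed.

(** The link between the trace and the metric: upper and lower estimates of x(V) both go through
    this identity. *)
Lemma mfrob_unit_sub U V : isunit U -> isunit V ->
  mfrob (U - V) ^+ 2 = 2 * d%:R - 2 * Re (\tr (adjmx U *m V)).
Proof.
move=> u v; have := mfrob_tr (U - V).
rewrite adjmxD adjmxN mulmxDl !mulmxDr !mulmxN !mulNmx (isunitC u) (isunitC v).
have -> : adjmx V *m U = adjmx (adjmx U *m V) by rewrite adjmxM adjmxK.
rewrite !raddfD !raddfN /= opprK mxtrace1.
have -> : \tr (adjmx (adjmx U *m V)) = conjc (\tr (adjmx U *m V)).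
  by rewrite /mxtrace rmorph_sum; apply: eq_bigr => i _; rewrite adjmxE.
move/(congr1 Re) => /= ->; rewrite !ReD.
have -> : Re (d%:R) = d%:R by rewrite -[d%:R in LHS](rmorph_nat (real_complex R)).
by case: (\tr _) => [a b] /=; ring.
Qed.

End Matrices.

(** * The Borel structure of the unitary group *)

Section UnitaryGroup.
Variables (R : realType) (d : nat).
Local Notation C := (complex R).
Local Notation Re := (@complex.Re R).
Local Notation Im := (@complex.Im R).
Local Notation U := (unitary R d).
Local Notation T := (Umeas R d).

Lemma uP (V : U) : isunit (val V).
Proof. by apply/eqP; exact: (valP V). Qed.

Definition mku (M : 'M[C]_d) (h : isunit M) : U := exist _ M (introT eqP h).

Definition umul (V W : U) : U := mku (isunitM (uP V) (uP W)).
Definition uinv (V : U) : U := mku (isunit_adj (uP V)).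
Definition uone : U := mku (isunit1 R d).

Lemma umulE V W : val (umul V W) = val V *m val W. Proof. by []. Qed.
Lemma uinvE V : val (uinv V) = adjmx (val V). Proof. by []. Qed.

Lemma umulVK V W : umul (uinv V) (umul V W) = W.
Proof. by apply: val_inj; rewrite /= mulmxA (isunitC (uP V)) mul1mx. Qed.

Lemma ratmx_approx (M : 'M[C]_d) (e : R) : 0 < e -> exists q : 'M[rat]_d * 'M[rat]_d,
  mx_opnorm (M - \matrix_(i, j) (ratr (q.1 i j) +i* ratr (q.2 i j))%C) < e.
Proof.
(* With real and imaginary parts approximated to within [c], the squared Frobenius error is at most
   2 d^2 c^2, below e^2 = 4 (d + 1)^2 c^2. *)
move=> e0; pose c : R := e / (2 * (d%:R + 1)).
have d1 : 0 < d%:R + 1 :> R by rewrite ltr_wpDl.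
have c0 : 0 < c by rewrite divr_gt0 // mulr_gt0.
have H (x : R) : exists q : rat, `|x - ratr q| < c.
  have /rat_in_itvoo[q] : x - c < x + c by lra.
  by rewrite in_itv /= => /andP[h1 h2]; exists q; rewrite ltr_norml; lra.
move: H => /choice[f Hf].
exists (\matrix_(i, j) f (Re (M i j)), \matrix_(i, j) f (Im (M i j))).
apply: (le_lt_trans (mx_opnorm_frob _)).
rewrite -(ltr_pXn2r (_ : 0 < 2)%N) ?nnegrE ?mfrob_ge0 ?ltW //.
rewrite /mfrob frobE.
have h : forall i j, cabs2 ((M - \matrix_(i0, j0) (ratr
    ((\matrix_(i, j) f (Re (M i j)) : 'M[rat]_d) i0 j0) +i* ratr ((\matrix_(i, j) f (Im (M i j)) : 'M[rat]_d) i0 j0))%C) i j)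
     <= 2 * c ^+ 2.
  move=> i j; rewrite !mxE; case: (M i j) => [a b] /=; rewrite /cabs2 /=.
  have := Hf a; have := Hf b; rewrite !ltr_norml => /andP[h1 h2] /andP[h3 h4].
  have hh (x : R) : - c < x -> x < c -> x ^+ 2 <= c ^+ 2 by nra.
  by rewrite mulr2n mulrDl !mul1r lerD // hh //; lra.
apply: le_lt_trans (_ : \sum_(i : 'I_d) \sum_(j : 'I_d) 2 * c ^+ 2 < _).
  by apply: ler_sum => i _; apply: ler_sum => j _; exact: h.
rewrite !sumr_const card_ord -mulrnA -[_ *+ _]mulr_natl natrM.
have -> : e = c * (2 * (d%:R + 1)) by rewrite /c divfK // gt_eqF // mulr_gt0.
have : (0 : R) <= d%:R by [].
move: (d%:R : R) => D D0; rewrite -subr_gt0.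
rewrite [X in 0 < X](_ : _ = c ^+ 2 * (4 * (D + 1) ^+ 2 - 2 * D ^+ 2)); last by ring.
by rewrite mulr_gt0 ?exprn_gt0 //; nra.
Qed.

(** Rational matrices are dense but seldom unitary: for each rational matrix and each radius 1/(k+1)
    a unitary matrix within that radius is chosen whenever there is one, and the countably many
    choices are enumerated by [unpickle]. *)
Lemma dense_seq : exists u : nat -> U, forall (V : U) (r : R), 0 < r ->
  exists n, mx_opnorm (val V - val (u n)) < r.
Proof.
pose tc (q : 'M[rat]_d * 'M[rat]_d) : 'M[C]_d :=
  \matrix_(i, j) (ratr (q.1 i j) +i* ratr (q.2 i j))%C.
pose P (q : 'M[rat]_d * 'M[rat]_d * nat) (V : U) :=
   mx_opnorm (val V - tc q.1) < (q.2.+1%:R)^-1.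
have /choice[f Hf] : forall q, exists V, (exists V', P q V') -> P q V.
  move=> q; have [[V PV]|nP] := pselect (exists V', P q V').
    by exists V.
  by exists uone.
exists (fun n => if unpickle n is Some q then f q else uone) => V r r0.
have [k kr] : exists k : nat, (k.+1%:R)^-1 < r / 2.
  have r2 : 0 < r / 2 by rewrite divr_gt0.
  exists (Num.truncn ((r / 2)^-1)).
  by rewrite invf_plt ?posrE // truncnS_gt.
have [q qk] : exists q, mx_opnorm (val V - tc q) < (k.+1%:R)^-1.
  by apply: ratmx_approx; rewrite invr_gt0.
exists (pickle (q, k)); rewrite pickleK.
have := Hf (q, k) (ex_intro _ V qk); rewrite /P.
set W := f _ => Wq.
have -> : val V - val W = (val V - tc q) + (tc q - val W) by rewrite addrA subrK.
apply: (le_lt_trans (mx_opnormD _ _)).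
move: (Wq : mx_opnorm (val W - tc q) < (k.+1%:R)^-1); rewrite mx_opnormB.
move=> h1; move: h1 qk kr; move: (k.+1%:R^-1) => z; lra.
Qed.

Lemma uball_measurable (V : U) (r : R) : measurable (uball V r : set T).
Proof. by apply: sub_sigma_algebra; exists V, r. Qed.

(* Lindelof property of U(d), phrased for any sigma-ideal-like family of balls. *)
Lemma countable_cover (O : set U) (P : set U -> Prop) :
  (forall V, O V -> exists2 r : R, 0 < r & P (uball V r)) ->
  (forall A B, P B -> A `<=` B -> P A) ->
  exists F : nat -> set U, (forall n, F n = set0 \/ (P (F n) /\ measurable (F n : set T))) /\
     O `<=` \bigcup_n F n.
Proof.
move=> H Pm; have [u Hu] := dense_seq.
pose B (p : nat * nat) := uball (u p.1) (p.2.+1%:R)^-1.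
pose F n := if unpickle n is Some p then (if `[< P (B p) >] then B p else set0) else set0.
exists F; split.
  move=> n; rewrite /F; case: unpickle => [p|]; last by left.
  case: asboolP => [h|_]; last by left.
  by right; split => //; exact: uball_measurable.
move=> V OV; have [r r0 Pr] := H V OV.
have [k kr] : exists k : nat, (k.+1%:R)^-1 < r / 2.
  have r2 : 0 < r / 2 by rewrite divr_gt0.
  exists (Num.truncn ((r / 2)^-1)).
  by rewrite invf_plt ?posrE // truncnS_gt.
have k0 : 0 < (k.+1%:R)^-1 :> R by rewrite invr_gt0.
have [n nk] := Hu V _ k0.
exists (pickle (n, k)) => //; rewrite /F pickleK.
suff PB : P (B (n, k)) by rewrite asboolT //; exact: nk.
apply: Pm Pr _ => W h; change (is_true (mx_opnorm (val W - val V) < r)).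
move: (h : is_true (mx_opnorm (val W - val (u n)) < (k.+1%:R)^-1)) => {}h.
have -> : val W - val V = (val W - val (u n)) + (val (u n) - val V) by rewrite addrA subrK.
apply: (le_lt_trans (mx_opnormD _ _)); rewrite [X in _ + X]mx_opnormB.
by move: h nk kr; move: (k.+1%:R^-1) => z; lra.
Qed.

Lemma uopen_measurable (O : set U) :
  (forall V, O V -> exists2 r : R, 0 < r & uball V r `<=` O) -> measurable (O : set T).
Proof.
move=> H; have [|F [HF OF]] := @countable_cover O (fun A => A `<=` O) H.
  by move=> A B AB BO; apply: subset_trans BO AB.
have -> : O = \bigcup_n F n.
  apply/seteqP; split => // V [n _ FV]; have [F0|[h _]] := HF n; last exact: h.
  by move: FV; rewrite F0.
apply: bigcupT_measurable => n; have [->|[_ //]] := HF n; exact: measurable0.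
Qed.

(** The covering lemma again, now with the sets contained in a measurable null set; this is how sets
    missing the support are seen to be null. *)
Lemma null_cover (nu : probability T R) (O : set U) :
  (forall V, O V -> exists2 r : R, 0 < r & nu (uball V r) = 0%E) ->
  measurable (O : set T) -> nu O = 0%E.
Proof.
move=> H mO.
have [||F [HF OF]] := @countable_cover O (fun A => exists B : set T, [/\ measurable B, A `<=` B & nu B = 0%E]).
- move=> V /H[r r0 h]; exists r => //; exists (uball V r); split => //.
  exact: uball_measurable.
- by move=> A B [X [mX BX X0]] AB; exists X; split => //; exact: subset_trans AB BX.
have mF n : measurable (F n : set T).
  by have [->|[_ //]] := HF n; exact: measurable0.
have F0 n : nu (F n) = 0%E.
  have [->|[[B [mB FB B0]] _]] := HF n; first exact: measure0.
  by apply: subset_measure0 B0.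
have : nu.-negligible (\bigcup_n F n).
  apply: negligible_bigcup => n; exists (F n); split; [exact: mF|exact: F0|exact: subset_refl].
case=> A [mA A0 FA]; apply: (@subset_measure0 _ T R nu O A) => //.
exact: subset_trans OF FA.
Qed.

Lemma cont_measurable (f : T -> R) :
  (forall (V : U) (e : R), 0 < e -> exists2 r : R, 0 < r &
    forall W : U, uball V r W -> `|f W - f V| < e) -> measurable_fun setT f.
Proof.
move=> H mD; apply: (measurability _ (RGenOInfty.measurableE R)) => //.
move=> /= _ [_ [x ->] <-]; rewrite setTI; apply: uopen_measurable => V /=.
rewrite in_itv /= andbT => xV.
have e0 : 0 < f V - x by rewrite subr_gt0.
have [r r0 Hr] := H V _ e0; exists r => // W /Hr /=.
by rewrite in_itv /= andbT ltr_norml => /andP[h1 h2]; lra.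
Qed.

Lemma entry_le_opnorm (M : 'M[C]_d) i j : cabs2 (M i j) <= mx_opnorm M ^+ 2.
Proof.
pose e : 'I_d -> C := fun k => (k == j)%:R.
have e1 : vnorm e = 1.
  rewrite /vnorm (bigD1 j) //= big1 ?addr0 => [|k kj].
    by rewrite /e eqxx /cabs2 /= expr1n expr0n addr0 sqrtr1.
  by rewrite /e (negbTE kj) /cabs2 /= expr0n addr0.
have := mv_le M e; rewrite e1 mulr1 => h.
apply: le_trans (_ : vnorm (mv M e) ^+ 2 <= _); last first.
  by rewrite ler_pXn2r ?nnegrE ?vnorm_ge0 ?mx_opnorm_ge0.
have -> : M i j = mv M e i; last exact: vnorm_comp.
rewrite /mv /fapp (bigD1 j) //= /e eqxx mulr1 big1 ?addr0 // => k kj.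
by rewrite (negbTE kj) mulr0.
Qed.

Lemma entry_measurable i j :
  measurable_fun setT (fun V : T => Re (val V i j)) /\
  measurable_fun setT (fun V : T => Im (val V i j)).
Proof.
split; apply: cont_measurable => V e e0; exists e => // W; rewrite /uball /=.
  move=> h; rewrite -(ltr_pXn2r (_ : 0 < 2)%N) ?nnegrE ?normr_ge0 ?(ltW e0) //.
  rewrite -normrX ger0_norm ?sqr_ge0 //.
  apply: le_lt_trans (_ : mx_opnorm (val W - val V) ^+ 2 < _); last first.
    by rewrite ltr_pXn2r ?nnegrE ?mx_opnorm_ge0 ?(ltW e0) //.
  apply: le_trans (entry_le_opnorm _ i j); rewrite !mxE.
  by case: (fun_of_matrix _ _ _) (fun_of_matrix _ _ _) => [a b] [p q]; rewrite /cabs2 /= lerDl sqr_ge0.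
move=> h; rewrite -(ltr_pXn2r (_ : 0 < 2)%N) ?nnegrE ?normr_ge0 ?(ltW e0) //.
rewrite -normrX ger0_norm ?sqr_ge0 //.
apply: le_lt_trans (_ : mx_opnorm (val W - val V) ^+ 2 < _); last first.
  by rewrite ltr_pXn2r ?nnegrE ?mx_opnorm_ge0 ?(ltW e0) //.
apply: le_trans (entry_le_opnorm _ i j); rewrite !mxE.
by case: (fun_of_matrix _ _ _) (fun_of_matrix _ _ _) => [a b] [p q]; rewrite /cabs2 /= lerDr sqr_ge0.
Qed.

Lemma unit_entry (V : U) i j : cabs2 (val V i j) <= 1.
Proof.
apply: (le_trans (entry_le_opnorm _ i j)).
by rewrite expr_le1 ?mx_opnorm_ge0 // opnorm_unit //; exact: uP.
Qed.

Lemma uball_preimage (V W : U) (r : R) : (umul V @^-1` uball W r) = uball (umul (uinv V) W) r.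
Proof.
apply/seteqP; split => X; rewrite /uball /= => h.
  rewrite -(opnorm_unitl _ (uP V)) mulmxBr !mulmxA (uP V) mul1mx; exact: h.
move: h; rewrite -[in X in X -> _](opnorm_unitl _ (uP V)) mulmxBr !mulmxA (uP V) mul1mx; exact.
Qed.

Lemma umul_measurable (V : U) : measurable_fun setT (umul V : T -> T).
Proof.
move=> mD; apply: (@measurability _ _ T T setT (umul V) (@uballs R d)) => //.
move=> /= _ [_ [W [r ->]] <-]; rewrite setTI.
rewrite uball_preimage; exact: uball_measurable.
Qed.

(** [is_haar] speaks of images; the preimage under V is the image under its inverse, and preimages
    are what a change of variables asks for. *)
Lemma haar_preimage (mu : probability T R) : is_haar mu -> forall (V : U) (A : set T),
  measurable A -> mu (umul V @^-1` A) = mu A.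
Proof.
move=> H V A mA; rewrite -(H (uinv V : T) A mA); congr (mu _).
apply/seteqP; split => W /=.
  move=> h; exists (umul V W : T) => //.
  by rewrite -[RHS]/(val (umul (uinv V) (umul V W))) umulVK.
by move=> [X AX e]; have -> : umul V W = X; [apply: val_inj; rewrite /= e mulmxA (uP V) mul1mx|].
Qed.

End UnitaryGroup.

(** * Integrals of bounded measurable functions *)

Section Expectation.
Variables (R : realType) (disp : measure_display) (T : measurableType disp).
Implicit Types (f g : T -> R) (nu : probability T R).

(** Closed under ring operations and integrable for every probability measure, so that integrability
    conditions become structural goals. *)
Definition bm f := measurable_fun setT f /\ exists M, forall x, `|f x| <= M.

Definition ER nu f : R := fine (\int[nu]_x (f x)%:E).

Lemma bm_cst (c : R) : bm (fun=> c).
Proof. by split; [exact: measurable_cst|exists `|c|]. Qed.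

Lemma bmD f g : bm f -> bm g -> bm (fun x => f x + g x).
Proof.
move=> [mf [M HM]] [mg [N HN]]; split; first exact: measurable_funD.
by exists (M + N) => x; apply: (le_trans (ler_normD _ _)); rewrite lerD.
Qed.

Lemma bmM f g : bm f -> bm g -> bm (fun x => f x * g x).
Proof.
move=> [mf [M HM]] [mg [N HN]]; split; first exact: measurable_funM.
exists (M * N) => x; rewrite normrM ler_pM //; exact: normr_ge0.
Qed.

Lemma bmZ (c : R) f : bm f -> bm (fun x => c * f x).
Proof. by apply: bmM; exact: bm_cst. Qed.

Lemma bmN f : bm f -> bm (fun x => - f x).
Proof.
move=> h; have := bmZ (-1) h; congr bm; apply/funext => x; exact: mulN1r.
Qed.

Lemma bmB f g : bm f -> bm g -> bm (fun x => f x - g x).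
Proof. by move=> hf hg; apply: bmD => //; exact: bmN. Qed.

Lemma bmX f n : bm f -> bm (fun x => f x ^+ n).
Proof.
move=> h; elim: n => [|n IH]; first exact: (bm_cst 1).
by have := bmM h IH; congr bm; apply/funext => x; rewrite exprS.
Qed.

Lemma bm_sum (I : Type) (r : seq I) (F : I -> T -> R) :
  (forall i, bm (F i)) -> bm (fun x => \sum_(i <- r) F i x).
Proof.
move=> H; elim: r => [|i r IH].
  by have := bm_cst 0; congr bm; apply/funext => x; rewrite big_nil.
by have := bmD (H i) IH; congr bm; apply/funext => x; rewrite big_cons.
Qed.

Lemma bm_indic (A : set T) : measurable A -> bm (\1_A : T -> R).
Proof.
move=> mA; split; first exact: measurable_indic.
exists 1 => x; rewrite indicE; case: (x \in A) => /=; rewrite ?normr1 ?normr0 //.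
Qed.

Lemma bm_integrable nu f : bm f -> nu.-integrable setT (EFin \o f).
Proof.
move=> [mf [M HM]]; apply: measurable_bounded_integrable => //.
  by apply: le_lt_trans (probability_le1 nu measurableT) _; rewrite ltry.
exists M; split; first exact: num_real.
by move=> N MN x _; apply: (le_trans (HM x)); exact: ltW.
Qed.

Lemma ERD nu f g : bm f -> bm g -> ER nu (fun x => f x + g x) = ER nu f + ER nu g.
Proof. by move=> hf hg; apply: (@RintegralD _ _ _ nu) => //; exact: bm_integrable. Qed.

Lemma ERZ nu (c : R) f : bm f -> ER nu (fun x => c * f x) = c * ER nu f.
Proof. by move=> hf; apply: (@RintegralZl _ _ _ nu) => //; exact: bm_integrable. Qed.

Lemma ER_cst nu (c : R) : ER nu (fun=> c) = c.
Proof.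
by rewrite /ER (@integral_cst _ _ _ nu) //= [nu _]probability_setT mule1.
Qed.

Lemma ERN nu f : bm f -> ER nu (fun x => - f x) = - ER nu f.
Proof.
move=> hf; rewrite -mulN1r -ERZ //; congr ER; apply/funext => x; rewrite mulN1r //.
Qed.

Lemma ERB nu f g : bm f -> bm g -> ER nu (fun x => f x - g x) = ER nu f - ER nu g.
Proof. by move=> hf hg; rewrite ERD ?ERN //; exact: bmN. Qed.

Lemma ER_sum nu (I : Type) (r : seq I) (F : I -> T -> R) :
  (forall i, bm (F i)) ->
  ER nu (fun x => \sum_(i <- r) F i x) = \sum_(i <- r) ER nu (F i).
Proof.
move=> H; elim: r => [|i r IH].
  rewrite big_nil -[RHS](ER_cst nu 0); congr ER; apply/funext => x; rewrite big_nil //.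
rewrite big_cons -IH -ERD //; last exact: bm_sum.
by congr ER; apply/funext => x; rewrite big_cons.
Qed.

Lemma ER_le nu f g : bm f -> bm g -> (forall x, f x <= g x) -> ER nu f <= ER nu g.
Proof.
by move=> hf hg h; apply: le_Rintegral => //; exact: bm_integrable.
Qed.

Lemma ER_ge0 nu f : (forall x, 0 <= f x) -> 0 <= ER nu f.
Proof. by move=> h; apply: Rintegral_ge0. Qed.

Lemma ER_indic nu (A : set T) : measurable A -> ER nu (\1_A) = fine (nu A).
Proof. by move=> mA; rewrite /ER integral_indic // setIT. Qed.

(** Everywhere f <= c + (M + |c|) 1_A, and the right-hand side has integral c. *)
Lemma ER_le_ae nu f (c : R) (A : set T) : bm f -> measurable A -> nu A = 0%E ->
  (forall x, ~ A x -> f x <= c) -> ER nu f <= c.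
Proof.
move=> hf mA A0 h; have [_ [M HM]] := hf.
have hi := bm_indic mA.
have -> : c = ER nu (fun x => c + (M + `|c|) * \1_A x).
  rewrite ERD ?ERZ ?ER_cst ?ER_indic ?A0 ?mulr0 ?addr0 //; first exact: bm_cst.
  exact: bmZ.
apply: ER_le => // [|x]; first by apply: bmD; [exact: bm_cst|exact: bmZ].
rewrite indicE; have [Ax|Ax] := pselect (A x).
  rewrite mem_set // mulr1; apply: (le_trans (ler_norm _)); apply: (le_trans (HM x)).
  by have := ler_norm (- c); rewrite normrN; lra.
by rewrite memNset // mulr0 addr0; exact: h.
Qed.

Lemma ER_push nu f (phi : T -> T) : measurable_fun setT phi -> bm f ->
  (forall A, measurable A -> nu (phi @^-1` A) = nu A) ->
  ER nu (fun x => f (phi x)) = ER nu f.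
Proof.
move=> mphi hf H; rewrite /ER; congr fine.
transitivity (\int[pushforward nu phi]_x (f x)%:E)%E; last first.
  by apply: eq_measure_integral => A mA _; exact: H.
have hf' : bm (f \o phi).
  case: hf => mf [M HM]; split; first exact: measurableT_comp.
  by exists M => x; exact: HM.
rewrite integral_pushforward //.
- by case: hf => mf _; apply/measurable_EFinP.
- exact: bm_integrable hf'.
Qed.

End Expectation.

Section ComplexExpectation.
Variables (R : realType) (d : nat).
Local Notation C := (complex R).
Local Notation Re := (@complex.Re R).
Local Notation Im := (@complex.Im R).
Local Notation U := (unitary R d).
Local Notation T := (Umeas R d).
Implicit Types (f g : T -> C) (nu : probability T R).

Definition cbm f := bm (fun x => Re (f x)) /\ bm (fun x => Im (f x)).

Lemma cE nu f : cintegral nu f = (ER nu (fun x => Re (f x)) +i* ER nu (fun x => Im (f x)))%C.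
Proof. by []. Qed.

Lemma cbm_real (f : T -> R) : bm f -> cbm (fun x => ((f x)%:C)%C).
Proof. by move=> h; split => //; exact: (@bm_cst R _ T 0). Qed.

Lemma cbm_cst (c : C) : cbm (fun=> c).
Proof. by split; exact: bm_cst. Qed.

Lemma cbmD f g : cbm f -> cbm g -> cbm (fun x => f x + g x).
Proof.
move=> [rf jf] [rg jg]; split.
  by have := bmD rf rg; congr bm; apply/funext => x; rewrite ReD.
by have := bmD jf jg; congr bm; apply/funext => x; rewrite ImD.
Qed.

Lemma ReM (z w : C) : Re (z * w) = Re z * Re w - Im z * Im w.
Proof. by case: z w => [a b] [c e]. Qed.

Lemma ImM (z w : C) : Im (z * w) = Re z * Im w + Im z * Re w.
Proof. by case: z w => [a b] [c e]; rewrite /= addrC. Qed.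

Lemma cbmM f g : cbm f -> cbm g -> cbm (fun x => f x * g x).
Proof.
move=> [rf jf] [rg jg]; split.
  by have := bmB (bmM rf rg) (bmM jf jg); congr bm; apply/funext => x; rewrite ReM.
by have := bmD (bmM rf jg) (bmM jf rg); congr bm; apply/funext => x; rewrite ImM.
Qed.

Lemma cbm_conj f : cbm f -> cbm (fun x => conjc (f x)).
Proof.
move=> [rf jf]; split.
  by move: rf; congr bm; apply/funext => x; case: (f x).
by move: (bmN jf); congr bm; apply/funext => x; case: (f x).
Qed.

Lemma cbm_sum (I : Type) (r : seq I) (F : I -> T -> C) :
  (forall i, cbm (F i)) -> cbm (fun x => \sum_(i <- r) F i x).
Proof.
move=> H; elim: r => [|i r IH].
  by have := cbm_cst 0; congr cbm; apply/funext => x; rewrite big_nil.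
by have := cbmD (H i) IH; congr cbm; apply/funext => x; rewrite big_cons.
Qed.

Lemma cbm_prod (I : Type) (r : seq I) (F : I -> T -> C) :
  (forall i, cbm (F i)) -> cbm (fun x => \prod_(i <- r) F i x).
Proof.
move=> H; elim: r => [|i r IH].
  by have := cbm_cst 1; congr cbm; apply/funext => x; rewrite big_nil.
by have := cbmM (H i) IH; congr cbm; apply/funext => x; rewrite big_cons.
Qed.

Lemma cbm_entry i j : cbm (fun V : T => val V i j).
Proof.
have [h1 h2] := entry_measurable R i j.
have b (V : T) : Re (val V i j) ^+ 2 <= 1 /\ Im (val V i j) ^+ 2 <= 1.
  have := unit_entry (V : U) i j; rewrite /cabs2.
  have := sqr_ge0 (Re (val V i j)); have := sqr_ge0 (Im (val V i j)).
  by move=> *; split; lra.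
split; split => //; exists 1 => V; have [b1 b2] := b V;
  by rewrite -(ler_pXn2r (_ : 0 < 2)%N) ?nnegrE ?normr_ge0 // -normrX ger0_norm ?sqr_ge0 // expr1n.
Qed.

Lemma cED nu f g : cbm f -> cbm g ->
  cintegral nu (fun x => f x + g x) = cintegral nu f + cintegral nu g.
Proof.
move=> [rf jf] [rg jg]; rewrite !cE.
have -> : (fun x => Re (f x + g x)) = (fun x => Re (f x) + Re (g x)).
  by apply/funext => x; rewrite ReD.
have -> : (fun x => Im (f x + g x)) = (fun x => Im (f x) + Im (g x)).
  by apply/funext => x; rewrite ImD.
by rewrite !ERD //; apply/eqP; rewrite eq_complex /= !eqxx.
Qed.

Lemma cEZ nu (c : C) f : cbm f -> cintegral nu (fun x => c * f x) = c * cintegral nu f.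
Proof.
move=> [rf jf]; rewrite !cE.
have -> : (fun x => Re (c * f x)) = (fun x => Re c * Re (f x) - Im c * Im (f x)).
  by apply/funext => x; rewrite ReM.
have -> : (fun x => Im (c * f x)) = (fun x => Re c * Im (f x) + Im c * Re (f x)).
  by apply/funext => x; rewrite ImM.
rewrite ERB ?ERD ?ERZ //; try exact: bmZ.
by case: c => a b; apply/eqP; rewrite eq_complex /= eqxx /= addrC.
Qed.

Lemma cE_cst nu (c : C) : cintegral nu (fun=> c) = c.
Proof. by rewrite cE !ER_cst; case: c. Qed.

Lemma cE_sum nu (I : Type) (r : seq I) (F : I -> T -> C) :
  (forall i, cbm (F i)) ->
  cintegral nu (fun x => \sum_(i <- r) F i x) = \sum_(i <- r) cintegral nu (F i).
Proof.
move=> H; elim: r => [|i r IH].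
  rewrite big_nil -[RHS](cE_cst nu 0); congr (cintegral nu); apply/funext => x; rewrite big_nil //.
rewrite big_cons -IH -cED //; last exact: cbm_sum.
by congr (cintegral nu); apply/funext => x; rewrite big_cons.
Qed.

Lemma cE_conj nu f : cbm f -> cintegral nu (fun x => conjc (f x)) = conjc (cintegral nu f).
Proof.
move=> [rf jf]; rewrite !cE /= -ERN //; apply/eqP; rewrite eq_complex /=; apply/andP; split;
  by apply/eqP; congr ER; apply/funext => x; case: (f x).
Qed.

Lemma cE_real nu (f : T -> R) : cintegral nu (fun x => ((f x)%:C)%C) = ((ER nu f)%:C)%C.
Proof. by rewrite cE /= ER_cst. Qed.

Lemma haar_ER (mu : probability T R) (f : T -> R) (V : U) : is_haar mu -> bm f ->
  ER mu (fun W : T => f (umul V W)) = ER mu f.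
Proof.
move=> H hf; apply: (@ER_push R _ T mu f (umul V)) => //; first exact: umul_measurable.
exact: haar_preimage.
Qed.

Lemma haar_cE (mu : probability T R) f (V : U) : is_haar mu -> cbm f ->
  cintegral mu (fun W : T => f (umul V W)) = cintegral mu f.
Proof.
by move=> H [rf jf]; rewrite !cE (haar_ER V H rf) (haar_ER V H jf).
Qed.

End ComplexExpectation.

Arguments tens_entry {R t d}.

(** * Growth of powers, and Cauchy-Schwarz in L^2(mu) *)

Lemma bernoulli_le (R : realType) (u : R) n : 0 <= u -> 1 + n%:R * u <= (1 + u) ^+ n.
Proof.
move=> u0; elim: n => [|n IH]; first by rewrite mul0r addr0 expr0.
rewrite exprS; apply: le_trans (_ : (1 + u) * (1 + n%:R * u) <= _); last first.
  by rewrite ler_pM2l // ltr_wpDr.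
rewrite -natr1 -subr_ge0 [X in 0 <= X](_ : _ = n%:R * u ^+ 2); last by ring.
by rewrite mulr_ge0 // sqr_ge0.
Qed.

(** If a / b = 1 + u with u > 0, Bernoulli makes the ratio of the powers at least 1 + k u, which
    exceeds K for large k. *)
Lemma le_of_pow2 (R : realType) (a b K : R) : 0 <= a -> 0 <= b ->
  (forall k, a ^+ (2 ^ k) <= K * b ^+ (2 ^ k)) -> a <= b.
Proof.
move=> a0 b0 H; rewrite leNgt; apply/negP => ab.
have b1 : 0 < b.
  rewrite lt_neqAle b0 andbT; apply/eqP => b00.
  by have := H 0%N; rewrite expn0 !expr1 -b00 mulr0 leNgt (le_lt_trans b0 ab).
pose u := a / b - 1.
have u0 : 0 < u by rewrite subr_gt0 ltr_pdivlMr ?mul1r.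
have aE : a = b * (1 + u) by rewrite /u addrC subrK mulrC divfK // gt_eqF.
have K1 k : 1 + k%:R * u <= K.
  apply: le_trans (bernoulli_le k (ltW u0)) _.
  apply: le_trans (_ : (1 + u) ^+ (2 ^ k) <= _).
    by apply: ler_weXn2l; [lra|apply: ltnW; exact: ltn_expl].
  have := H k; rewrite {1}aE exprMn mulrC ler_pM2r ?exprn_gt0 //.
have := K1 (Num.truncn (K / u)).+1.
have : K / u < (Num.truncn (K / u)).+1%:R by exact: truncnS_gt.
by rewrite ltr_pdivrMr //; lra.
Qed.

Section L2.
Variables (R : realType) (d : nat).
Local Notation C := (complex R).
Local Notation Re := (@complex.Re R).
Local Notation U := (unitary R d).
Local Notation T := (Umeas R d).
Variable mu : probability T R.

Lemma bm_cabs2 (f : T -> C) : cbm f -> bm (fun x => cabs2 (f x)).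
Proof. by move=> [rf jf]; apply: bmD; apply: bmX. Qed.

Lemma ER_cs (f g : T -> C) : cbm f -> cbm g ->
  (ER mu (fun V => Re (conjc (f V) * g V))) ^+ 2
    <= ER mu (fun V => cabs2 (f V)) * ER mu (fun V => cabs2 (g V)).
Proof.
move=> cf cg.
have bfg : bm (fun V => Re (conjc (f V) * g V)) by have [] := cbmM (cbm_conj cf) cg.
apply: discr_le => [|s]; first by apply: ER_ge0 => V; exact: cabs2_ge0.
have -> : ER mu (fun V => cabs2 (f V)) + 2 * s * ER mu (fun V => Re (conjc (f V) * g V))
   + s ^+ 2 * ER mu (fun V => cabs2 (g V)) =
   ER mu (fun V => cabs2 (f V) + 2 * s * Re (conjc (f V) * g V) + s ^+ 2 * cabs2 (g V)).
  have b1 := bm_cabs2 cf; have b2 := bm_cabs2 cg.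
  have b3 := bmZ (2 * s) bfg; have b4 := bmZ (s ^+ 2) b2.
  by rewrite (ERD mu (bmD b1 b3) b4) (ERD mu b1 b3) !ERZ.
apply: ER_ge0 => V.
rewrite [X in 0 <= X](_ : _ = cabs2 (f V + (s%:C)%C * g V)) ?cabs2_ge0 //.
by case: (f V) (g V) => [a b] [c e]; rewrite /cabs2 /=; ring.
Qed.

End L2.

(** * Matrix coefficients and the contraction property *)

Section Tensor.
Variables (R : realType) (d t : nat).
Local Notation C := (complex R).
Local Notation Re := (@complex.Re R).
Local Notation U := (unitary R d).
Local Notation T := (Umeas R d).
Local Notation I := (tidx t d).

(** V -> V^{t,t} is multiplicative: a product over tensor slots of sums expands into a sum over
    index functions. *)
Lemma tens_mul (A B : 'M[C]_d) (a b : I) :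
  tens_entry (A *m B) a b = \sum_(c : I) tens_entry A a c * tens_entry B c b.
Proof.
have H (P Q : 'I_t -> 'I_d -> C) :
   \prod_(k < t) \sum_(j < d) P k j * Q k j =
   \sum_(f : {ffun 'I_t -> 'I_d}) (\prod_(k < t) P k (f k)) * \prod_(k < t) Q k (f k).
  rewrite bigA_distr_bigA /=; apply: eq_bigr => f _.
  by rewrite -big_split.
rewrite /tens_entry.
have -> : \prod_(k < t) (A *m B) (a.1 k) (b.1 k) =
   \prod_(k < t) \sum_(j < d) A (a.1 k) j * B j (b.1 k).
  by apply: eq_bigr => k _; rewrite mxE.
have -> : \prod_(k < t) conjc ((A *m B) (a.2 k) (b.2 k)) =
   \prod_(k < t) \sum_(j < d) conjc (A (a.2 k) j) * conjc (B j (b.2 k)).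
  apply: eq_bigr => k _; rewrite mxE rmorph_sum; apply: eq_bigr => j _.
  by rewrite rmorphM.
rewrite !H big_distrl /=.
under eq_bigr do rewrite big_distrr /=.
rewrite pair_big /=; apply: eq_bigr => -[f g] _ /=; ring.
Qed.

Lemma tens_adj (A : 'M[C]_d) (a b : I) :
  tens_entry (adjmx A) a b = conjc (tens_entry A b a).
Proof.
rewrite /tens_entry rmorphM !rmorph_prod /=; congr (_ * _); apply: eq_bigr => k _;
  by rewrite adjmxE.
Qed.

Lemma cbm_tens (a b : I) : cbm (fun V : T => tens_entry (val V) a b).
Proof.
apply: cbmM; apply: cbm_prod => k; first exact: cbm_entry.
apply: (@cbm_conj R d (fun V => val V _ _)); exact: cbm_entry.
Qed.

Lemma tens_le1 (V : U) (a b : I) : cabs2 (tens_entry (val V) a b) <= 1.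
Proof.
have H (J : Type) (r : seq J) (F : J -> C) : (forall j, cabs2 (F j) <= 1) ->
    cabs2 (\prod_(j <- r) F j) <= 1.
  move=> HF; elim: r => [|j r IH]; first by rewrite big_nil /cabs2 /= expr1n expr0n addr0.
  by rewrite big_cons cabs2M mulr_ile1 ?cabs2_ge0.
rewrite /tens_entry cabs2M mulr_ile1 ?cabs2_ge0 //; apply: H => j.
  exact: unit_entry.
by rewrite cabs2_conj; exact: unit_entry.
Qed.

Definition fmul (X Y : I -> I -> C) := fun i k => \sum_j X i j * Y j k.

(* tr (X V^{t,t}), where V^{t,t} is the matrix [tens_entry V]. *)
Definition coefn (X : I -> I -> C) (V : U) : C :=
  \sum_b \sum_a X b a * tens_entry (val V) a b.

(** The entry (q, p) of V^{t,t} X, that is, the coefficient of [Z p q] in [coefn (fmul X Z) V]. It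
    makes averages over Z explicit as linear forms. *)
Definition coefpq (X : I -> I -> C) p q (V : U) : C :=
  \sum_b X b p * tens_entry (val V) q b.

Lemma cbm_coefpq X p q : cbm (coefpq X p q : T -> C).
Proof. by apply: cbm_sum => b; apply: cbmM; [exact: cbm_cst|exact: cbm_tens]. Qed.

Lemma cbm_coefn X : cbm (coefn X : T -> C).
Proof.
by apply: cbm_sum => b; apply: cbm_sum => a; apply: cbmM; [exact: cbm_cst|exact: cbm_tens].
Qed.

Lemma coefn_fmul X Z V : coefn (fmul X Z) V = \sum_p \sum_q Z p q * coefpq X p q V.
Proof.
rewrite /coefn /coefpq /fmul.
transitivity (\sum_b \sum_a \sum_j (X b j * Z j a * tens_entry (val V) a b)).
  by apply: eq_bigr => b _; apply: eq_bigr => a _; rewrite big_distrl.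
under eq_bigr do rewrite exchange_big /=.
rewrite exchange_big /=; apply: eq_bigr => p _.
rewrite exchange_big /=; apply: eq_bigr => q _.
by rewrite big_distrr /=; apply: eq_bigr => b _; ring.
Qed.

Definition rho (V : U) : I -> I -> C := fun a b => tens_entry (val V) a b.

(** Translating the argument on the left is multiplying the parameter [X] on the right, so the
    contraction argument can take place on parameters. *)
Lemma coefn_umul X V W : coefn X (umul V W) = coefn (fmul X (rho V)) W.
Proof.
rewrite /coefn /fmul; apply: eq_bigr => b _.
under eq_bigr do rewrite umulE tens_mul big_distrr /=.
rewrite exchange_big /=; apply: eq_bigr => p _.
by rewrite big_distrl /=; apply: eq_bigr => q _; rewrite /rho; ring.
Qed.

Lemma rho_inv V : rho (uinv V) = fadj (rho V).
Proof. by apply/funext => a; apply/funext => b; rewrite /rho /fadj uinvE tens_adj. Qed.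

Section Moment.
Variable nu : probability T R.

Lemma moment_lin (k : I -> I -> C) :
  cintegral nu (fun V => \sum_p \sum_q k p q * rho V p q) =
  \sum_p \sum_q k p q * moment_op t nu p q.
Proof.
rewrite cE_sum => [|p]; last first.
  by apply: cbm_sum => q; apply: cbmM; [exact: cbm_cst|exact: cbm_tens].
apply: eq_bigr => p _; rewrite cE_sum => [|q]; last first.
  by apply: cbmM; [exact: cbm_cst|exact: cbm_tens].
by apply: eq_bigr => q _; rewrite cEZ //; exact: cbm_tens.
Qed.

(** Convolution by nu acts on parameters as right multiplication by the adjoint of the moment
    operator. *)
Lemma coefn_moment_adj X (W : U) :
  coefn (fmul X (fadj (moment_op t nu))) W =
  cintegral nu (fun V => coefn X (umul (uinv V) W)).
Proof.
under [X in cintegral nu X]eq_fun do rewrite coefn_umul coefn_fmul rho_inv.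
rewrite coefn_fmul /fadj exchange_big /=.
transitivity (\sum_q \sum_p coefpq X p q W * conjc (moment_op t nu q p)).
  by apply: eq_bigr => q _; apply: eq_bigr => p _; rewrite mulrC.
transitivity (conjc (\sum_q \sum_p conjc (coefpq X p q W) * moment_op t nu q p)).
  rewrite rmorph_sum; apply: eq_bigr => q _; rewrite rmorph_sum; apply: eq_bigr => p _.
  by rewrite rmorphM /= conjcK.
rewrite -moment_lin -cE_conj; last first.
  by apply: cbm_sum => p; apply: cbm_sum => q; apply: cbmM; [exact: cbm_cst|exact: cbm_tens].
congr (cintegral nu); apply/funext => V; rewrite exchange_big /=.
rewrite rmorph_sum; apply: eq_bigr => q _; rewrite rmorph_sum; apply: eq_bigr => p _.
by rewrite rmorphM /= conjcK mulrC.
Qed.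

End Moment.

Section Contract.
Variables (mu nu : probability T R).
Hypothesis mu_haar : is_haar mu.

Definition dmom : I -> I -> C := fun a b => moment_op t nu a b - moment_op t mu a b.

(** The L^2(mu) product read on parameters. Distinct parameters may define the same function, so it
    is only positive semidefinite; Cauchy-Schwarz still holds. *)
Definition cip (X Y : I -> I -> C) : C :=
  cintegral mu (fun V => conjc (coefn X V) * coefn Y V).

Lemma cip_mulr X Y Z : cip X (fmul Y Z) =
  \sum_p \sum_q cintegral mu (fun V => conjc (coefn X V) * coefpq Y p q V) * Z p q.
Proof.
rewrite /cip; under [X in cintegral mu X]eq_fun do rewrite coefn_fmul big_distrr /=.
have cX := cbm_conj (cbm_coefn X).
rewrite cE_sum => [|p]; last first.
  apply: cbmM => //; apply: cbm_sum => q; apply: cbmM; [exact: cbm_cst|exact: cbm_coefpq].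
apply: eq_bigr => p _; under [X in cintegral mu X]eq_fun do rewrite big_distrr /=.
rewrite cE_sum => [|q]; last first.
  apply: cbmM => //; apply: cbmM; [exact: cbm_cst|exact: cbm_coefpq].
apply: eq_bigr => q _; rewrite mulrC -cEZ; last by apply: cbmM => //; exact: cbm_coefpq.
by congr (cintegral mu); apply/funext => V; ring.
Qed.

Lemma cip_adjl X Y Z : cip (fmul X (fadj Z)) Y =
  \sum_p \sum_q cintegral mu (fun V => conjc (coefpq X q p V) * coefn Y V) * Z p q.
Proof.
rewrite /cip exchange_big /=.
have cY := cbm_coefn Y.
have cX p q := cbm_conj (cbm_coefpq X p q).
transitivity (cintegral mu (fun V => \sum_p \sum_q (Z q p * (conjc (coefpq X p q V) * coefn Y V)))).
  congr (cintegral mu); apply/funext => V; rewrite coefn_fmul rmorph_sum big_distrl /=.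
  apply: eq_bigr => p _; rewrite rmorph_sum big_distrl /=; apply: eq_bigr => q _.
  by rewrite /fadj rmorphM /= conjcK; ring.
have h p q : cbm (fun V : T => Z q p * (conjc (coefpq X p q V) * coefn Y V)).
  by apply: cbmM; [exact: cbm_cst|apply: cbmM].
rewrite cE_sum => [|p]; last exact: cbm_sum.
apply: eq_bigr => p _; rewrite cE_sum //; apply: eq_bigr => q _.
by rewrite cEZ ?(mulrC (Z q p)) //; apply: cbmM.
Qed.

(** Haar invariance under V -> W V: each translation is unitary for the L^2(mu) product. *)
Lemma cip_rho X Y (W : U) : cip (fmul X (fadj (rho W))) Y = cip X (fmul Y (rho W)).
Proof.
rewrite /cip -(@haar_cE R d mu (fun V => conjc (coefn (fmul X (fadj (rho W))) V) * coefn Y V) W) //; last first.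
  apply: cbmM; [apply: cbm_conj|]; exact: cbm_coefn.
congr (cintegral mu); apply/funext => V.
by rewrite -rho_inv -coefn_umul umulVK coefn_umul.
Qed.

(** Both sides are linear in the moment operator, so the identity for a single translation [rho W]
    can be averaged over W, for nu and for mu. *)
Lemma cip_dmom X Y : cip (fmul X (fadj dmom)) Y = cip X (fmul Y dmom).
Proof.
rewrite cip_adjl cip_mulr.
have H (n : probability T R) :
   \sum_p \sum_q cintegral mu (fun V => conjc (coefpq X q p V) * coefn Y V) * moment_op t n p q =
   \sum_p \sum_q cintegral mu (fun V => conjc (coefn X V) * coefpq Y p q V) * moment_op t n p q.
  rewrite -!moment_lin; congr (cintegral n); apply/funext => V.
  by rewrite -cip_adjl cip_rho cip_mulr.
have S (k : I -> I -> C) : \sum_p \sum_q k p q * dmom p q =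
   (\sum_p \sum_q k p q * moment_op t nu p q) - (\sum_p \sum_q k p q * moment_op t mu p q).
  rewrite -sumrB; apply: eq_bigr => p _; rewrite -sumrB; apply: eq_bigr => q _.
  by rewrite mulrBr.
by rewrite !S !H.
Qed.

Definition ip X Y := Re (cip X Y).

Lemma ip_sym X Y : ip X Y = ip Y X.
Proof.
rewrite /ip /cip !cE /=; congr ER; apply/funext => V.
by case: (coefn X V) (coefn Y V) => [a b] [c e] /=; ring.
Qed.

Lemma ip_adj1 X Y : ip (fmul X (fadj dmom)) Y = ip X (fmul Y dmom).
Proof. by rewrite /ip cip_dmom. Qed.

Lemma ip_adj2 X Y : ip (fmul X dmom) Y = ip X (fmul Y (fadj dmom)).
Proof. by rewrite ip_sym -ip_adj1 ip_sym. Qed.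

Lemma ip_self X : ip X X = ER mu (fun V => cabs2 (coefn X V)).
Proof. by rewrite /ip /cip cE /=; congr ER; apply/funext => V; rewrite mulcJ. Qed.

Lemma ip_ge0 X : 0 <= ip X X.
Proof. by rewrite ip_self; apply: ER_ge0 => V; exact: cabs2_ge0. Qed.

Lemma ip_cs X Y : ip X Y ^+ 2 <= ip X X * ip Y Y.
Proof. by rewrite !ip_self; apply: ER_cs; exact: cbm_coefn. Qed.

Definition opS X := fmul (fmul X (fadj dmom)) dmom.

Lemma ip_opS X Y : ip (opS X) Y = ip X (opS Y).
Proof. by rewrite /opS ip_adj2 ip_adj1. Qed.

Lemma ip_iter X i j : ip (iter i opS X) (iter j opS X) = ip X (iter (i + j) opS X).
Proof.
elim: i j => [|i IH] j //; rewrite iterS ip_opS -iterS IH addnS //.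
Qed.

(** A crude bound: the dimension factor is independent of the number of iterations and vanishes
    under 2^k-th roots. *)
Lemma coefn_frob X V : cabs2 (coefn X V) <= #|{: I}|%:R ^+ 2 * frob X ^+ 2.
Proof.
have Ic : \sum_(b : I) (1 : R) = #|{: I}|%:R by rewrite sumr_const.
have one : vnorm (fun _ : I => 1 : C) ^+ 2 = #|{: I}|%:R.
  rewrite vnorm2 -Ic; apply: eq_bigr => i _; by rewrite /cabs2 /= expr1n expr0n addr0.
have -> : coefn X V = \sum_b 1 * \sum_a X b a * tens_entry (val V) a b.
  by apply: eq_bigr => b _; rewrite mul1r.
apply: (le_trans (vnorm_dot _ _)); rewrite one [_%:R ^+ 2]expr2 -mulrA ler_wpM2l // (frobE X) vnorm2.
rewrite big_distrr /=; apply: ler_sum => b _; apply: (le_trans (vnorm_dot _ _)).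
rewrite mulrC -vnorm2 ler_wpM2r ?sqr_ge0 // vnorm2 -Ic; apply: ler_sum => a _.
exact: tens_le1.
Qed.

Lemma frob_fmul X Y (c : R) : 0 <= c -> (forall x, vnorm (fapp (fadj Y) x) <= c * vnorm x) ->
  frob (fmul X Y) <= c * frob X.
Proof.
move=> c0 H; rewrite -(ler_pXn2r (_ : 0 < 2)%N) ?nnegrE ?mulr_ge0 ?vnorm_ge0 //.
rewrite exprMn !frobE big_distrr /=; apply: ler_sum => b _.
rewrite -!vnorm2 -exprMn ler_pXn2r ?nnegrE ?mulr_ge0 ?vnorm_ge0 //.
rewrite -(vnorm_conj (fun a => X b a)); apply: le_trans (H _).
rewrite -(vnorm_conj (fun a => fmul X Y b a)) le_eqVlt; apply/orP; left; apply/eqP.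
congr vnorm; apply/funext => a; rewrite /fmul /fapp rmorph_sum; apply: eq_bigr => j _.
by rewrite rmorphM mulrC.
Qed.

(* With S = D^* D for D = T_nu - T_mu (acting on the right), which is self-adjoint
   for the L^2(mu) product, Cauchy-Schwarz makes s_n = <X, X S^n> satisfy
   s_1^(2^k) <= s_0^(2^k - 1) s_(2^k), and s_n = O(delta^(2 n)); let k grow. *)
Lemma expander_contract (delta : R) X : approx_expander t nu mu delta ->
  ip (fmul X (fadj dmom)) (fmul X (fadj dmom)) <= delta ^+ 2 * ip X X.
Proof.
move=> H; have d0 : 0 <= delta by apply: le_trans (opnorm_ge0 _) H.
have B1 x : vnorm (fapp dmom x) <= delta * vnorm x.
  by apply: le_trans (fapp_opnorm _ _) _; rewrite ler_wpM2r ?vnorm_ge0.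
have B2 := fadj_bound d0 B1.
have B3 x : vnorm (fapp (fadj (fadj dmom)) x) <= delta * vnorm x.
  suff -> : fadj (fadj dmom) = dmom by exact: B1.
  by apply/funext => a; apply/funext => b; rewrite /fadj conjcK.
have F n : frob (iter n opS X) <= (delta ^+ 2) ^+ n * frob X.
  elim: n => [|n IH]; first by rewrite expr0 mul1r.
  rewrite iterS /opS; apply: (le_trans (frob_fmul _ d0 B2)).
  apply: le_trans (_ : delta * (delta * frob (iter n opS X)) <= _).
    by rewrite ler_wpM2l // frob_fmul.
  have -> : (delta ^+ 2) ^+ n.+1 * frob X = delta * (delta * ((delta ^+ 2) ^+ n * frob X)) by rewrite exprS; ring.
  by rewrite !ler_wpM2l.
pose s n := ip X (iter n opS X).
have s2 n : s n ^+ 2 <= s 0%N * s (n + n)%N.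
  by rewrite /s -ip_iter; exact: ip_cs.
have sE : ip (fmul X (fadj dmom)) (fmul X (fadj dmom)) = s 1%N by rewrite ip_adj1.
have s1p : 0 <= s 1%N by rewrite -sE ip_ge0.
rewrite sE -[ip X X]/(s 0%N).
have : 0 <= s 0%N by exact: ip_ge0.
rewrite le_eqVlt => /predU1P[s0|s0].
  rewrite -s0 mulr0; have := s2 1%N; rewrite -s0 mul0r => h.
  by rewrite leNgt; apply/negP => p; have := exprn_gt0 2 p; rewrite ltNge h.
pose K := #|{: I}|%:R ^+ 2 * frob X ^+ 2.
have K0 : 0 <= K by rewrite mulr_ge0 ?sqr_ge0.
(* Cauchy-Schwarz gives s_n^2 <= s_0 |X S^n|^2; the last factor is at most K delta^(4 n) by
   [coefn_frob] and [F]. *)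
have sn n : s n ^+ 2 <= s 0%N * (K * ((delta ^+ 2) ^+ 2) ^+ n).
  apply: (le_trans (ip_cs _ _)); rewrite ler_pM2l // ip_self.
  rewrite -[X in _ <= X](ER_cst mu); apply: ER_le.
  - exact: bm_cabs2 (cbm_coefn _).
  - exact: bm_cst.
  move=> V; apply: (le_trans (coefn_frob _ _)).
  rewrite /K -mulrA ler_wpM2l ?sqr_ge0 // -exprM mulnC exprM -exprMn.
  by rewrite ler_pXn2r ?nnegrE ?mulr_ge0 ?exprn_ge0 ?vnorm_ge0 // mulrC.
have g k : s 1%N ^+ (2 ^ k) * s 0%N <= s 0%N ^+ (2 ^ k) * s (2 ^ k)%N.
  elim: k => [|k IH]; first by rewrite expn0 !expr1 mulrC.
  rewrite -(ler_pM2r s0) expnS.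
  have -> : s 1%N ^+ (2 * 2 ^ k) * s 0%N * s 0%N = (s 1%N ^+ (2 ^ k) * s 0%N) ^+ 2.
    by rewrite mulnC exprM exprMn -!mulrA.
  apply: le_trans (_ : (s 0%N ^+ (2 ^ k) * s (2 ^ k)%N) ^+ 2 <= _).
    rewrite ler_pXn2r ?nnegrE //.
      by rewrite mulr_ge0 ?exprn_ge0 // ltW.
    by apply: le_trans IH; rewrite mulr_ge0 ?exprn_ge0 // ltW.
  rewrite exprMn -exprM (mulnC _ 2%N) -mulrA ler_pM2l ?exprn_gt0 //.
  by rewrite mulrC mul2n -addnn s2.
rewrite -(ler_pXn2r (_ : 0 < 2)%N) ?nnegrE ?mulr_ge0 ?sqr_ge0 ?(ltW s0) //.
(* The constant K / s_0 does not depend on k, so it costs nothing in the limit. *)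
apply: (@le_of_pow2 _ _ _ (K / s 0%N)); rewrite ?sqr_ge0 // => k.
rewrite -[_ / _ * _]mulrA -(ler_pM2r s0) -(ler_pM2r s0).
have -> : (s 1%N ^+ 2) ^+ (2 ^ k) * s 0%N * s 0%N = (s 1%N ^+ (2 ^ k) * s 0%N) ^+ 2.
  by rewrite -exprM mulnC exprM exprMn -!mulrA.
apply: le_trans (_ : (s 0%N ^+ (2 ^ k) * s (2 ^ k)%N) ^+ 2 <= _).
  rewrite ler_pXn2r ?nnegrE //.
    by rewrite mulr_ge0 ?exprn_ge0 // ltW.
  by apply: le_trans (g k); rewrite mulr_ge0 ?exprn_ge0 // ltW.
rewrite exprMn.
apply: le_trans (_ : (s 0%N ^+ (2 ^ k)) ^+ 2 * (s 0%N * (K * ((delta ^+ 2) ^+ 2) ^+ (2 ^ k))) <= _).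
  by rewrite ler_wpM2l ?sqr_ge0.
have -> : ((delta ^+ 2 * s 0%N) ^+ 2) ^+ (2 ^ k) =
    ((delta ^+ 2) ^+ 2) ^+ (2 ^ k) * (s 0%N ^+ (2 ^ k)) ^+ 2.
  by rewrite (exprAC (s 0%N)) -(exprMn _ ((delta ^+ 2) ^+ 2)) -(exprMn _ (delta ^+ 2)).
rewrite le_eqVlt; apply/orP; left; apply/eqP.
have sn0 : s 0%N != 0 by rewrite gt_eqF.
move: (s 0%N) ((s 0%N ^+ (2 ^ k)) ^+ 2) (((delta ^+ 2) ^+ 2) ^+ (2 ^ k)) sn0 => x y z sn0.
by field.
Qed.

End Contract.

Lemma coefn_dmom (mu nu : probability T R) X (W : U) :
  coefn (fmul X (fadj (dmom mu nu))) W =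
  cintegral nu (fun V => coefn X (umul (uinv V) W)) -
  cintegral mu (fun V => coefn X (umul (uinv V) W)).
Proof.
rewrite -!coefn_moment_adj !coefn_fmul -sumrB; apply: eq_bigr => p _.
rewrite -sumrB; apply: eq_bigr => q _.
by rewrite /fadj /dmom rmorphB mulrBl.
Qed.

End Tensor.

(** * Truncated Chebyshev expansion of powers *)

Section Cosh.
Variable R : realType.
Implicit Types u v a : R.

Definition cosh2 u : R := expR u + expR (- u).

Lemma cosh2_double u : cosh2 (2 * u) = cosh2 u ^+ 2 - 2.
Proof.
rewrite /cosh2 -mulrN sqrrD -!expRM_natl -expRD subrr expR0 /=; ring.
Qed.

(** With e = exp(a u^2): 4 e^2 - 2 <= 2 e^4, because (e^2 - 1)^2 >= 0. *)
Lemma cosh2_step a u : cosh2 u <= 2 * expR (a * u ^+ 2) ->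
  cosh2 (2 * u) <= 2 * expR (a * (2 * u) ^+ 2).
Proof.
move=> H; rewrite cosh2_double.
have c0 : 0 <= cosh2 u by rewrite addr_ge0 ?expR_ge0.
have -> : a * (2 * u) ^+ 2 = 4 * (a * u ^+ 2) by ring.
rewrite (expRM_natl 4%N).
move: (expR (a * u ^+ 2)) (expR_ge0 (a * u ^+ 2)) H => e e0 H.
have h : cosh2 u ^+ 2 <= (2 * e) ^+ 2.
  by rewrite ler_pXn2r ?nnegrE // mulr_ge0.
have := sqr_ge0 (e ^+ 2 - 1); rewrite sqrrB expr1n -exprM mulr1.
by move: h; rewrite exprMn; lra.
Qed.

Lemma expR_le_inv u : u < 1 -> expR u <= (1 - u)^-1.
Proof.
move=> u1; have u2 : 0 < 1 - u by rewrite subr_gt0.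
rewrite -[expR u]invrK -expRN lef_pV2 ?posrE ?expR_gt0 //.
exact: expR_ge1Dx.
Qed.

(** Starting point of the doubling, with the constant 1/2 spoilt by (1 + v)^2: [cosh2 (2 * v)] is
    (exp v - exp(-v))^2 + 2, and the difference is at most 2 v (1 + v). *)
Lemma cosh2_small v : 0 <= v -> v <= 2^-1 ->
  cosh2 (2 * v) <= 2 * expR ((1 + v) ^+ 2 / 2 * (2 * v) ^+ 2).
Proof.
move=> v0 v1; rewrite cosh2_double.
have v2 : 0 < 1 - v by lra.
have s1 : expR v - expR (- v) <= 2 * (v * (1 + v)).
  have h1 : expR v <= (1 - v)^-1 by apply: expR_le_inv; lra.
  have h2 : 1 - v <= expR (- v) by exact: expR_ge1Dx.
  have h3 : (1 - v)^-1 <= 1 - v + 2 * (v * (1 + v)).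
    rewrite -[X in X <= _]mul1r ler_pdivrMr //; nra.
  lra.
have s0 : 0 <= expR v - expR (- v) by rewrite subr_ge0 ler_expR; lra.
have e : cosh2 v ^+ 2 = (expR v - expR (- v)) ^+ 2 + 4.
  have : expR v * expR (- v) = 1 by rewrite -expRD subrr expR0.
  rewrite /cosh2; move: (expR v) (expR (- v)) => x y xy.
  by rewrite sqrrD sqrrB xy; ring.
have h : (expR v - expR (- v)) ^+ 2 <= (2 * (v * (1 + v))) ^+ 2.
  by rewrite ler_pXn2r ?nnegrE ?mulr_ge0 //; lra.
have := expR_ge1Dx ((1 + v) ^+ 2 / 2 * (2 * v) ^+ 2).
move: h; rewrite e !exprMn; nra.
Qed.

Lemma le_of_pow2V (A B c : R) : 0 <= c -> 0 <= B ->
  (forall n, A <= B * (1 + c / 2 ^+ n)) -> A <= B.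
Proof.
move=> c0 B0 H; rewrite leNgt; apply/negP => BA.
have e0 : 0 < A - B by rewrite subr_gt0.
pose n := (Num.truncn (B * c / (A - B))).+1.
have h1 : B * c / (A - B) < n%:R by exact: truncnS_gt.
have h2 : (n%:R : R) <= 2 ^+ n by rewrite -natrX ler_nat ltnW // ltn_expl.
have p2 : 0 < 2 ^+ n :> R by rewrite exprn_gt0.
have := H n; rewrite mulrDr mulr1 mulrA -lerBlDl ler_pdivlMr //.
move: h1; rewrite ltr_pdivrMr //; move: (A - B) e0 => x x0; nra.
Qed.

(* The inequality is stable under u -> 2 u, so it is enough to have it up to a factor
   1 + O(2^-n) at u / 2^n. *)
Lemma cosh2_le u : cosh2 u <= 2 * expR (u ^+ 2 / 2).
Proof.
wlog u0 : u / 0 <= u.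
  move=> H; have [|/ltW u0] := leP 0 u; first exact: H.
  have := H (- u); rewrite /cosh2 opprK sqrrN addrC; apply.
  by rewrite oppr_ge0.
have step a v n : cosh2 v <= 2 * expR (a * v ^+ 2) ->
    cosh2 (2 ^+ n * v) <= 2 * expR (a * (2 ^+ n * v) ^+ 2).
  move=> H; elim: n => [|n IH]; first by rewrite expr0 mul1r.
  by rewrite exprS -mulrA; exact: cosh2_step.
(* 2^k0 >= 2 (u^3 + u) puts both v and the excess exponent z below 1/2, whatever n is. *)
have [k0 k0P] : exists k0 : nat, u ^+ 3 + u <= 2 ^+ k0 / 2.
  exists (Num.truncn (u ^+ 3 + u)).+2.
  have : u ^+ 3 + u < (Num.truncn (u ^+ 3 + u)).+1%:R by exact: truncnS_gt.
  move: (Num.truncn _).+1 => k h; rewrite [2 ^+ _.+1]exprS mulrAC mulfV ?mul1r //.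
  by apply: (le_trans (ltW h)); rewrite -natrX ler_nat ltnW // ltn_expl.
apply: (@le_of_pow2V _ _ (4 * u ^+ 3)).
- by rewrite mulr_ge0 ?exprn_ge0.
- by rewrite mulr_ge0 ?expR_ge0.
move=> n; set m := (n + k0)%N.
have pm : 0 < 2 ^+ m :> R by rewrite exprn_gt0.
pose v := u / 2 ^+ m / 2.
have v0 : 0 <= v by rewrite !divr_ge0 // ltW.
have pk : 0 < 2 ^+ k0 :> R by rewrite exprn_gt0.
have km : 2 ^+ k0 <= 2 ^+ m :> R by apply: ler_weXn2l; rewrite ?leq_addl //; lra.
have nm : 2 ^+ n <= 2 ^+ m :> R by apply: ler_weXn2l; rewrite ?leq_addr //; lra.
have u3 : 0 <= u ^+ 3 by rewrite exprn_ge0.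
have v1 : v <= 2^-1.
  by rewrite /v ler_pdivrMr // mulVf ?pnatr_eq0 // ler_pdivrMr // mul1r; lra.
have uE : u = 2 ^+ m * (2 * v) by rewrite /v; field; rewrite gt_eqF.
have := step _ _ m (cosh2_small v0 v1); rewrite -uE => /le_trans; apply.
rewrite -[X in _ <= X]mulrA ler_pM2l //.
have -> : (1 + v) ^+ 2 / 2 * u ^+ 2 = u ^+ 2 / 2 + (2 * v + v ^+ 2) * u ^+ 2 / 2 by field.
rewrite expRD ler_pM2l ?expR_gt0 //.
set z := _ * _ / 2.
have zle : z <= 2 * v * u ^+ 2.
  have : v ^+ 2 <= v by nra.
  have : 0 <= u ^+ 2 by rewrite sqr_ge0.
  by rewrite /z; nra.
have e1 : 2 * v * u ^+ 2 = u ^+ 3 / 2 ^+ m by rewrite /v; field; rewrite gt_eqF.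
have z2 : z <= 2^-1.
  apply: (le_trans zle); rewrite e1 ler_pdivrMr //; lra.
have z0 : 0 <= z by rewrite /z !mulr_ge0 ?addr_ge0 ?mulr_ge0 ?sqr_ge0.
apply: le_trans (expR_le_inv _) _; first lra.
have h : (1 - z)^-1 <= 1 + 2 * z.
  rewrite -[X in X <= _]mul1r ler_pdivrMr; [nra|lra].
apply: (le_trans h); rewrite lerD2l.
have p : u ^+ 3 / 2 ^+ m <= u ^+ 3 / 2 ^+ n.
  by rewrite ler_wpM2l // lef_pV2 ?posrE ?exprn_gt0.
have : 0 <= u ^+ 3 / 2 ^+ n by rewrite divr_ge0 ?exprn_ge0.
move: p; rewrite -e1 -mulrA; lra.
Qed.

End Cosh.

Section Chebyshev.
Variable R : realType.
Implicit Types x y th : R.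

(** Real form of the binomial expansion of (e^(i th) + e^(-i th))^n. The free phase [psi] makes
    Pascal's rule an induction step: the two halves have phases psi - th and psi + th. *)
Lemma cos_binomial (n : nat) (psi th : R) :
  \sum_(i < n.+1) 'C(n, i)%:R * cos (psi + (2 * i%:R - n%:R) * th) =
  (2 * cos th) ^+ n * cos psi.
Proof.
elim: n psi => [|n IH] psi.
  by rewrite big_ord1 /= !mulr0 subrr mul0r addr0 expr0.
rewrite big_ord_recl /= bin0 mul1r.
under eq_bigr => i _ do rewrite /bump /= add1n binS natrD mulrDl.
rewrite big_split /= addrA.
have -> : cos (psi + (2 * 0%:R - n.+1%:R) * th) +
    \sum_(i < n.+1) 'C(n, i.+1)%:R * cos (psi + (2 * i.+1%:R - n.+1%:R) * th) =
    \sum_(i < n.+1) 'C(n, i)%:R * cos (psi - th + (2 * i%:R - n%:R) * th).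
  rewrite big_ord_recr /= bin_small // mul0r addr0 [RHS]big_ord_recl /= bin0 mul1r.
  congr (_ + _).
    by congr cos; rewrite -natr1; ring.
  by apply: eq_bigr => i _; congr (_ * cos _); rewrite /bump /= add1n -!natr1; ring.
have -> : \sum_(i < n.+1) 'C(n, i)%:R * cos (psi + (2 * i.+1%:R - n.+1%:R) * th) =
    \sum_(i < n.+1) 'C(n, i)%:R * cos (psi + th + (2 * i%:R - n%:R) * th).
  by apply: eq_bigr => i _; congr (_ * cos _); rewrite -!natr1; ring.
by rewrite !IH cosB cosD exprS; ring.
Qed.

Lemma exp_binomial (n : nat) (s : R) :
  \sum_(i < n.+1) 'C(n, i)%:R * expR ((2 * i%:R - n%:R) * s) = cosh2 s ^+ n.
Proof.
rewrite /cosh2 addrC exprDn; apply: eq_bigr => i _.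
have ni : (i <= n)%N by rewrite -ltnS.
rewrite -[RHS]mulr_natl; congr (_ * _).
by rewrite -!expRM_natl -expRD natrB //; congr expR; ring.
Qed.

(** Pairs of consecutive terms, so that the three-term recurrence is structural. *)
Fixpoint cheb2 (j : nat) : {poly R} * {poly R} :=
  if j is j'.+1 then let p := cheb2 j' in (p.2, (4 *: 'X - 2%:P) * p.2 - p.1)
  else (1, 2 *: 'X - 1).

(* Shifted Chebyshev polynomial: cheb j (cos^2 th) = cos (2 j th). *)
Definition cheb j := (cheb2 j).1.

Lemma size_affine (a b : R) : (size ((a *: 'X - b%:P)%R : {poly R}) <= 2)%N.
Proof.
apply: (leq_trans (size_polyD _ _)); rewrite geq_max size_polyN.
apply/andP; split; first by apply: (leq_trans (size_scale_leq _ _)); rewrite size_polyX.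
by apply: (leq_trans (size_polyC_leq1 _)).
Qed.

Lemma size_cheb j : (size (cheb j) <= j.+1)%N.
Proof.
suff : (size (cheb2 j).1 <= j.+1)%N /\ (size (cheb2 j).2 <= j.+2)%N by case.
elim: j => [|j [h1 h2]] /=.
  by rewrite size_poly1; split => //; exact: (size_affine 2 1).
split => //; apply: (leq_trans (size_polyD _ _)); rewrite geq_max size_polyN.
apply/andP; split; last by apply: (leq_trans h1); rewrite ltnW // ltnW.
apply: (leq_trans (size_polyMleq _ _)).
have := size_affine 4 2; move: h2; move: (size _) (size _) => a b; lia.
Qed.

Lemma cheb_cos j th : (cheb j).[cos th ^+ 2] = cos (2 * j%:R * th).
Proof.
suff : (cheb2 j).1.[cos th ^+ 2] = cos (2 * j%:R * th) /\
       (cheb2 j).2.[cos th ^+ 2] = cos (2 * j.+1%:R * th) by case.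
elim: j => [|j [h1 h2]] /=.
  rewrite hornerC !hornerE cos0; split => //=.
  have -> : 2 * th = th + th by ring.
  by rewrite cosD -[sin th * sin th]expr2 sin2cos2; ring.
split => //; rewrite !hornerE h1 h2.
have -> : 2 * j.+2%:R * th = 2 * j.+1%:R * th + 2 * th by rewrite -!natr1; ring.
have -> : 2 * j%:R * th = 2 * j.+1%:R * th - 2 * th by rewrite -!natr1; ring.
have c2 : cos (2 * th) = 2 * cos th ^+ 2 - 1.
  by rewrite mulrDl mul1r cosD -[sin th * sin th]expr2 sin2cos2; ring.
rewrite cosB cosD c2 /=; ring.
Qed.

(** |i - N|: one of the two truncated differences is always 0. *)
Definition adist (i N : nat) := ((i - N) + (N - i))%N.

Lemma cos_adist (i N : nat) th : cos ((2 * i%:R - (2 * N)%:R) * th) = (cheb (adist i N)).[cos th ^+ 2].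
Proof.
rewrite cheb_cos /adist; have [h|/ltnW h] := leqP i N.
  have -> : (i - N = 0)%N by apply/eqP; rewrite subn_eq0.
  by rewrite add0n -cosN natrB // natrM; congr cos; ring.
have -> : (N - i = 0)%N by apply/eqP; rewrite subn_eq0.
by rewrite addn0 natrB // natrM; congr cos; ring.
Qed.

(** Without the condition on [i] the sum is x^N: at x = cos^2 th it is the Fourier expansion of
    cos^(2 N). *)
Definition trunc_pow (N t : nat) : {poly R} :=
  \sum_(i < (2 * N).+1 | (adist i N <= t)%N) ('C(2 * N, i)%:R / 4 ^+ N) *: cheb (adist i N).

Lemma size_trunc_pow N t : (size (trunc_pow N t) <= t.+1)%N.
Proof.
apply: (leq_trans (size_sum _ _ _)); apply/bigmax_leqP => i h.
apply: (leq_trans (size_scale_leq _ _)); apply: (leq_trans (size_cheb _)).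
by rewrite ltnS.
Qed.

Lemma binomial_tail (N t : nat) : (0 < N)%N ->
  \sum_(i < (2 * N).+1 | (t < adist i N)%N) 'C(2 * N, i)%:R / 4 ^+ N
    <= 2 * expR (- (t%:R ^+ 2 / N%:R)) :> R.
Proof.
move=> N0; have NR : 0 < N%:R :> R by rewrite ltr0n.
(* Chernoff parameter: the bound has exponent -2 s t + N s^2, minimal at s = t / N with value -t^2 /
   N. *)
pose s : R := t%:R / N%:R.
have s0 : 0 <= s by rewrite divr_ge0.
have p4 : 0 < 4 ^+ N :> R by rewrite exprn_gt0.
rewrite -mulr_suml ler_pdivrMr //.
have H : \sum_(i < (2 * N).+1 | (t < adist i N)%N) 'C(2 * N, i)%:R <=
   expR (- (2 * s * t%:R)) * \sum_(i < (2 * N).+1) 'C(2 * N, i)%:R *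
     (expR ((2 * i%:R - (2 * N)%:R) * s) + expR ((2 * i%:R - (2 * N)%:R) * - s)).
  rewrite big_distrr /= big_mkcond /=; apply: ler_sum => i _.
  have c0 : 0 <= 'C(2 * N, i)%:R :> R by [].
  case: ifP => [h|_]; last by rewrite !mulr_ge0 ?addr_ge0 ?expR_ge0.
  rewrite mulrCA -[X in X <= _]mulr1 ler_wpM2l // mulrDr -!expRD.
  have [hi|hi] := leqP i N.
    apply: ler_wpDl; first exact: expR_ge0.
    rewrite -[X in X <= _]expR0 ler_expR.
    have -> : - (2 * s * t%:R) + (2 * i%:R - (2 * N)%:R) * - s = 2 * s * (N%:R - i%:R - t%:R).
      by rewrite natrM; ring.
    rewrite mulr_ge0 ?mulr_ge0 // -natrB // subr_ge0 ler_nat.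
    by move: h; rewrite /adist; lia.
  apply: ler_wpDr; first exact: expR_ge0.
  rewrite -[X in X <= _]expR0 ler_expR.
  have -> : - (2 * s * t%:R) + (2 * i%:R - (2 * N)%:R) * s = 2 * s * (i%:R - N%:R - t%:R).
    by rewrite natrM; ring.
  rewrite mulr_ge0 ?mulr_ge0 // -natrB ?(ltnW hi) // subr_ge0 ler_nat.
  by move: h; rewrite /adist; lia.
apply: (le_trans H); under eq_bigr do rewrite mulrDr.
rewrite big_split /= !exp_binomial.
have -> : cosh2 (- s) = cosh2 s by rewrite /cosh2 opprK addrC.
have hc : cosh2 s ^+ (2 * N) <= 4 ^+ N * expR (N%:R * s ^+ 2).
  apply: le_trans (_ : (2 * expR (s ^+ 2 / 2)) ^+ (2 * N) <= _).
    by rewrite ler_pXn2r ?nnegrE ?mulr_ge0 ?addr_ge0 ?expR_ge0 ?cosh2_le // muln_gt0.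
  rewrite exprMn exprM -expRM_natl natrM.
  have -> : 2 ^+ 2 = 4 :> R by rewrite -natrX.
  by have -> : 2 * N%:R * (s ^+ 2 / 2) = N%:R * s ^+ 2 by field.
have -> : forall c : R, c + c = 2 * c by move=> c; ring.
rewrite mulrCA -[X in _ <= X]mulrA ler_pM2l //.
apply: le_trans (_ : expR (- (2 * s * t%:R)) * (4 ^+ N * expR (N%:R * s ^+ 2)) <= _).
  by rewrite ler_pM2l ?expR_gt0.
rewrite mulrCA -expRD mulrC ler_pM2r // ler_expR /s.
rewrite le_eqVlt; apply/orP; left; apply/eqP; field; rewrite gt_eqF //.
Qed.

Lemma trunc_pow_approx (N t : nat) x : (0 < N)%N -> 0 <= x -> x <= 1 ->
  `|(trunc_pow N t).[x] - x ^+ N| <= 2 * expR (- (t%:R ^+ 2 / N%:R)).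
Proof.
move=> N0 x0 x1.
have [th xE] : exists th, x = cos th ^+ 2.
  exists (acos (Num.sqrt x)); rewrite acosK ?sqr_sqrtr // in_itv /=.
  by rewrite (le_trans _ (sqrtr_ge0 x)) ?lerN10 //= -sqrtr1 ler_sqrt.
have p4 : 0 < 4 ^+ N :> R by rewrite exprn_gt0.
have e : x ^+ N = \sum_(i < (2 * N).+1) ('C(2 * N, i)%:R / 4 ^+ N) * (cheb (adist i N)).[x].
  have := cos_binomial (2 * N) 0 th.
  rewrite cos0 mulr1 => e; rewrite xE.
  have -> : (cos th ^+ 2) ^+ N = (2 * cos th) ^+ (2 * N) / 4 ^+ N.
    have e4 : 2 ^+ 2 = 4 :> R by rewrite -natrX.
    by rewrite exprM [(2 * _) ^+ 2]exprMn e4 [(4 * _) ^+ _]exprMn mulrAC mulfV ?mul1r // gt_eqF.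
  rewrite -e mulr_suml; apply: eq_bigr => i _.
  by rewrite add0r cos_adist -!mulrA [_^-1 * _]mulrC.
have qE : (trunc_pow N t).[x] = \sum_(i < (2 * N).+1 | (adist i N <= t)%N)
    ('C(2 * N, i)%:R / 4 ^+ N) * (cheb (adist i N)).[x].
  by rewrite /trunc_pow horner_sum; apply: eq_bigr => i _; rewrite hornerZ.
rewrite qE e [X in _ - X](bigID (fun i : 'I__ => (adist i N <= t)%N)) /= opprD addrA subrr sub0r normrN.
apply: le_trans (binomial_tail t N0).
apply: (le_trans (ler_norm_sum _ _ _)).
under eq_bigl do rewrite -ltnNge.
apply: ler_sum => i _; rewrite normrM [X in X * _]ger0_norm ?divr_ge0 ?(ltW p4) //.
by rewrite ler_piMr ?divr_ge0 ?(ltW p4) // xE cheb_cos ler_norml cos_geN1 cos_le1.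
Qed.

End Chebyshev.

(** * Powers of the trace as matrix coefficients *)

Section Span.
Variables (R : realType) (d : nat).
Local Notation C := (complex R).
Local Notation U := (unitary R d).

Definition span (t : nat) (f : U -> C) := exists G : tidx t d -> tidx t d -> C,
  forall V, f V = \sum_a \sum_b G a b * tens_entry (val V) a b.

Lemma span_ext t f g : f =1 g -> span t f -> span t g.
Proof. by move=> h [G H]; exists G => V; rewrite -h. Qed.

Lemma span0 t : span t (fun=> 0).
Proof.
by exists (fun _ _ => 0) => V; rewrite big1 // => a _; rewrite big1 // => b _; rewrite mul0r.
Qed.

Lemma spanD t f g : span t f -> span t g -> span t (fun V => f V + g V).
Proof.
move=> [F hF] [G hG]; exists (fun a b => F a b + G a b) => V; rewrite hF hG -big_split /=.
apply: eq_bigr => a _; rewrite -big_split /=; apply: eq_bigr => b _; by rewrite mulrDl.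
Qed.

Lemma spanZ t c f : span t f -> span t (fun V => c * f V).
Proof.
move=> [F hF]; exists (fun a b => c * F a b) => V; rewrite hF big_distrr /=.
apply: eq_bigr => a _; rewrite big_distrr /=; apply: eq_bigr => b _; by rewrite mulrA.
Qed.

Lemma span_sum t (J : Type) (r : seq J) (F : J -> U -> C) :
  (forall j, span t (F j)) -> span t (fun V => \sum_(j <- r) F j V).
Proof.
move=> H; elim: r => [|j r IH].
  by apply: span_ext (span0 t) => V; rewrite big_nil.
by apply: span_ext (spanD (H j) IH) => V; rewrite big_cons.
Qed.

Lemma span_tens t (a b : tidx t d) : span t (fun V => tens_entry (val V) a b).
Proof.
exists (fun a' b' => (a' == a)%:R * (b' == b)%:R) => V.
rewrite (bigD1 a) //= (bigD1 b) //= !eqxx !mul1r big1 => [|b' /negbTE ->]; last first.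
  by rewrite mulr0 mul0r.
rewrite addr0 big1 ?addr0 // => a' /negbTE ->.
by rewrite big1 // => b' _; rewrite !mul0r.
Qed.

Definition fcons t (i : 'I_d) (f : {ffun 'I_t -> 'I_d}) : {ffun 'I_t.+1 -> 'I_d} :=
  [ffun m => if unlift ord0 m is Some m' then f m' else i].

Lemma fcons0 t i (f : {ffun 'I_t -> 'I_d}) : fcons i f ord0 = i.
Proof. by rewrite ffunE unlift_none. Qed.

Lemma fconsS t i (f : {ffun 'I_t -> 'I_d}) m : fcons i f (lift ord0 m) = f m.
Proof. by rewrite ffunE liftK. Qed.

Lemma tens_cons t (M : 'M[C]_d) i j k l (a b : tidx t d) :
  tens_entry M ((fcons i a.1, fcons k a.2) : tidx t.+1 d) (fcons j b.1, fcons l b.2) =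
  M i j * conjc (M k l) * tens_entry M a b.
Proof.
rewrite /tens_entry /= !big_ord_recl !fcons0.
rewrite (eq_bigr (fun m => M (a.1 m) (b.1 m))) => [|m _]; last by rewrite !fconsS.
rewrite [X in _ * (_ * X) = _](eq_bigr (fun m => conjc (M (a.2 m) (b.2 m)))) => [|m _].
  by ring.
by rewrite !fconsS.
Qed.

Lemma span_entryM t f i j k l : span t f ->
  span t.+1 (fun V => val V i j * conjc (val V k l) * f V).
Proof.
move=> [F hF].
apply: (@span_ext _ (fun V : U => \sum_a \sum_b F a b * tens_entry (val V)
   ((fcons i a.1, fcons k a.2) : tidx t.+1 d) (fcons j b.1, fcons l b.2))).
  move=> V; rewrite hF big_distrr /=; apply: eq_bigr => a _; rewrite big_distrr /=.
  by apply: eq_bigr => b _; rewrite tens_cons mulrCA.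
by apply: span_sum => a; apply: span_sum => b; apply: spanZ; exact: span_tens.
Qed.

Definition xfun (V : U) : R := cabs2 (\tr (val V)) / d%:R ^+ 2.

Lemma xfunE V : ((xfun V)%:C)%C =
  \sum_i \sum_k (d%:R ^- 2) * (val V i i * conjc (val V k k) * 1).
Proof.
rewrite /xfun rmorphM /= -mulcJ fmorphV rmorphXn /= rmorph_nat /mxtrace rmorph_sum.
rewrite mulrC [X in _ * X]mulrC big_distrl /= big_distrr /=; apply: eq_bigr => i _.
by rewrite !big_distrr /=; apply: eq_bigr => k _; rewrite mulr1.
Qed.

Lemma unit_sum1 (V : U) : (0 < d)%N ->
  1 = \sum_i \sum_j (d%:R)^-1 * (val V i j * conjc (val V i j)) :> C.
Proof.
move=> d0; transitivity (\sum_(i < d) (d%:R)^-1 : C).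
  by rewrite sumr_const card_ord -[RHS]mulr_natl mulfV // pnatr_eq0 -lt0n.
apply: eq_bigr => i _; rewrite -big_distrr /=.
have /matrixP/(_ i i) := uP V; rewrite !mxE eqxx mulr1n => e.
rewrite -[LHS]mulr1; congr (_ * _); rewrite -[LHS]e; apply: eq_bigr => j _; by rewrite adjmxE.
Qed.

(* sum_(i, j) |V_ij|^2 = d raises the tensor degree without changing the function. *)
Lemma span_up t f : (0 < d)%N -> span t f -> span t.+1 f.
Proof.
move=> d0 h; apply: (@span_ext _ (fun V : U =>
   \sum_i \sum_j (d%:R)^-1 * (val V i j * conjc (val V i j) * f V))).
  move=> V; have /(congr1 (fun z => z * f V)) := unit_sum1 V d0.
  rewrite mul1r => e; apply: (etrans _ (esym e)); rewrite big_distrl /=; apply: eq_bigr => i _.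
  by rewrite big_distrl /=; apply: eq_bigr => j _; rewrite !mulrA.
by apply: span_sum => i; apply: span_sum => j; apply: spanZ; exact: span_entryM.
Qed.

Lemma span_x t f : span t f -> span t.+1 (fun V => ((xfun V)%:C)%C * f V).
Proof.
move=> h; apply: (@span_ext _ (fun V : U =>
   \sum_i \sum_k (d%:R ^- 2) * (val V i i * conjc (val V k k) * f V))).
  move=> V; rewrite xfunE big_distrl /=; apply: eq_bigr => i _.
  by rewrite big_distrl /=; apply: eq_bigr => j _; rewrite mulr1 !mulrA.
by apply: span_sum => i; apply: span_sum => j; apply: spanZ; exact: span_entryM.
Qed.

Lemma span_xn t i : (0 < d)%N -> (i <= t)%N -> span t (fun V => ((xfun V ^+ i)%:C)%C).
Proof.
move=> d0; elim: t i => [|t IH] [|i] //=.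
(* In degree 0 the index type has a single element and the entry is an empty product. *)
- move=> _; exists (fun _ _ => 1) => V.
  pose p0 : tidx 0 d := ([ffun=> Ordinal d0], [ffun=> Ordinal d0]).
  have u (p : tidx 0 d) : p = p0.
    by case: p => f g; congr pair; apply/ffunP => -[].
  have b1 (F : tidx 0 d -> C) : \sum_a F a = F p0.
    rewrite (bigD1 p0) //= big1 ?addr0 // => p pp0.
    by move: pp0; rewrite [p]u eqxx.
  by rewrite !b1 /tens_entry !big_ord0 !mulr1.
- by move=> _; apply: span_up => //; exact: IH.
- rewrite ltnS => it; apply: span_ext (span_x (IH i it)) => V.
  rewrite exprS; exact: (esym (rmorphM (real_complex R) _ _)).
Qed.

(** The reason for truncating at degree t: such polynomials in x(V) are coefficients of V^{t,t},
    where the expander bound applies. *)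
Lemma span_poly t (q : {poly R}) : (0 < d)%N -> (size q <= t.+1)%N ->
  exists X, forall V, coefn (t := t) X V = ((q.[xfun V])%:C)%C.
Proof.
move=> d0 sq.
have : span t (fun V => ((q.[xfun V])%:C)%C).
  apply: (@span_ext _ (fun V : U => \sum_(i < t.+1) ((q`_i)%:C)%C * ((xfun V ^+ i)%:C)%C)).
    move=> V; rewrite (horner_coef_wide _ sq) rmorph_sum /=; apply: eq_bigr => i _.
    by rewrite rmorphM.
  apply: span_sum => i; apply: spanZ; apply: span_xn => //; by rewrite -ltnS.
case=> G hG; exists (fun b a => G a b) => V; rewrite hG /coefn exchange_big //.
Qed.

End Span.

(** * The absolute trace as a distance to the phases *)

Section Trace.
Variables (R : realType) (d : nat).
Local Notation C := (complex R).
Local Notation Re := (@complex.Re R).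
Local Notation Im := (@complex.Im R).
Local Notation U := (unitary R d).

Definition cis (phi : R) : C := (cos phi +i* sin phi)%C.

Lemma cabs2_cis phi : cabs2 (cis phi) = 1.
Proof. by rewrite /cabs2 /= cos2Dsin2. Qed.

Lemma cis_surj (z : C) : cabs2 z = 1 -> exists2 phi, 0 <= phi < 2 * pi & z = cis phi.
Proof.
case: z => a b; rewrite /cabs2 /= => ab.
have pi0 := pi_gt0 R.
have a1 : -1 <= a <= 1.
  by rewrite -ler_norml -(ler_pXn2r (_ : 0 < 2)%N) ?nnegrE // -normrX ger0_norm ?sqr_ge0 // expr1n -ab lerDl sqr_ge0.
have aI : a \in `[-1, 1] by rewrite in_itv.
have c := acosK aI.
have s : sin (acos a) = `|b|.
  by rewrite sin_acos // -sqrtr_sqr; congr Num.sqrt; lra.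
have [b0|b0] := leP 0 b.
  exists (acos a); last by rewrite /cis c s ger0_norm.
  by rewrite acos_ge0 //=; have := acos_lepi a1; lra.
(* For b < 0 the angle is 2 pi - acos a; it is below 2 pi because a = 1 would force b = 0. *)
have a11 : a < 1.
  rewrite lt_neqAle; case/andP: a1 => _ ->; rewrite andbT; apply/eqP => ae.
  move: ab; rewrite ae expr1n => h; have : b ^+ 2 = 0 by lra.
  by move/eqP; rewrite sqrf_eq0 => /eqP b00; rewrite b00 ltxx in b0.
have ac0 : 0 < acos a by rewrite acos_gt0 // a11 andbT; case/andP: a1.
exists (pi *+ 2 - acos a).
  rewrite -mulr_natl; have := acos_lepi a1; lra.
by rewrite /cis addrC cosD2pi sinD2pi cosN sinN c s ltr0_norm // opprK.
Qed.

Lemma Re_le_abs (z : C) : Re z <= Num.sqrt (cabs2 z).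
Proof.
apply: (le_trans (ler_norm _)); rewrite -sqrtr_sqr ler_sqrt ?cabs2_ge0 //.
by rewrite /cabs2 lerDl sqr_ge0.
Qed.

Lemma phase_exists (z : C) : exists2 phi, 0 <= phi < 2 * pi &
  cis phi * z = ((Num.sqrt (cabs2 z))%:C)%C.
Proof.
have [->|z0] := eqVneq z 0.
  exists 0; first by rewrite lexx mulr_gt0 ?pi_gt0.
  by rewrite mulr0 /cabs2 /= expr0n addr0 sqrtr0.
have c0 : 0 < cabs2 z by rewrite lt_neqAle cabs2_ge0 eq_sym cabs2_eq0 z0.
have s0 : 0 < Num.sqrt (cabs2 z) by rewrite sqrtr_gt0.
pose w := conjc z * (((Num.sqrt (cabs2 z))^-1)%:C)%C.
have [phi h e] : exists2 phi, 0 <= phi < 2 * pi & w = cis phi.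
  apply: cis_surj; rewrite cabs2M cabs2_conj cabs2_real exprVn sqr_sqrtr ?cabs2_ge0 //.
  by rewrite mulfV // gt_eqF.
exists phi => //; rewrite -e /w mulrAC mulcJ -rmorphM /=; congr (_%:C)%C.
by rewrite -{1}[cabs2 z]sqr_sqrtr ?cabs2_ge0 // expr2 mulfK // gt_eqF.
Qed.

Definition tn (V : U) : R := Num.sqrt (cabs2 (\tr (val V))).

Lemma tn_ge0 V : 0 <= tn V. Proof. exact: sqrtr_ge0. Qed.

(** The phase that makes the trace a nonnegative real is the one closest to 1 in Frobenius norm. *)
Lemma tn_phase V : exists2 phi, 0 <= phi < 2 * pi &
  mfrob (1%:M - cis phi *: val V) ^+ 2 = 2 * d%:R - 2 * tn V.
Proof.
have [phi h e] := phase_exists (\tr (val V)); exists phi => //.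
rewrite mfrob_unit_sub; [|exact: isunit1|by apply: isunitZ (uP V); exact: cabs2_cis].
by rewrite adjmx1 mul1mx mxtraceZ e.
Qed.

Lemma tn_le V : tn V <= d%:R.
Proof. by have [phi _ e] := tn_phase V; have := sqr_ge0 (mfrob (1%:M - cis phi *: val V)); lra. Qed.

Lemma tn_close V : 2 * d%:R - 2 * tn V <= mfrob (1%:M - val V) ^+ 2.
Proof.
rewrite mfrob_unit_sub; [|exact: isunit1|exact: uP].
by rewrite adjmx1 mul1mx; have := Re_le_abs (\tr (val V)); rewrite -/(tn V); lra.
Qed.

Lemma tn_far V (c : R) : 0 <= c ->
  (forall phi, 0 <= phi < 2 * pi -> c <= mx_opnorm (1%:M - cis phi *: val V)) ->
  c ^+ 2 <= 2 * d%:R - 2 * tn V.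
Proof.
move=> c0 H; have [phi h <-] := tn_phase V.
rewrite ler_pXn2r ?nnegrE ?mfrob_ge0 //; apply: (le_trans (H _ h)); exact: mx_opnorm_frob.
Qed.

Lemma xfun_tn (V : U) : xfun V = (tn V / d%:R) ^+ 2.
Proof. by rewrite exprMn exprVn sqr_sqrtr ?cabs2_ge0. Qed.

Lemma xfun_ge0 (V : U) : 0 <= xfun V.
Proof. by rewrite xfun_tn sqr_ge0. Qed.

Lemma xfun_le1 (V : U) : xfun V <= 1.
Proof.
rewrite xfun_tn expr_le1 ?divr_ge0 ?tn_ge0 //.
have [d0|d0] := posnP d; first by rewrite [X in _ / X%:R]d0 invr0 mulr0.
by rewrite ler_pdivrMr ?ltr0n // mul1r tn_le.
Qed.

Lemma tn_inv V : tn (uinv V) = tn V.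
Proof.
rewrite /tn uinvE; congr Num.sqrt; rewrite -cabs2_conj; congr cabs2.
by rewrite /mxtrace rmorph_sum; apply: eq_bigr => i _; rewrite /= adjmxE conjcK.
Qed.

Lemma xfun_inv (V : U) : xfun (uinv V) = xfun V.
Proof. by rewrite !xfun_tn tn_inv. Qed.

Lemma uinv_umul (V W : U) : uinv (umul V W) = umul (uinv W) (uinv V).
Proof. by apply: val_inj; rewrite !(uinvE, umulE) adjmxM. Qed.

Lemma uinvK (V : U) : uinv (uinv V) = V.
Proof. by apply: val_inj; rewrite !uinvE adjmxK. Qed.

(** Lets an average over W be rewritten so that W stands on the right, where left invariance of the
    Haar measure applies. *)
Lemma xfun_swap (V W : U) : xfun (umul (uinv V) W) = xfun (umul (uinv W) V).
Proof. by rewrite -xfun_inv uinv_umul uinvK. Qed.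

Lemma bm_xfun : bm (fun V : Umeas R d => @xfun R d V).
Proof.
have -> : (fun V : Umeas R d => @xfun R d V) = (fun V : Umeas R d => (d%:R ^- 2) * cabs2 (\tr (val V))).
  by apply/funext => V; rewrite /xfun mulrC.
apply: bmZ; apply: (@bm_cabs2 _ _ (fun V : Umeas R d => \tr (val V))).
by apply: cbm_sum => i; exact: cbm_entry.
Qed.

End Trace.

(** * The squared Cayley transform *)

Section Cayley.
Variables (R : realType) (d : nat).
Local Notation C := (complex R).
Local Notation Re := (@complex.Re R).
Local Notation Im := (@complex.Im R).
Local Notation U := (unitary R d).
Implicit Types K L : 'M[C]_d.

Definition herm K := adjmx K = K.

Definition ic : C := (0 +i* 1)%C.

Lemma ic2 : ic * ic = -1.
Proof. by apply/eqP; rewrite eq_complex /=; apply/andP; split; apply/eqP; ring. Qed.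

Lemma conj_ic : conjc ic = - ic.
Proof. by apply/eqP; rewrite eq_complex /= oppr0 !eqxx. Qed.

Definition cayd K : 'M[C]_d := 1%:M - ic *: K.

Lemma adj_cayd K : herm K -> adjmx (cayd K) = 1%:M + ic *: K.
Proof. by move=> h; rewrite /cayd adjmxD adjmxN adjmxZ adjmx1 h conj_ic scaleNr opprK. Qed.

Lemma vnorm_adj (A : 'M[C]_d) x :
  ((vnorm (mv A x) ^+ 2)%:C)%C = \sum_i conjc (x i) * mv (adjmx A *m A) x i.
Proof. by rewrite -dot_self mvM -[RHS]dot_adj adjmxK. Qed.

(** The cross terms cancel because K is Hermitian. Hence 1 - iK is injective with contractive
    inverse, and has norm at most sqrt 2 when K has norm at most 1. *)
Lemma cayd_norm K x : herm K ->
  vnorm (mv (cayd K) x) ^+ 2 = vnorm x ^+ 2 + vnorm (mv K x) ^+ 2.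
Proof.
move=> h; apply: (@complexI R).
rewrite vnorm_adj rmorphD /= vnorm_adj -dot_self adj_cayd //.
have -> : (1%:M + ic *: K) *m cayd K = 1%:M + adjmx K *m K.
  rewrite h /cayd mulmxDl mulmxBr mulmxBr !mul1mx !mulmx1.
  by rewrite -scalemxAl -scalemxAr scalerA ic2 scaleN1r opprK addrA subrK.
by rewrite -big_split /=; apply: eq_bigr => i _; rewrite mvD mv1 mulrDr.
Qed.

Lemma cayd_ge K x : herm K -> vnorm x <= vnorm (mv (cayd K) x).
Proof.
move=> h; rewrite -(ler_pXn2r (_ : 0 < 2)%N) ?nnegrE ?vnorm_ge0 // cayd_norm //.
by rewrite lerDl sqr_ge0.
Qed.

Lemma herm_opp K : herm K -> herm (- K).
Proof. by move=> h; rewrite /herm adjmxN h. Qed.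

Lemma cayd_unit K : herm K -> cayd K \in unitmx.
Proof.
move=> h; rewrite -row_free_unit -kermx_eq0; apply/eqP/row_matrixP => i; rewrite row0.
set v := row i _.
have vQ : v *m cayd K = 0.
  by rewrite /v -row_mul mulmx_ker row0.
pose x : 'I_d -> C := fun j => conjc (v 0 j).
have : vnorm x <= 0.
  (* Up to conjugation, the left kernel of [cayd K] is the kernel of its adjoint [cayd (- K)]. *)
  apply: (le_trans (cayd_ge x (herm_opp h))).
  suff -> : mv (cayd (- K)) x = (fun=> 0) by rewrite vnorm0.
  have -> : cayd (- K) = adjmx (cayd K) by rewrite adj_cayd // /cayd scalerN opprK.
  apply/funext => k; have /rowP/(_ k) := vQ; rewrite !mxE => /(congr1 (@conjc R)).
  rewrite conjc0 rmorph_sum => <-; apply: eq_bigr => j _.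
  by rewrite adjmxE rmorphM /= mulrC.
move=> x0; apply/rowP => j; rewrite [RHS]mxE.
have : vnorm x = 0 by apply/eqP; rewrite eq_le x0 vnorm_ge0.
by move/vnorm0_eq0 => /(_ j) /eqP; rewrite /x conjc_eq0 => /eqP.
Qed.

Definition cayi K := invmx (cayd K).

Lemma cayiK K : herm K -> cayi K *m cayd K = 1%:M.
Proof. by move=> h; rewrite mulVmx // cayd_unit. Qed.

Lemma cayKi K : herm K -> cayd K *m cayi K = 1%:M.
Proof. by move=> h; rewrite mulmxV // cayd_unit. Qed.

Lemma cayi_le K x : herm K -> vnorm (mv (cayi K) x) <= 1 * vnorm x.
Proof.
move=> h; have e : x = mv (cayd K) (mv (cayi K) x) by rewrite -mvM cayKi // mv1.
by rewrite mul1r [X in _ <= vnorm X]e; exact: cayd_ge.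
Qed.

(* Cayley transform (1 + iK)(1 - iK)^-1 *)
Definition cay K := 2%:R *: cayi K - 1%:M.

Lemma cay_unitary K : herm K -> isunit (cay K).
Proof.
move=> h; have e1 := cayiK h; have e2 := cayKi h.
have a1 : (1%:M + ic *: K) *m adjmx (cayi K) = 1%:M.
  by rewrite -adj_cayd // -adjmxM e1 adjmx1.
have PE : 1%:M + ic *: K = 2%:R *: 1%:M - cayd K.
  by rewrite /cayd; apply/matrixP => i j; rewrite !mxE; ring.
have cE : cay K = (1%:M + ic *: K) *m cayi K.
  by rewrite PE mulmxBl -scalemxAl mul1mx e2.
have cE' : cay K = cayi K *m (1%:M + ic *: K).
  by rewrite PE mulmxBr -scalemxAr mulmx1 e1.
have aE : adjmx (cay K) = adjmx (cayi K) *m cayd K.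
  by rewrite cE adjmxM; congr (_ *m _); rewrite -adj_cayd // adjmxK.
by rewrite /isunit aE cE' mulmxA -(mulmxA (cayi K)) a1 mulmx1 e1.
Qed.

(** The resolvent identity, from which both Lipschitz bounds follow. *)
Lemma cayi_sub K L : herm K -> herm L ->
  cayi K - cayi L = ic *: (cayi K *m (K - L) *m cayi L).
Proof.
move=> hK hL.
have -> : ic *: (cayi K *m (K - L) *m cayi L) = cayi K *m (cayd L - cayd K) *m cayi L.
  have -> : cayd L - cayd K = ic *: (K - L).
    by rewrite /cayd; apply/matrixP => i j; rewrite !mxE; ring.
  by rewrite -scalemxAr -scalemxAl.
by rewrite mulmxBr cayiK // mulmxBl mul1mx -mulmxA cayKi // mulmx1.
Qed.

Lemma cabs2_ic : cabs2 ic = 1.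
Proof. by rewrite /cabs2 /= expr0n expr1n add0r. Qed.

Lemma sqmx_sub (A B : 'M[C]_d) : A *m A - B *m B = A *m (A - B) + (A - B) *m B.
Proof. by rewrite mulmxBr mulmxBl addrA subrK. Qed.

Definition ucay K := cay K *m cay K.

Lemma ucay_unitary K : herm K -> isunit (ucay K).
Proof. by move=> h; apply: isunitM; exact: cay_unitary. Qed.

Lemma ucay_sub K L : herm K -> herm L -> ucay K - ucay L =
  (2%:R * ic) *: (cay K *m (cayi K *m (K - L) *m cayi L) +
                (cayi K *m (K - L) *m cayi L) *m cay L).
Proof.
move=> hK hL.
have e : cay K - cay L = (2%:R * ic) *: (cayi K *m (K - L) *m cayi L).
  by rewrite -scalerA -cayi_sub // /cay scalerBr; apply/matrixP => i j; rewrite !mxE; ring.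
by rewrite /ucay sqmx_sub e -scalemxAr -scalemxAl -scalerDr.
Qed.

Lemma mx_opnormM_lel (A B : 'M[C]_d) : mx_opnorm A <= 1 -> mx_opnorm (A *m B) <= mx_opnorm B.
Proof.
by move=> h; apply: (le_trans (mx_opnormM A B)); rewrite ler_piMl // mx_opnorm_ge0.
Qed.

Lemma mx_opnormM_ler (A B : 'M[C]_d) : mx_opnorm B <= 1 -> mx_opnorm (A *m B) <= mx_opnorm A.
Proof.
by move=> h; apply: (le_trans (mx_opnormM A B)); rewrite ler_piMr // mx_opnorm_ge0.
Qed.

Lemma unit_bound (V : 'M[C]_d) x : isunit V -> vnorm (mv V x) <= 1 * vnorm x.
Proof. by move=> u; rewrite unit_vnorm ?mul1r. Qed.

Lemma cabs2_2ic : Num.sqrt (cabs2 (2%:R * ic)) = 2.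
Proof.
rewrite cabs2M cabs2_ic mulr1 -[2%:R](rmorph_nat (real_complex R)) cabs2_real sqrtr_sqr.
by rewrite ger0_norm.
Qed.

(** 4 is 2 for the Cayley transform, whose increments are twice those of a resolvent, times 2 for
    the squaring; all other factors are contractions. *)
Lemma ucay_opnorm K L : herm K -> herm L ->
  mx_opnorm (ucay K - ucay L) <= 4 * mx_opnorm (K - L).
Proof.
move=> hK hL; rewrite ucay_sub //; apply: (le_trans (mx_opnormZ _ _)).
rewrite cabs2_2ic (_ : 4 = 2 * 2); last by rewrite -natrM.
rewrite -mulrA ler_pM2l // mulrDl mul1r.
have b1 := opnorm_unit (cay_unitary hK); have b2 := opnorm_unit (cay_unitary hL).
have c1 : mx_opnorm (cayi K) <= 1 by apply: mx_opnorm_le => // x; exact: cayi_le.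
have c2 : mx_opnorm (cayi L) <= 1 by apply: mx_opnorm_le => // x; exact: cayi_le.
have m : mx_opnorm (cayi K *m (K - L) *m cayi L) <= mx_opnorm (K - L).
  exact: le_trans (mx_opnormM_ler _ c2) (mx_opnormM_lel _ c1).
apply: (le_trans (mx_opnormD _ _)); apply: lerD.
  exact: le_trans (mx_opnormM_lel _ b1) m.
exact: le_trans (mx_opnormM_ler _ b2) m.
Qed.

(** Same constant in Frobenius norm, since the outer factors enter only through their operator
    norm. *)
Lemma ucay_frob K L : herm K -> herm L ->
  mfrob (ucay K - ucay L) <= 4 * mfrob (K - L).
Proof.
move=> hK hL; rewrite ucay_sub // mfrobZ.
rewrite cabs2_2ic (_ : 4 = 2 * 2); last by rewrite -natrM.
rewrite -mulrA ler_pM2l // mulrDl mul1r.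
have m : mfrob (cayi K *m (K - L) *m cayi L) <= mfrob (K - L).
  rewrite -[X in _ <= X]mul1r; apply: le_trans (_ : 1 * mfrob (cayi K *m (K - L)) <= _).
    by apply: mfrob_boundr => // x; exact: cayi_le.
  by rewrite mul1r; apply: mfrob_bound => // x; exact: cayi_le.
apply: (le_trans (mfrobD _ _)); apply: lerD; apply: le_trans m; rewrite -[X in _ <= X]mul1r.
  by apply: mfrob_bound => // x; apply: unit_bound; exact: cay_unitary.
by apply: mfrob_boundr => // x; apply: unit_bound; exact: cay_unitary.
Qed.

Lemma adjmx_conjC (A : 'M[C]_d) : map_mx (@Num.conj C) A^T = adjmx A.
Proof. by apply/matrixP => i j; rewrite adjmxE !mxE. Qed.

Lemma unitary_spectral (V : 'M[C]_d) : isunit V -> exists P D, [/\ isunit P,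
  V = adjmx P *m diag_mx D *m P & forall j, cabs2 (D 0 j) = 1].
Proof.
move=> uV; have nV : V \is normalmx.
  by apply/normalmxP; rewrite adjmx_conjC (isunitC uV).
have e := orthomx_spectralP nV.
have uP := spectral_unitarymx V.
set P := spectralmx V in e uP *; set D := spectral_diag V in e.
have uP' : isunit P by rewrite /isunit -adjmx_conjC; apply/unitarymxP.
have iP : invmx P = adjmx P by rewrite invmx_unitary // adjmx_conjC.
exists P, D; split; [exact: uP'|by rewrite -iP|move=> j].
have dE : diag_mx D = P *m V *m adjmx P.
  by rewrite e iP !mulmxA uP' mul1mx -mulmxA uP' mulmx1.
have uD : isunit (diag_mx D).
  by rewrite dE; apply: isunitM; [apply: isunitM|apply: isunit_adj].
move/matrixP/(_ j j): (isunitC uD); rewrite !mxE eqxx mulr1n (bigD1 j) //= big1 => [|i ij]; last first.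
  by rewrite adjmxE mxE (negbTE ij) mulr0n conjc0 mul0r.
by rewrite adjmxE !mxE eqxx mulr1n addr0 mulcJ => -[].
Qed.

(* Choosing the square root w of z with Re w >= 0 makes the Cayley parameter
   k = Im w / (1 + Re w) bounded by 1: this is why the transform is squared. *)
Lemma scalar_cayley (z : C) : cabs2 z = 1 ->
  exists2 k : R, `|k| <= 1 &
    (2 * (1 - ic * (k%:C)%C)^-1 - 1) * (2 * (1 - ic * (k%:C)%C)^-1 - 1) = z.
Proof.
move=> /cis_surj[phi _ zE].
have [w [w1 w0 wz]] : exists w : C, [/\ cabs2 w = 1, 0 <= Re w & w * w = z].
  have h : cis (phi / 2) * cis (phi / 2) = z.
    rewrite zE [in RHS](_ : phi = phi / 2 + phi / 2); last by field.
    by apply/eqP; rewrite eq_complex /= cosD sinD; apply/andP; split; apply/eqP; ring.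
  have [c0|c0] := leP 0 (cos (phi / 2)).
    by exists (cis (phi / 2)); split; rewrite ?cabs2_cis.
  exists (- cis (phi / 2)); split; rewrite ?cabs2N ?cabs2_cis ?mulrNN //=.
  by rewrite oppr_ge0 ltW.
case: w w1 w0 wz => a b; rewrite /cabs2 /= => ab a0 wz.
have a1 : 0 < 1 + a by lra.
exists (b / (1 + a)).
  rewrite normrM normfV (gtr0_norm a1) ler_pdivrMr // mul1r.
  have : `|b| <= 1.
    by rewrite -(ler_pXn2r (_ : 0 < 2)%N) ?nnegrE // -normrX ger0_norm ?sqr_ge0 // expr1n; nra.
  lra.
suff -> : 2 * (1 - ic * ((b / (1 + a))%:C)%C)^-1 - 1 = (a +i* b)%C by [].
set k := b / (1 + a).
have kE : k * (1 + a) = b by rewrite divfK // gt_eqF.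
have nz : 1 - ic * (k%:C)%C != 0.
  by rewrite eq_complex /= negb_and; apply/orP; left; apply/eqP; rewrite !mul0r mul1r !subr0; lra.
have bk : b * k = 1 - a.
  apply: (mulIf (lt0r_neq0 a1)); rewrite -mulrA kE; lra.
have ak : b - a * k = k by rewrite -kE; lra.
apply: (mulIf nz); rewrite mulrBl -mulrA mulVf // mulr1 mul1r.
apply/eqP; rewrite eq_complex /=; apply/andP; split; apply/eqP.
  by move: bk; lra.
by move: ak; lra.
Qed.

Lemma sq_affine (A : 'M[C]_d) :
  (2%:R *: A - 1%:M) *m (2%:R *: A - 1%:M) - 1%:M = 4%:R *: (A *m A - A).
Proof.
rewrite mulmxBl mulmxBr mul1mx mulmx1 -scalemxAl -scalemxAr.
by apply/matrixP => i j; rewrite !mxE; ring.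
Qed.

(** K is built on the eigenvalues by [scalar_cayley]. The last bound comes from the exact formula 4
    i K = (1 - iK)(V - 1)(1 - iK), where each outer factor has norm at most sqrt 2. *)
Lemma ucay_surj (V : 'M[C]_d) : isunit V -> exists K, [/\ herm K, mx_opnorm K <= 1, ucay K = V &
  2 * mfrob K <= mfrob (V - 1%:M)].
Proof.
move=> uV; have [P [D [uP VE Dj]]] := unitary_spectral uV.
have /choice[k Hk] : forall j, exists k : R, `|k| <= 1 /\
    (2 * (1 - ic * (k%:C)%C)^-1 - 1) * (2 * (1 - ic * (k%:C)%C)^-1 - 1) = D 0 j.
  by move=> j; have [k k1 k2] := scalar_cayley (Dj j); exists k.
pose kd : 'rV[C]_d := \row_j ((k j)%:C)%C.
pose K := adjmx P *m diag_mx kd *m P.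
have uP' := isunitC uP.
have hK : herm K.
  rewrite /herm /K !adjmxM adjmxK mulmxA; congr (_ *m _ *m _).
  apply/matrixP => i j; rewrite adjmxE !mxE eq_sym; case: eqP => [->|_].
    by rewrite !mulr1n conjc_real.
  by rewrite !mulr0n conjc0.
have nz j : 1 - ic * ((k j)%:C)%C != 0.
  by rewrite eq_complex /= negb_and; apply/orP; left; apply/eqP; rewrite !mul0r mul1r !subr0; lra.
pose gd : 'rV[C]_d := \row_j (1 - ic * ((k j)%:C)%C)^-1.
have QE : cayd K = adjmx P *m diag_mx (\row_j (1 - ic * ((k j)%:C)%C)) *m P.
  have -> : diag_mx (\row_j (1 - ic * ((k j)%:C)%C)) = 1%:M - ic *: diag_mx kd.
    apply/matrixP => i j; rewrite !mxE; case: eqP => [->|_]; rewrite ?mulr1n ?mulr0n //.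
    by rewrite mulr0 subr0.
  by rewrite mulmxBr mulmxBl mulmx1 uP' -scalemxAr -scalemxAl.
have iE : cayi K = adjmx P *m diag_mx gd *m P.
  set Y := (X in _ = X).
  have prod1 : cayd K *m Y = 1%:M.
    rewrite QE /Y !mulmxA -(mulmxA _ P) uP mulmx1 -(mulmxA _ _ (diag_mx gd)) mulmx_diag.
    have -> : \row_j ((\row_j0 (1 - ic * ((k j0)%:C)%C)) 0 j * gd 0 j) = const_mx 1 :> 'rV[C]_d.
      by apply/rowP => j; rewrite !mxE mulfV.
    by rewrite diag_const_mx mulmx1 uP'.
  by rewrite -[LHS]mulmx1 -prod1 mulmxA (cayiK hK) mul1mx.
have cE : cay K = adjmx P *m diag_mx (\row_j (2 * (1 - ic * ((k j)%:C)%C)^-1 - 1)) *m P.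
  have -> : diag_mx (\row_j (2 * (1 - ic * ((k j)%:C)%C)^-1 - 1)) = 2%:R *: diag_mx gd - 1%:M.
    apply/matrixP => i j; rewrite !mxE; case: eqP => [->|_]; rewrite ?mulr1n ?mulr0n //.
    by rewrite mulr0 subr0.
  by rewrite mulmxBr mulmxBl mulmx1 uP' -scalemxAr -scalemxAl /cay iE.
have uE : ucay K = V.
  rewrite /ucay cE !mulmxA -(mulmxA _ P) uP mulmx1 -(mulmxA _ _ (diag_mx (\row__ _))) mulmx_diag.
  rewrite [X in diag_mx X](_ : _ = D) -?VE //.
  by apply/rowP => j; rewrite !mxE; have [_ e] := Hk j; rewrite e.
have K1 x : vnorm (mv K x) <= 1 * vnorm x.
  rewrite mul1r /K mvM mvM unit_vnorm; last exact: isunit_adj.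
  rewrite -[X in _ <= X](unit_vnorm x uP); set y := mv P x.
  rewrite -(ler_pXn2r (_ : 0 < 2)%N) ?nnegrE ?vnorm_ge0 // !vnorm2.
  apply: ler_sum => i _.
  have -> : mv (diag_mx kd) y i = kd 0 i * y i.
    rewrite /mv /fapp (bigD1 i) //= mxE eqxx mulr1n big1 ?addr0 // => j ji.
    by rewrite mxE eq_sym (negbTE ji) mulr0n mul0r.
  rewrite cabs2M mxE cabs2_real ler_piMl ?cabs2_ge0 //.
  have [h _] := Hk i; rewrite -[_ ^+ 2]ger0_norm ?sqr_ge0 // normrX expr_le1 //.
exists K; split => //; first exact: mx_opnorm_le.
have Q2 x : vnorm (mv (cayd K) x) <= Num.sqrt 2 * vnorm x.
  rewrite -(ler_pXn2r (_ : 0 < 2)%N) ?nnegrE ?mulr_ge0 ?vnorm_ge0 ?sqrtr_ge0 //.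
  rewrite cayd_norm // exprMn [Num.sqrt 2 ^+ 2]sqr_sqrtr // mulr_natl mulr2n lerD2l.
  by rewrite ler_pXn2r ?nnegrE ?vnorm_ge0 //; have := K1 x; rewrite mul1r.
have KE : 4%:R * ic *: K = cayd K *m (V - 1%:M) *m cayd K.
  have -> : V - 1%:M = (4%:R * ic) *: (cayi K *m K *m cayi K).
    have e : ic *: (cayi K *m K) = cayi K - 1%:M.
      have h1 : cayi K *m cayd K = cayi K - ic *: (cayi K *m K).
        by rewrite /cayd mulmxBr mulmx1 -scalemxAr.
      by rewrite -(cayiK hK) h1 subKr.
    by rewrite -scalerA scalemxAl e -uE /ucay /cay sq_affine mulmxBl mul1mx.
  rewrite -scalemxAr -scalemxAl; congr (_ *: _).
  by rewrite -(mulmxA (cayi K) K) (mulmxA (cayd K)) (cayKi hK) mul1mx -mulmxA (cayiK hK) mulmx1.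
have f4 : mfrob (4%:R * ic *: K) = 4 * mfrob K.
  rewrite mfrobZ cabs2M cabs2_ic mulr1 -[4%:R](rmorph_nat (real_complex R)) cabs2_real sqrtr_sqr.
  by rewrite ger0_norm.
have : 4 * mfrob K <= 2 * mfrob (V - 1%:M).
  rewrite -f4 KE; apply: le_trans (_ : Num.sqrt 2 * mfrob (cayd K *m (V - 1%:M)) <= _).
    by apply: mfrob_boundr => //; exact: sqrtr_ge0.
  apply: le_trans (_ : Num.sqrt 2 * (Num.sqrt 2 * mfrob (V - 1%:M)) <= _); last first.
    by rewrite mulrA -expr2 [Num.sqrt 2 ^+ 2]sqr_sqrtr.
  rewrite ler_wpM2l ?sqrtr_ge0 //; apply: mfrob_bound => //; exact: sqrtr_ge0.
lra.
Qed.

End Cayley.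

(** * Haar measure of balls *)

Section Lattice.
Variables (R : realType) (d : nat).
Local Notation C := (complex R).
Local Notation Re := (@complex.Re R).
Local Notation Im := (@complex.Im R).
Local Notation U := (unitary R d).
Local Notation T := (Umeas R d).

(* Isometry, for the Frobenius norm, from real to Hermitian matrices. *)
Definition hr (X : 'M[R]_d) : 'M[C]_d :=
  \matrix_(i, j) ((X i j + X j i) / 2 +i* ((X i j - X j i) / 2))%C.

Lemma hr_herm X : herm (hr X).
Proof.
apply/matrixP => i j; rewrite adjmxE !mxE; apply/eqP; rewrite eq_complex /=.
by apply/andP; split; apply/eqP; field.
Qed.

Lemma hrD X Y : hr (X + Y) = hr X + hr Y.
Proof.
apply/matrixP => i j; rewrite !mxE; apply/eqP; rewrite eq_complex /=.
by apply/andP; split; apply/eqP; field.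
Qed.

Lemma hrZ (a : R) X : hr (a *: X) = (a%:C)%C *: hr X.
Proof.
apply/matrixP => i j; rewrite !mxE; apply/eqP; rewrite eq_complex /=.
by apply/andP; split; apply/eqP; field.
Qed.

Lemma hrB X Y : hr (X - Y) = hr X - hr Y.
Proof.
apply/matrixP => i j; rewrite !mxE; apply/eqP; rewrite eq_complex /=.
by apply/andP; split; apply/eqP; field.
Qed.

Lemma hr_frob X : mfrob (hr X) ^+ 2 = \sum_i \sum_j X i j ^+ 2.
Proof.
rewrite /mfrob frobE.
transitivity (\sum_i \sum_j (X i j ^+ 2 / 2 + X j i ^+ 2 / 2)).
  by apply: eq_bigr => i _; apply: eq_bigr => j _; rewrite /cabs2 mxE /=; field.
transitivity (\sum_i \sum_j X i j ^+ 2 / 2 + \sum_i \sum_j X j i ^+ 2 / 2).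
  by rewrite -big_split; apply: eq_bigr => i _; rewrite -big_split.
rewrite [X in _ + X]exchange_big /= -big_split; apply: eq_bigr => i _.
by rewrite -big_split; apply: eq_bigr => j _; rewrite /=; field.
Qed.

Lemma hr_surj K : herm K -> exists X, hr X = K.
Proof.
move=> hK; exists (\matrix_(i, j) (Re (K i j) + Im (K i j))).
apply/matrixP => i j; rewrite !mxE; have /matrixP/(_ j i) := hK; rewrite adjmxE => <-.
by case: (K i j) => a b; apply/eqP; rewrite eq_complex /=; apply/andP; split; apply/eqP; field.
Qed.

Definition lat (s : R) (Z : 'M[int]_d) : 'M[C]_d := hr (s *: map_mx (fun z => z%:~R) Z).

Lemma lat_herm s Z : herm (lat s Z). Proof. exact: hr_herm. Qed.

Lemma latD s Y Z : lat s (Y + Z) = lat s Y + lat s Z.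
Proof.
rewrite /lat -hrD -scalerDr; congr (hr (_ *: _)).
by apply/matrixP => i j; rewrite !mxE rmorphD.
Qed.

Lemma latB s Y Z : lat s (Y - Z) = lat s Y - lat s Z.
Proof.
rewrite /lat -hrB -scalerBr; congr (hr (_ *: _)).
by apply/matrixP => i j; rewrite !mxE rmorphB.
Qed.

Lemma round_exists (x : R) : exists z : int, `|x - z%:~R| <= 2^-1.
Proof.
exists (Num.floor (x + 2^-1)).
have /andP[h1 h2] := Num.Theory.floor_itv (x + 2^-1).
by rewrite ler_norml; move: h1 h2; rewrite intrD /=; lra.
Qed.

(* Rounding in the orthonormal coordinates of hr costs at most half the diagonal of a cell. *)
Lemma lat_round (s : R) X : 0 < s -> exists Z : 'M[int]_d,
  mfrob (hr X - lat s Z) <= s * d%:R / 2 /\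
  (forall i j, `|X i j - s * (Z i j)%:~R| <= s / 2).
Proof.
move=> s0; have /choice[f Hf] : forall p : 'I_d * 'I_d, exists z : int, `|X p.1 p.2 / s - z%:~R| <= 2^-1.
  by move=> p; exact: round_exists.
pose Z : 'M[int]_d := \matrix_(i, j) f (i, j).
have H i j : `|X i j - s * (Z i j)%:~R| <= s / 2.
  have := Hf (i, j); rewrite /= mxE => h.
  have -> : X i j - s * (f (i, j))%:~R = s * (X i j / s - (f (i, j))%:~R).
    by rewrite mulrBr mulrCA mulfV ?mulr1 // gt_eqF.
  by rewrite normrM (gtr0_norm s0) ler_pM2l.
exists Z; split => //.
rewrite -(ler_pXn2r (_ : 0 < 2)%N) ?nnegrE ?mfrob_ge0 ?divr_ge0 ?mulr_ge0 ?(ltW s0) //.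
rewrite /lat -hrB hr_frob.
apply: le_trans (_ : \sum_(i < d) \sum_(j < d) (s / 2) ^+ 2 <= _).
  apply: ler_sum => i _; apply: ler_sum => j _; rewrite !mxE.
  rewrite -[X in X <= _]ger0_norm ?sqr_ge0 // normrX ler_pXn2r ?nnegrE ?normr_ge0 ?divr_ge0 ?(ltW s0) //.
  by have := H i j; rewrite mxE.
rewrite !sumr_const card_ord -mulrnA -[X in X <= _]mulr_natl natrM.
by rewrite le_eqVlt; apply/orP; left; apply/eqP; field.
Qed.

Definition boxZ (M : nat) : seq 'M[int]_d :=
  map (fun f : {ffun 'I_d * 'I_d -> 'I_(2 * M).+1} =>
    \matrix_(i, j) ((f (i, j) : nat)%:Z - M%:Z)) (enum {: {ffun 'I_d * 'I_d -> 'I_(2 * M).+1}}).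

Lemma boxZ_uniq M : uniq (boxZ M).
Proof.
rewrite map_inj_uniq ?enum_uniq // => f g /matrixP h; apply/ffunP => -[i j].
have := h i j; rewrite !mxE => /addIr [] e; exact: val_inj.
Qed.

Lemma mem_boxZ M (Z : 'M[int]_d) : (forall i j, `|Z i j| <= M%:Z) -> Z \in boxZ M.
Proof.
move=> H; apply/mapP; exists [ffun p => inord (absz (Z p.1 p.2 + M%:Z)%R)].
  by rewrite mem_enum.
apply/matrixP => i j; rewrite mxE ffunE /=.
have := H i j; rewrite ler_norml => /andP[]; move: (Z i j) => z h1 h2.
by rewrite inordK; lia.
Qed.

(** [M] only makes the enumeration finite; [mem_lball] shows that no lattice point of norm at most
    [r] is lost once d r <= M s. *)
Definition lball (s : R) (M : nat) (r : R) : seq 'M[int]_d :=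
  [seq Z <- boxZ M | mx_opnorm (lat s Z) <= r].

Lemma lball_uniq s M r : uniq (lball s M r).
Proof. exact: filter_uniq (boxZ_uniq M). Qed.

Lemma lat_coord s (Z : 'M[int]_d) i j : 0 < s ->
  `|(Z i j)%:~R| * s <= d%:R * mx_opnorm (lat s Z).
Proof.
move=> s0.
have h : (s * (Z i j)%:~R) ^+ 2 <= mfrob (lat s Z) ^+ 2.
  rewrite /lat hr_frob (bigD1 i) //= (bigD1 j) //= !mxE -addrA lerDl.
  rewrite addr_ge0 ?sumr_ge0 // => [k _|k _]; first exact: sqr_ge0.
  by rewrite sumr_ge0 // => l _; exact: sqr_ge0.
have h2 := mfrob_opnorm (lat s Z).
have d0 : 1 <= d%:R :> R by rewrite ler1n; apply: leq_ltn_trans (ltn_ord i).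
rewrite -(ler_pXn2r (_ : 0 < 2)%N) ?nnegrE ?mulr_ge0 ?mx_opnorm_ge0 ?(ltW s0) //.
have -> : (`|(Z i j)%:~R| * s) ^+ 2 = (s * (Z i j)%:~R) ^+ 2.
  by rewrite !exprMn real_normK ?num_real // mulrC.
apply: (le_trans h); apply: (le_trans h2); rewrite exprMn ler_wpM2r ?sqr_ge0 //; nra.
Qed.

Lemma mem_lball s M r (Z : 'M[int]_d) : 0 < s -> d%:R * r <= M%:R * s ->
  (Z \in lball s M r) = (mx_opnorm (lat s Z) <= r).
Proof.
move=> s0 Mr; rewrite mem_filter; case: leP => //= h.
apply: mem_boxZ => i j.
rewrite -(ler_int R) -(ler_pM2r s0); apply: le_trans Mr.
rewrite intr_norm; apply: (le_trans (lat_coord Z i j s0)); by rewrite ler_wpM2l.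
Qed.

Lemma pigeonhole (A : eqType) (B : finType) (f : A -> B) (s : seq A) (n : nat) :
  (forall c, (size [seq x <- s | f x == c] <= n)%N) -> (size s <= #|B| * n)%N.
Proof.
move=> H; rewrite -sum1_size (partition_big f xpredT) //=.
rewrite -sum_nat_const; apply: leq_sum => c _.
by rewrite -big_filter sum1_size.
Qed.

(* Pigeonhole modulo k: (Y - Z) / k is a lattice point whenever Y = Z mod k. *)
Lemma lball_scale s M (r : R) (k : nat) : 0 < s -> (0 < k)%N -> d%:R * (2 * r / k%:R) <= M%:R * s ->
  (size (lball s M r) <= k ^ (d ^ 2) * size (lball s M (2 * r / k%:R)))%N.
Proof.
move=> s0 k0 MR; case: k k0 MR => // k _ MR.
pose f (Z : 'M[int]_d) : {ffun 'I_d * 'I_d -> 'I_k.+1} := [ffun p => inord (absz (Z p.1 p.2 %% k.+1%:Z)%Z)].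
have -> : (k.+1 ^ (d ^ 2) = #|{ffun 'I_d * 'I_d -> 'I_k.+1}|)%N.
  by rewrite card_ffun card_prod !card_ord mulnn.
apply: (@pigeonhole _ _ f) => c.
(* One residue class: subtracting a fixed member [Z0] and dividing by the modulus is injective on
   it, and the quotient has norm at most 2 r over the modulus. *)
set F := (X in (size X <= _)%N); case E : F => [//|Z0 F'].
have Fin Z : Z \in F -> mx_opnorm (lat s Z) <= r /\ f Z = c.
  by rewrite !mem_filter => /andP[/eqP -> /andP[-> _]].
have Z0F : Z0 \in F by rewrite E mem_head.
rewrite -E; pose g (Z : 'M[int]_d) : 'M[int]_d := \matrix_(i, j) ((Z i j - Z0 i j) %/ k.+1%:Z)%Z.
have gE Z : Z \in F -> Z - Z0 = (k.+1%:Z) *: g Z.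
  move=> ZF; apply/matrixP => i j; rewrite !mxE.
  have e : f Z (i, j) = f Z0 (i, j) by rewrite (Fin _ ZF).2 (Fin _ Z0F).2.
  move: e; rewrite !ffunE /= => /(congr1 (fun n : 'I_k.+1 => (n : nat)%:Z)).
  have k1 : (k.+1%:Z != 0) by [].
  have b (z : int) : (absz (z %% k.+1%:Z)%Z < k.+1)%N.
    by rewrite -ltz_nat gez0_abs ?modz_ge0 // ltz_pmod.
  rewrite !inordK // !gez0_abs ?modz_ge0 // => /eqP; rewrite eqz_mod_dvd => dv.
  by rewrite mulrC divzK.
have inj : {in F &, injective g}.
  move=> Y Z YF ZF e; have := gE _ YF; rewrite e -gE //; exact: addIr.
rewrite -(size_map g F); apply: uniq_leq_size.
  by rewrite map_inj_in_uniq //; apply: filter_uniq; exact: lball_uniq.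
move=> _ /mapP[Z ZF ->]; rewrite mem_lball //.
have kR : 0 < k.+1%:R :> R by rewrite ltr0n.
rewrite ler_pdivlMr //.
have -> : lat s (g Z) = (((k.+1%:R)^-1)%:C)%C *: (lat s Z - lat s Z0).
  rewrite -latB gE // /lat -hrZ; congr hr; apply/matrixP => i j; rewrite !mxE.
  rewrite intrM [RHS]mulrCA; have -> : (k.+1%:Z)%:~R = k.+1%:R :> R by [].
  by rewrite [k.+1%:R^-1 * _]mulrA mulVf ?mul1r // gt_eqF.
rewrite mulrC; apply: le_trans (_ : k.+1%:R * ((k.+1%:R)^-1 * mx_opnorm (lat s Z - lat s Z0)) <= _).
  rewrite ler_pM2l //; apply: (le_trans (mx_opnormZ _ _)).
  by rewrite cabs2_real sqrtr_sqr ger0_norm // invr_ge0 ltW.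
rewrite mulrA mulfV ?gt_eqF // mul1r; apply: (le_trans (mx_opnormD _ _)).
rewrite mx_opnormN; have [h1 _] := Fin _ ZF; have [h2 _] := Fin _ Z0F; lra.
Qed.

Variable mu : probability T R.
Hypothesis mu_haar : is_haar mu.

Lemma haar_uball (V : U) r : mu (uball V r) = mu (uball (uone R d) r).
Proof.
rewrite -(haar_preimage mu_haar V); last exact: uball_measurable.
rewrite uball_preimage; congr (mu (uball _ r)); apply: val_inj.
by rewrite umulE uinvE (isunitC (uP V)).
Qed.

Definition ulat s Z : U := mku (ucay_unitary (lat_herm s Z)).

(* Count, for each V, the lattice points whose image lies in the ball around V,
   and integrate over V. *)
Lemma haar_ball (r : R) (k : nat) : (0 < d)%N -> 0 < r -> 8 / r + 2 < k%:R ->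
  (k%:R ^+ (d ^ 2))^-1 <= fine (mu (uball (uone R d) r)).
Proof.
move=> d0 r0 rk; set v := fine _.
have dR : 0 < d%:R :> R by rewrite ltr0n.
have kR : 0 < k%:R :> R.
  by apply: lt_trans rk; rewrite addr_gt0 // divr_gt0.
have k0 : (0 < k)%N by rewrite -(ltr0n R).
(* [Rb] leaves room for a shift of the unit ball. The hypothesis k > 8/r + 2 says exactly that a <
   r/4; then eta + a < r/4, and the 4-Lipschitz map yields distances below r. *)
pose Rb := 1 + r / 4; pose a := 2 * Rb / k%:R.
have a4 : a < r / 4.
  rewrite ltr_pdivrMr //; move: rk; rewrite -(ltr_pM2l r0) mulrDr mulrCA mulfV ?gt_eqF // /Rb; lra.
have a0 : 0 < a by rewrite divr_gt0 // mulr_gt0 // /Rb; lra.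
pose eta := (r / 4 - a) / 2; have eta0 : 0 < eta by rewrite /eta; lra.
pose s := 2 * eta / d%:R; have s0 : 0 < s by rewrite divr_gt0 // mulr_gt0.
have sE : s * d%:R / 2 = eta by rewrite /s divfK ?gt_eqF //; lra.
pose M := (Num.truncn (d%:R * Rb / s)).+1.
have MR : d%:R * Rb <= M%:R * s by rewrite -ler_pdivrMr // ltW // truncnS_gt.
have Ma : d%:R * a <= M%:R * s.
  by apply: le_trans MR; rewrite ler_pM2l // /Rb; lra.
set S := lball s M Rb; set G := lball s M a.
have SG : (size S <= k ^ (d ^ 2) * size G)%N by exact: lball_scale.
(* V = ucay K with K in the unit ball; if K is rounded to L, the translate L + G lies in S and is
   mapped into the ball around V. *)
have count (V : U) : (size G)%:R <= \sum_(Z <- S) \1_(uball (ulat s Z) r) V :> R.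
  have [K [hK K1 KV _]] := ucay_surj (uP V).
  have [X XK] := hr_surj hK.
  have [L [hL _]] := lat_round X s0; rewrite sE XK in hL.
  have nL : mx_opnorm (K - lat s L) <= eta by apply: le_trans hL; exact: mx_opnorm_frob.
  have inS Z : Z \in G -> (L + Z \in S) /\ uball (ulat s (L + Z)) r V.
    rewrite mem_lball // => Za; split.
      rewrite mem_lball //.
      have -> : lat s (L + Z) = (K - (K - lat s L)) + lat s Z.
        by rewrite latD opprB [K + _]addrC subrK.
      apply: (le_trans (mx_opnormD _ _)).
      apply: le_trans (_ : (1 + eta) + a <= _); last by rewrite /Rb /eta; lra.
      apply: lerD Za; apply: (le_trans (mx_opnormD _ _)).
      by rewrite mx_opnormN lerD.
    change (is_true (mx_opnorm (val V - ucay (lat s (L + Z))) < r)); rewrite -KV.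
    apply: (le_lt_trans (ucay_opnorm hK (lat_herm _ _))).
    have -> : K - lat s (L + Z) = (K - lat s L) - lat s Z by rewrite latD opprD addrA.
    have h : mx_opnorm (K - lat s L - lat s Z) <= eta + a.
      by apply: (le_trans (mx_opnormD _ _)); rewrite mx_opnormN lerD.
    apply: le_lt_trans (_ : 4 * (eta + a) < _); first by rewrite ler_pM2l.
    by rewrite /eta; lra.
  pose P Z := (V \in uball (ulat s Z) r).
  apply: le_trans (_ : (size [seq Z <- S | P Z])%:R <= _).
    rewrite ler_nat -(size_map (fun Z => L + Z)); apply: uniq_leq_size.
      by rewrite map_inj_uniq ?lball_uniq //; exact: addrI.
    move=> _ /mapP[Z /inS[h1 h2] ->]; rewrite mem_filter h1 andbT /P.
    exact: mem_set.
  rewrite -sum1_size big_filter natr_sum big_mkcond /=; apply: ler_sum => Z _.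
  by rewrite indicE /P; case: (V \in _).
(* By invariance all balls have measure v; with [SG], the number of lattice points then cancels. *)
have intg : (size G)%:R <= (size S)%:R * v.
  rewrite -(ER_cst mu (size G)%:R).
  have bmi Z : bm (\1_(uball (ulat s Z) r) : T -> R).
    by apply: bm_indic; exact: uball_measurable.
  apply: le_trans (_ : ER mu (fun V : T => \sum_(Z <- S) \1_(uball (ulat s Z) r) V) <= _).
    by apply: ER_le => //; [exact: bm_cst|exact: bm_sum].
  rewrite ER_sum // (eq_bigr (fun=> v)) => [|Z _].
    by rewrite big_const_seq count_predT iter_addr_0 mulr_natl.
  by rewrite ER_indic; [rewrite haar_uball|exact: uball_measurable].
have G0 : 0 < (size G)%:R :> R.
  rewrite ltr0n; have : 0 \in G.
    rewrite mem_lball //.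
    have -> : lat s 0 = 0 by rewrite -(subrr 0) latB subrr.
    by rewrite mx_opnorm0 ltW.
  by move: (G) => [|].
have v0 : 0 <= v by rewrite fine_ge0.
have kd : 0 < k%:R ^+ (d ^ 2) :> R by rewrite exprn_gt0.
rewrite -[_^-1]mul1r ler_pdivrMr //.
have h : (size G)%:R <= k%:R ^+ (d ^ 2) * (size G)%:R * v.
  apply: (le_trans intg); rewrite ler_wpM2r //.
  by rewrite -natrX -natrM ler_nat.
rewrite -(ler_pM2l G0) mulr1; apply: (le_trans h).
by rewrite le_eqVlt; apply/orP; left; apply/eqP; ring.
Qed.

End Lattice.

(** * Haar moments of the trace *)

Section Theta.
Variable R : realType.

(** A coordinate rounded to z has size at least |z| - 1/2 in units of the mesh s. With s^2 = d / (8
    N), the exponent N / (2 d) per squared unit of K becomes 1/16. *)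
Definition wgt (z : int) : R := expR (- (Num.max (`|z%:~R| - 2^-1) 0) ^+ 2 / 16).

Lemma wgt_gt0 z : 0 < wgt z. Proof. exact: expR_gt0. Qed.

Lemma wgt_le1 z : wgt z <= 1.
Proof.
rewrite /wgt -[X in _ <= X]expR0 ler_expR mulNr oppr_le0 divr_ge0 //; exact: sqr_ge0.
Qed.

Lemma wgt_opp z : wgt (- z) = wgt z.
Proof. by rewrite /wgt rmorphN normrN. Qed.

(* Tangent line (j - 1/2)^2 >= 6 (j - 1/2) - 9, then a geometric series. *)
Lemma wgt_sum (M : nat) : \sum_(j < M) wgt j.+1%:Z <= 24 / 5.
Proof.
pose g : R := expR (3 / 8).
(* The final inequality g^2 <= (24/5)(g - 1) holds between the roots of 5 g^2 - 24 g + 24, about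
   1.42 and 3.38; hence a bound on each side. *)
have g1 : 143 / 100 <= g.
  apply: le_trans (_ : (1 + 3 / 32) ^+ 4 <= _); first by rewrite !exprS expr0; lra.
  rewrite /g (_ : 3 / 8 = 4%:R * (3 / 32)); last by field.
  by rewrite expRM_natl ler_pXn2r ?nnegrE ?expR_ge0 ?expR_ge1Dx //; lra.
have g2 : g <= 3.
  apply: le_trans (@expR_le_inv R (3 / 8) _) _; first by lra.
  by rewrite (_ : (1 - 3 / 8)^-1 = 8 / 5); [lra|field].
have w (j : nat) : wgt j.+1%:Z <= g * (g ^+ j)^-1.
  have -> : g * (g ^+ j)^-1 = expR (3 / 8 - 3 / 8 * j%:R).
    by rewrite expRB mulrC -expRM_natl mulrC [_%:R * _]mulrC.
  rewrite /wgt ler_expR.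
  have -> : `|(j.+1%:Z)%:~R| = j%:R + 1 :> R by rewrite ger0_norm ?ler0z // -[LHS]/(j.+1%:R) -natr1.
  have j0 : 0 <= j%:R :> R by [].
  rewrite (_ : Num.max _ _ = j%:R + 1 - 2^-1); last by apply/max_idPl; lra.
  by have := sqr_ge0 ((j%:R : R) - 5 / 2); move: (j%:R : R) j0 => x x0; nra.
have gs n : (\sum_(j < n) g * (g ^+ j)^-1) * (g - 1) <= g ^+ 2.
  have gp : 0 < g by lra.
  have -> : (\sum_(j < n) g * (g ^+ j)^-1) * (g - 1) = g ^+ 2 - g ^+ 2 / g ^+ n.
    elim: n => [|n IH]; first by rewrite big_ord0 mul0r expr0 divr1 subrr.
    rewrite big_ord_recr mulrDl IH /= [g ^+ n.+1]exprS.
    have : g ^+ n != 0 by rewrite expf_neq0 // gt_eqF.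
    have : g != 0 by rewrite gt_eqF.
    by move: (g ^+ n) => z g0 z0; field; rewrite g0 z0.
  by rewrite gerBl divr_ge0 ?exprn_ge0 // ltW.
apply: le_trans (_ : \sum_(j < M) g * (g ^+ j)^-1 <= _).
  by apply: ler_sum => j _; exact: w.
have gm : 0 < g - 1 by lra.
rewrite -(ler_pM2r gm); apply: (le_trans (gs M)); nra.
Qed.

(** 53/5 = 1 + 2 * 24/5: the term at 0 and two half-lines. *)
Lemma wgt_box (M : nat) : \sum_(i < (2 * M).+1) wgt ((i : nat)%:Z - M%:Z) <= 53 / 5.
Proof.
rewrite -(big_mkord xpredT (fun i => wgt (i%:Z - M%:Z))).
rewrite (@big_cat_nat _ _ _ M) //=; last by lia.
rewrite [X in _ + X]big_nat_recl; last by lia.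
rewrite subrr.
have e1 : \sum_(0 <= i < M) wgt (i%:Z - M%:Z) = \sum_(j < M) wgt j.+1%:Z.
  rewrite big_nat_rev /= add0n big_mkord; apply: eq_bigr => j _; rewrite -wgt_opp; congr wgt.
  have := ltn_ord j; lia.
have e2 : \sum_(M <= i < 2 * M) wgt (i.+1%:Z - M%:Z) = \sum_(j < M) wgt j.+1%:Z.
  rewrite -{1}[M]add0n big_addn (_ : (2 * M - M)%N = M); last by lia.
  rewrite big_mkord; apply: eq_bigr => j _; congr wgt; lia.
rewrite e1 e2; have := wgt_sum M; have := wgt_le1 0; lra.
Qed.

End Theta.

Lemma mfrobBC (R : realType) d (A B : 'M[complex R]_d) : mfrob (A - B) = mfrob (B - A).
Proof.
by apply: vnorm_eq => p; rewrite !mxE -cabs2N opprB.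
Qed.

Lemma bm_umul (R : realType) d (V : unitary R d) (f : Umeas R d -> R) :
  bm f -> bm (fun W : Umeas R d => f (umul V W)).
Proof.
move=> [mf [B HB]]; split; last by exists B => W; exact: HB.
exact: (measurableT_comp mf (umul_measurable V)).
Qed.

Section HaarMoment.
Variables (R : realType) (d : nat).
Local Notation C := (complex R).
Local Notation Re := (@complex.Re R).
Local Notation Im := (@complex.Im R).
Local Notation U := (unitary R d).
Local Notation T := (Umeas R d).
Variable mu : probability T R.
Hypothesis mu_haar : is_haar mu.
Hypothesis d0 : (0 < d)%N.

Definition xmom (N : nat) : R := ER mu (fun V => @xfun R d V ^+ N).

Lemma bm_xfunX N : bm (fun V : T => @xfun R d V ^+ N).
Proof. by apply: bmX; exact: bm_xfun. Qed.

Lemma dR : 0 < d%:R :> R. Proof. by rewrite ltr0n. Qed.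

Lemma xfun_tn_le (V : U) (c : R) (N : nat) : 0 <= c -> d%:R * c <= tn V ->
  c ^+ (2 * N) <= xfun V ^+ N.
Proof.
move=> c0 h; rewrite exprM xfun_tn; apply: lerXn2r; rewrite ?nnegrE ?sqr_ge0 //.
by apply: lerXn2r; rewrite ?nnegrE ?divr_ge0 ?tn_ge0 // ler_pdivlMr ?dR // mulrC.
Qed.

(** On the ball of radius r around 1 the Frobenius distance to 1 is at most sqrt(d) r, so |tr V| / d
    >= 1 - r^2/2; [haar_ball] measures the ball. *)
Lemma xmom_lower (N k : nat) (r : R) : 0 < r -> r ^+ 2 <= 2 -> 8 / r + 2 < k%:R ->
  (1 - r ^+ 2 / 2) ^+ (2 * N) / k%:R ^+ (d ^ 2) <= xmom N.
Proof.
move=> r0 r2 rk.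
have c0 : 0 <= 1 - r ^+ 2 / 2 by lra.
have := haar_ball mu_haar d0 r0 rk; set v := fine _ => hv.
apply: le_trans (_ : (1 - r ^+ 2 / 2) ^+ (2 * N) * v <= _).
  by rewrite ler_wpM2l // exprn_ge0.
have mB := uball_measurable (uone R d) r.
rewrite /v -(ER_indic mu mB) -ERZ; last exact: bm_indic.
apply: ER_le; [by apply: bmZ; exact: bm_indic|exact: bm_xfunX|].
move=> V; rewrite indicE; have [VB|VB] := pselect (uball (uone R d) r V); last first.
  by rewrite memNset // mulr0 exprn_ge0 // xfun_ge0.
rewrite mem_set // mulr1; apply: xfun_tn_le => //.
have h : mx_opnorm (1%:M - val (V : U)) <= r.
  by rewrite mx_opnormB; apply: ltW; exact: VB.
have h1 := mfrob_opnorm (1%:M - val (V : U)).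
have h2 : mx_opnorm (1%:M - val (V : U)) ^+ 2 <= r ^+ 2.
  by rewrite ler_pXn2r ?nnegrE ?mx_opnorm_ge0 // ltW.
have h3 := tn_close (V : U).
have h4 : mfrob (1%:M - val (V : U)) ^+ 2 <= d%:R * r ^+ 2.
  by apply: (le_trans h1); rewrite ler_pM2l ?dR.
lra.
Qed.

Lemma xfun_exp (V : U) (N : nat) : xfun V ^+ N <= expR (- (N%:R * (2 * d%:R - 2 * tn V) / d%:R)).
Proof.
rewrite xfun_tn -exprM.
have h : tn V / d%:R <= expR (- (2 * d%:R - 2 * tn V) / (2 * d%:R)).
  apply: le_trans (expR_ge1Dx _).
  by rewrite le_eqVlt; apply/orP; left; apply/eqP; field; rewrite gt_eqF // dR.
apply: le_trans (_ : expR (- (2 * d%:R - 2 * tn V) / (2 * d%:R)) ^+ (2 * N) <= _).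
  by apply: lerXn2r; rewrite ?nnegrE ?divr_ge0 ?tn_ge0 ?expR_ge0.
rewrite -expRM_natl ler_expR natrM.
by rewrite le_eqVlt; apply/orP; left; apply/eqP; field; rewrite gt_eqF // dR.
Qed.

(** For e >= 0, the matrices at Frobenius distance at least e from every phase. *)
Definition tailset (e : R) : set T := [set V | 2 * tn (V : U) <= 2 * d%:R - e ^+ 2].

Lemma tailset_measurable e : measurable (tailset e).
Proof.
have [e0|e0] := leP 0 (2 * d%:R - e ^+ 2); last first.
  rewrite [tailset e](_ : _ = set0); first exact: measurable0.
  apply/seteqP; split => // V; rewrite /tailset /= => h.
  by have := tn_ge0 (V : U); lra.
have -> : tailset e = (fun V : T => @xfun R d V) @^-1` [set` `]-oo, (((2 * d%:R - e ^+ 2) / (2 * d%:R)) ^+ 2)]].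
  apply/seteqP; split => V; rewrite /tailset /= in_itv /= xfun_tn => h.
    apply: lerXn2r; rewrite ?nnegrE ?divr_ge0 ?mulr_ge0 ?tn_ge0 //.
    by rewrite ler_pdivrMr ?dR // (_ : _ / _ * _ = (2 * d%:R - e ^+ 2) / 2); [lra|field; rewrite gt_eqF // dR].
  move: h; rewrite ler_pXn2r ?nnegrE ?divr_ge0 ?mulr_ge0 ?tn_ge0 //.
  rewrite ler_pdivrMr ?dR // (_ : _ / _ * _ = (2 * d%:R - e ^+ 2) / 2).
    lra.
  by field; rewrite gt_eqF // dR.
have [mf _] := bm_xfun R d.
have := mf measurableT _ (measurable_itv `]-oo, (((2 * d%:R - e ^+ 2) / (2 * d%:R)) ^+ 2)]).
by rewrite setTI.
Qed.

Definition tailmom (N : nat) (e : R) : R :=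
  ER mu (fun V => \1_(tailset e) V * @xfun R d V ^+ N).

(* Up to a phase, V = ucay K with ||K||_F <= ||1 - e^(i phi) V||_F / 2. Rounding K to a
   point Z of a lattice of mesh s bounds x(V)^N by a Gaussian weight of Z, while
   x((ucay Z)^-1 V)^N >= (1 - y)^(2 N); by invariance each translate integrates to E x^N,
   and the sum over Z of the weights factors over the d^2 coordinates. *)
Lemma tailmom_le (N : nat) (e : R) : (0 < N)%N -> (d%:R ^+ 2 / (4 * N%:R) < 1 :> R) ->
  tailmom N e * (1 - d%:R ^+ 2 / (4 * N%:R)) ^+ (2 * N) <=
   expR (- (7 / 8 * N%:R * e ^+ 2 / d%:R)) * (53 / 5) ^+ (d ^ 2) * xmom N.
Proof.
move=> N0 y1; set y := _ / (4 * _) in y1 *.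
have NR : 0 < N%:R :> R by rewrite ltr0n.
have DR := dR.
(* Rounding moves V by at most 4 (s d / 2) = 2 s d in Frobenius norm, so the translate has |tr| / d
   >= 1 - 2 s^2 d = 1 - y. As 2 N y = d^2 / 2, a mesh of this order costs only a factor exponential
   in d^2. *)
pose s := Num.sqrt (d%:R / (8 * N%:R) : R).
have s2 : s ^+ 2 = d%:R / (8 * N%:R) by rewrite sqr_sqrtr // divr_ge0 // mulr_ge0.
have s0 : 0 < s by rewrite sqrtr_gt0 divr_gt0 // mulr_gt0.
have yE : y = 2 * s ^+ 2 * d%:R by rewrite s2 /y; field; rewrite gt_eqF.
pose M := (Num.truncn (d%:R / s + 1)).+1.
have MP : d%:R / s + 1 < M%:R by exact: truncnS_gt.
set c1 := expR _.
pose wZ (Z : 'M[int]_d) : R := \prod_(p : 'I_d * 'I_d) wgt R (Z p.1 p.2).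
have wZ0 Z : 0 <= wZ Z by apply: prodr_ge0 => p _; apply: ltW; exact: wgt_gt0.
have key (V : U) : (\1_(tailset e) V * xfun V ^+ N) * (1 - y) ^+ (2 * N) <=
    \sum_(Z <- boxZ d M) c1 * wZ Z * xfun (umul (uinv (ulat s Z)) V) ^+ N.
  have pos Z : 0 <= c1 * wZ Z * xfun (umul (uinv (ulat s Z)) V) ^+ N.
    by rewrite !mulr_ge0 ?expR_ge0 ?exprn_ge0 ?xfun_ge0.
  rewrite indicE; have [VA|VA] := pselect (tailset e V); last first.
    by rewrite memNset // !mul0r; apply: sumr_ge0.
  rewrite mem_set // mul1r.
  have [phi _ phE] := tn_phase V.
  set D := 2 * d%:R - 2 * tn V in phE.
  have De : e ^+ 2 <= D by move: VA; rewrite /tailset /D /=; lra.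
  have uV' : isunit (cis phi *: val V) by apply: isunitZ (uP V); exact: cabs2_cis.
  have [K [hK _ KV KF]] := ucay_surj uV'.
  have KD : 4 * mfrob K ^+ 2 <= D.
    rewrite -phE (_ : 4 = 2 ^+ 2); last by rewrite -natrX.
    rewrite -exprMn; apply: lerXn2r; rewrite ?nnegrE ?mulr_ge0 ?mfrob_ge0 //.
    by apply: (le_trans KF); rewrite mfrobBC.
  have [X XK] := hr_surj hK.
  have [Z [ZF ZX]] := lat_round X s0.
  have Xs : mfrob K ^+ 2 = \sum_i \sum_j X i j ^+ 2 by rewrite -XK hr_frob.
  (* |X i j| <= |K|_F <= d and rounding adds at most 1/2, so |Z i j| <= d / s + 1/2 < M. *)
  have Zb : Z \in boxZ d M.
    apply: mem_boxZ => i j; rewrite -(ler_int R) intr_norm.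
    have Xij : `|X i j| <= d%:R.
      rewrite -(ler_pXn2r (_ : 0 < 2)%N) ?nnegrE ?normr_ge0 ?ler0n // real_normK ?num_real //.
      apply: le_trans (_ : mfrob K ^+ 2 <= _).
        rewrite Xs (bigD1 i) //= (bigD1 j) //= -addrA lerDl addr_ge0 ?sumr_ge0 // => [k _|k _].
          exact: sqr_ge0.
        by rewrite sumr_ge0 // => l _; exact: sqr_ge0.
      have d1 : 1 <= d%:R :> R by rewrite ler1n.
      have := tn_ge0 V; move: KD; rewrite /D => KD t0.
      have : d%:R <= d%:R ^+ 2 :> R by rewrite expr2; nra.
      lra.
    have := ZX i j; rewrite !ler_norml => /andP[h1 h2].
    move: Xij; rewrite ler_norml => /andP[h3 h4].
    have sM : d%:R + s <= M%:R * s.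
      by rewrite -ler_pdivrMr // mulrDl mulfV ?gt_eqF // ltW.
    apply/andP; split; rewrite -(ler_pM2r s0); move: (_%:~R : R) h1 h2 => z h1 h2; lra.
  rewrite (big_rem Z) //=; apply: ler_wpDr; first by apply: sumr_ge0.
  have xW : (1 - y) ^+ (2 * N) <= xfun (umul (uinv (ulat s Z)) V) ^+ N.
    apply: xfun_tn_le; first by rewrite subr_ge0 ltW.
    have -> : tn (umul (uinv (ulat s Z)) V) =
        Num.sqrt (cabs2 (\tr (adjmx (ucay (lat s Z)) *m (cis phi *: val V)))).
      by rewrite /tn umulE uinvE -scalemxAr mxtraceZ cabs2M cabs2_cis mul1r.
    apply: le_trans (Re_le_abs _).
    have hF := mfrob_unit_sub (ucay_unitary (lat_herm s Z)) uV'.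
    have hF2 : mfrob (ucay (lat s Z) - cis phi *: val V) <= 2 * s * d%:R.
      rewrite -KV; apply: (le_trans (ucay_frob (lat_herm _ _) hK)).
      have -> : mfrob (lat s Z - K) = mfrob (hr X - lat s Z).
        by rewrite -XK mfrobBC.
      lra.
    have hF3 : mfrob (ucay (lat s Z) - cis phi *: val V) ^+ 2 <= (2 * s * d%:R) ^+ 2.
      by apply: lerXn2r; rewrite ?nnegrE ?mfrob_ge0 ?mulr_ge0 // ltW.
    move: hF3; rewrite hF yE !exprMn; move: (complex.Re _) => t; rewrite -natrX; lra.
  have xV : xfun V ^+ N <= c1 * wZ Z.
    apply: (le_trans (xfun_exp V N)); rewrite -/D.
    (* Seven eighths of the exponent give the tail factor; the remaining eighth pays for the sum
       over lattice points. *)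
    have -> : - (N%:R * D / d%:R) = - (7 / 8 * N%:R * D / d%:R) + - (N%:R * D / (8 * d%:R)).
      by field; rewrite gt_eqF.
    rewrite expRD; apply: ler_pM; rewrite ?expR_ge0 //.
      rewrite /c1 ler_expR lerN2 ler_pM2r ?invr_gt0 // ler_pM2l // mulr_gt0 //.
    have -> : wZ Z = expR (\sum_(p : 'I_d * 'I_d) (- (Num.max (`|(Z p.1 p.2)%:~R| - 2^-1) 0) ^+ 2 / 16)).
      by rewrite expR_sum.
    rewrite ler_expR lerNl -sumrN.
    apply: le_trans (_ : N%:R * (4 * mfrob K ^+ 2) / (8 * d%:R) <= _); last first.
      by rewrite ler_pM2r ?invr_gt0 ?mulr_gt0 // ler_pM2l.
    have -> : N%:R * (4 * mfrob K ^+ 2) / (8 * d%:R) = (N%:R / (2 * d%:R)) * mfrob K ^+ 2.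
      by field; rewrite gt_eqF.
    rewrite Xs pair_big /= big_distrr /=; apply: ler_sum => -[i j] _ /=.
    rewrite mulNr opprK.
    have zs : (Num.max (`|(Z i j)%:~R| - 2^-1) 0) * s <= `|X i j|.
      have := ZX i j; move: ((Z i j)%:~R : R) => z h.
      have [h1|h1] := leP (`|z| - 2^-1) 0; first by rewrite mul0r.
      rewrite mulrBl -[X in _ * X - _](gtr0_norm s0) -normrM mulrC.
      have := ler_normB (s * z) (X i j); have := ler_normD (X i j) (s * z - X i j).
      rewrite addrCA subrr addr0 [`|s * z - _|]distrC; lra.
    have : (Num.max (`|(Z i j)%:~R| - 2^-1) 0 * s) ^+ 2 <= X i j ^+ 2.
      rewrite -(real_normK (num_real (X i j))); apply: lerXn2r; rewrite ?nnegrE ?normr_ge0 //.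
      by rewrite mulr_ge0 ?(ltW s0) // le_max lexx orbT.
    rewrite exprMn s2 => h.
    apply: le_trans (_ : N%:R / (2 * d%:R) * (Num.max (`|(Z i j)%:~R| - 2^-1) 0 ^+ 2 * (d%:R / (8 * N%:R))) <= _).
      rewrite le_eqVlt; apply/orP; left; apply/eqP; field.
      by rewrite !gt_eqF.
    by rewrite ler_pM2l // divr_gt0 // mulr_gt0.
  by apply: ler_pM; rewrite ?exprn_ge0 ?xfun_ge0 // subr_ge0 ltW.
have mA := tailset_measurable e.
have bT : bm (fun V : T => \1_(tailset e) V * @xfun R d V ^+ N).
  by apply: bmM; [exact: bm_indic|exact: bm_xfunX].
have bZ Z : bm (fun V : T => c1 * wZ Z * @xfun R d (umul (uinv (ulat s Z)) V) ^+ N).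
  by apply: bmZ; exact: (bm_umul (uinv (ulat s Z)) (bm_xfunX N)).
rewrite mulrC /tailmom -ERZ //.
apply: le_trans (_ : ER mu (fun V : T => \sum_(Z <- boxZ d M) c1 * wZ Z * @xfun R d (umul (uinv (ulat s Z)) V) ^+ N) <= _).
  by apply: ER_le; [exact: bmZ|exact: bm_sum|move=> V; rewrite mulrC; exact: key].
rewrite ER_sum //.
rewrite (eq_bigr (fun Z => c1 * xmom N * wZ Z)) => [|Z _]; last first.
  rewrite ERZ; last exact: (bm_umul (uinv (ulat s Z)) (bm_xfunX N)).
  rewrite (haar_ER (uinv (ulat s Z)) mu_haar (bm_xfunX N)) -/(xmom N); ring.
rewrite -big_distrr /= -[X in X <= _]mulrA -[X in _ <= X]mulrA ler_pM2l ?expR_gt0 //.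
rewrite [X in X <= _]mulrC ler_wpM2r //.
  by apply: ER_ge0 => V; rewrite exprn_ge0 // xfun_ge0.
rewrite big_map big_enum /=.
have -> : (53 / 5) ^+ (d ^ 2) = \prod_(p : 'I_d * 'I_d) (53 / 5 : R).
  by rewrite prodr_const card_prod !card_ord mulnn.
apply: le_trans (_ : \prod_(p : 'I_d * 'I_d) \sum_(i < (2 * M).+1) wgt R ((i : nat)%:Z - M%:Z) <= _); last first.
  apply: ler_prod => p _; rewrite wgt_box andbT; apply: sumr_ge0 => i _; apply: ltW; exact: wgt_gt0.
rewrite bigA_distr_bigA /= le_eqVlt; apply/orP; left; apply/eqP.
apply: eq_bigr => f _; apply: eq_bigr => -[i j] _; by rewrite mxE.
Qed.

End HaarMoment.

(** * The covering argument *)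

Section Core.
Variables (R : realType) (d : nat).
Local Notation C := (complex R).
Local Notation Re := (@complex.Re R).
Local Notation Im := (@complex.Im R).
Local Notation U := (unitary R d).
Local Notation T := (Umeas R d).

(** Fubini for integrands of finite rank, by linearity of the two integrals. *)
Lemma cE_swap (mu nu : probability T R) (w : T -> C) (J : finType) (phi psi : J -> T -> C) :
  cbm w -> (forall j, cbm (phi j)) -> (forall j, cbm (psi j)) ->
  cintegral mu (fun V => w V * cintegral nu (fun W => \sum_j phi j W * psi j V)) =
  cintegral nu (fun W => cintegral mu (fun V => w V * \sum_j phi j W * psi j V)).
Proof.
move=> cw cphi cpsi.
transitivity (\sum_j cintegral nu (phi j) * cintegral mu (fun V => w V * psi j V)).
  rewrite (_ : (fun V => _) = fun V => \sum_j cintegral nu (phi j) * (w V * psi j V)).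
    rewrite cE_sum => [|j]; last by apply: cbmM; [exact: cbm_cst|exact: cbmM].
    by apply: eq_bigr => j _; rewrite cEZ //; exact: cbmM.
  apply/funext => V; rewrite cE_sum => [|j]; last by apply: cbmM => //; exact: cbm_cst.
  rewrite big_distrr /=; apply: eq_bigr => j _.
  rewrite (_ : (fun x => _) = fun x => psi j V * phi j x); last by apply/funext => x; rewrite mulrC.
  by rewrite cEZ //; ring.
rewrite (_ : (fun W => _) = fun W => \sum_j cintegral mu (fun V => w V * psi j V) * phi j W).
  rewrite cE_sum => [|j]; last by apply: cbmM => //; exact: cbm_cst.
  by apply: eq_bigr => j _; rewrite cEZ // mulrC.
apply/funext => W.
rewrite (_ : (fun V => _) = fun V => \sum_j phi j W * (w V * psi j V)); last first.
  by apply/funext => V; rewrite big_distrr /=; apply: eq_bigr => j _; ring.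
rewrite cE_sum => [|j]; last by apply: cbmM; [exact: cbm_cst|exact: cbmM].
by apply: eq_bigr => j _; rewrite cEZ ?(mulrC (phi j W)) //; exact: cbmM.
Qed.

Lemma Dchan_le (A B : 'M[C]_d) phi : 0 <= phi < 2 * pi ->
  Dchan A B <= mx_opnorm (A - cis phi *: B).
Proof.
move=> h; apply: ge_inf; last by exists phi.
by exists 0 => _ [p [_ ->]]; exact: mx_opnorm_ge0.
Qed.

(** The strict inequality keeps the set open, hence measurable and covered by small balls. *)
Definition nearset (U0 : U) (eps : R) : set T :=
  [set V : T | exists2 phi, 0 <= phi < 2 * pi & mx_opnorm (val U0 - cis phi *: val (V : U)) < eps].

Lemma cis_opnorm phi (A : 'M[C]_d) : mx_opnorm (cis phi *: A) <= mx_opnorm A.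
Proof. by apply: (le_trans (mx_opnormZ _ _)); rewrite cabs2_cis sqrtr1 mul1r. Qed.

Lemma nearset_measurable U0 eps : measurable (nearset U0 eps).
Proof.
apply: uopen_measurable => V [phi h hV].
exists (eps - mx_opnorm (val U0 - cis phi *: val V)); first by rewrite subr_gt0.
move=> W hW; exists phi; first exact: h.
have -> : val U0 - cis phi *: val W = (val U0 - cis phi *: val V) - cis phi *: (val W - val V).
  by rewrite scalerBr opprB addrA subrK.
apply: (le_lt_trans (mx_opnormD _ _)); rewrite mx_opnormN.
apply: (@le_lt_trans _ _ (mx_opnorm (val U0 - cis phi *: val V) + mx_opnorm (val W - val V))).
  by rewrite lerD2l cis_opnorm.
by move: (hW : is_true (mx_opnorm (val W - val V) < _)); lra.
Qed.

Lemma nearset_null (nu : probability T R) U0 eps :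
  ~ (exists2 V, msupport nu V & Dchan (val U0) (val V) <= eps) -> nu (nearset U0 eps) = 0%E.
Proof.
move=> H; apply: null_cover; last exact: nearset_measurable.
move=> V [phi h hV].
have : ~ msupport nu V.
  by move=> sV; apply: H; exists V => //; apply: le_trans (Dchan_le _ _ h) (ltW hV).
rewrite /msupport /= => /existsNP[r /not_implyP[r0 /negP hr]]; exists r => //.
by apply/eqP; rewrite eq_le measure_ge0 andbT leNgt.
Qed.

Variables (mu nu : probability T R).
Hypothesis mu_haar : is_haar mu.
Hypothesis d0 : (0 < d)%N.

(** By the triangle inequality V is at distance at least eps - r from every phase multiple of W, and
    operator distance is at most the Frobenius distance read off the trace. *)
Lemma tail_of_far (U0 V W : U) (eps r : R) : r <= eps -> ~ nearset U0 eps W -> uball U0 r V ->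
  tailset (d := d) (eps - r) (umul (uinv W) V).
Proof.
move=> re nW bV.
have : tn (umul (uinv W) V) = tn (umul (uinv V) W) by rewrite -tn_inv uinv_umul uinvK.
rewrite /tailset /= => ->.
suff h : (eps - r) ^+ 2 <= 2 * d%:R - 2 * tn (umul (uinv V) W) by lra.
apply: tn_far => [|phi hphi]; first by rewrite subr_ge0.
have -> : mx_opnorm (1%:M - cis phi *: val (umul (uinv V) W)) = mx_opnorm (val V - cis phi *: val W).
  rewrite -(opnorm_unitl _ (uP V)) mulmxBr mulmx1 -scalemxAr umulE mulmxA uinvE.
  by rewrite (uP V) mul1mx.
rewrite leNgt; apply/negP => h; apply: nW; exists phi => //.
have -> : val U0 - cis phi *: val W = (val V - cis phi *: val W) - (val V - val U0).
  by rewrite opprB [RHS]addrC addrA subrK.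
apply: (le_lt_trans (mx_opnormD _ _)); rewrite mx_opnormN.
by move: h (bV : is_true (mx_opnorm (val V - val U0) < r)); lra.
Qed.

Lemma net_bound (t N : nat) (eps r delta : R) (U0 : U) :
  (0 < N)%N -> 0 < r -> r <= eps ->
  approx_expander t nu mu delta ->
  ~ (exists2 V, msupport nu V & Dchan (val U0) (val V) <= eps) ->
  let v := fine (mu (uball (uone R d) r)) in
  let m := xmom mu N in
  2 * expR (- (t%:R ^+ 2 / N%:R)) <= m / 8 ->
  tailmom mu N (eps - r) <= v * m / 4 ->
  v * m <= 8 * delta ^+ 2.
Proof.
move=> N0 r0 re Hexp Hno v m; set E := 2 * expR _ => Em Tm.
have E0 : 0 <= E by rewrite mulr_ge0 ?expR_ge0.
pose q := trunc_pow R N t.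
have [X hX] := span_poly d0 (size_trunc_pow R N t).
pose h (V : U) : R := q.[xfun V].
have hq V : `|h V - xfun V ^+ N| <= E.
  by apply: trunc_pow_approx => //; [exact: xfun_ge0|exact: xfun_le1].
have bx := @bm_xfunX R d N : bm (fun V : T => @xfun R d V ^+ N).
have bh : bm (h : T -> R).
  have [b1 _] := cbm_coefn X; move: b1; congr bm; apply/funext => V; by rewrite hX.
have v0 : 0 <= v by rewrite fine_ge0.
have m0 : 0 <= m by apply: ER_ge0 => V; rewrite exprn_ge0 // xfun_ge0.
have m1 : m <= 1.
  rewrite -(ER_cst mu 1); apply: ER_le => //; first exact: bm_cst.
  by move=> V; rewrite exprn_ile1 // ?xfun_ge0 ?xfun_le1.
have mh : m - E <= ER mu h.
  rewrite -(ER_cst mu E) -ERB //; last exact: bm_cst.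
  apply: ER_le => //; first by apply: bmB => //; exact: bm_cst.
  by move=> V; have := hq V; rewrite ler_norml => /andP[]; lra.
(* (x^N + E)^2 <= (1 + 2 E) x^N + E^2 because x^N <= 1; then E <= m/8 <= 1/8. *)
have h2 : ER mu (fun V => h V ^+ 2) <= 2 * m.
  apply: le_trans (_ : ER mu (fun V => (1 + 2 * E) * @xfun R d V ^+ N + E ^+ 2) <= _).
    apply: ER_le; [exact: bmX|by apply: bmD; [exact: bmZ|exact: bm_cst]|].
    move=> V; have := hq V; have : xfun (V : U) ^+ N <= 1.
      by rewrite exprn_ile1 // ?xfun_ge0 ?xfun_le1.
    have : 0 <= xfun (V : U) ^+ N by rewrite exprn_ge0 // xfun_ge0.
    move: (xfun _ ^+ N) (h V) => x y x0 x1; rewrite ler_norml => /andP[l1 l2].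
    have a1 : 0 <= x + E by rewrite addr_ge0.
    have a2 : y ^+ 2 <= (x + E) ^+ 2.
      by rewrite -(real_normK (num_real y)); apply: lerXn2r; rewrite ?nnegrE // ler_norml; lra.
    nra.
  rewrite ERD; [|exact: bmZ|exact: bm_cst].
  rewrite ERZ // ER_cst -/(xmom mu N) -/m; nra.
pose B := uball U0 r.
have mB : measurable (B : set T) by exact: uball_measurable.
have bB : bm (\1_B : T -> R) by exact: bm_indic.
have vB : ER mu \1_B = v by rewrite (ER_indic mu mB) /v -(haar_uball mu_haar U0 r).
pose F (V : U) := ER nu (fun W : T => h (umul (uinv W) V)).
have hsw (V W : U) : h (umul (uinv W) V) = h (umul (uinv V) W).
  by rewrite /h xfun_swap.
have cX (V : U) : coefn (fmul X (fadj (dmom mu nu))) V = ((F V - ER mu h)%:C)%C.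
  rewrite coefn_dmom.
  have e (n : probability T R) : cintegral n (fun W => coefn X (umul (uinv W) V)) =
      ((ER n (fun W : T => h (umul (uinv W) V)))%:C)%C.
    by rewrite -cE_real; congr (cintegral n); apply/funext => W; rewrite hX.
  rewrite !e -rmorphB /=; congr ((_ - _)%:C)%C.
  rewrite -(haar_ER (uinv V) mu_haar bh); congr ER; apply/funext => W; exact: hsw.
have cF := cbm_coefn (fmul X (fadj (dmom mu nu))).
have bF : bm (fun V : T => F V - ER mu h).
  by have [b1 _] := cF; move: b1; congr bm; apply/funext => V; rewrite cX.
have bF' : bm (F : T -> R).
  have := bmD bF (@bm_cst R _ T (ER mu h)); congr bm; apply/funext => V; by rewrite subrK.
have CS : (ER mu (fun V => \1_B V * (F V - ER mu h))) ^+ 2 <= v * (delta ^+ 2 * (2 * m)).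
  have := @ER_cs R d mu (fun V => ((\1_B V)%:C)%C) _ (cbm_real bB) cF.
  have -> : ER mu (fun V => Re (conjc ((\1_B V : R)%:C)%C * coefn (fmul X (fadj (dmom mu nu))) V)) =
     ER mu (fun V => \1_B V * (F V - ER mu h)).
    by congr ER; apply/funext => V; rewrite cX conjc_real -rmorphM.
  have -> : ER mu (fun V => cabs2 ((\1_B V : R)%:C)%C) = v.
    rewrite -vB; congr ER; apply/funext => V; rewrite cabs2_real indicE.
    by case: (V \in _); rewrite /= ?expr1n ?expr0n.
  move=> /le_trans; apply; rewrite ler_wpM2l // -ip_self.
  apply: (le_trans (expander_contract mu_haar X Hexp)).
  rewrite ler_wpM2l ?sqr_ge0 //; apply: le_trans h2; rewrite ip_self.
  rewrite le_eqVlt; apply/orP; left; apply/eqP; congr ER; apply/funext => V.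
  by rewrite hX cabs2_real.
pose G (W : U) := ER mu (fun V : T => \1_B V * h (umul (uinv W) V)).
pose cw := fun V : T => ((\1_B V : R)%:C)%C.
have ccw : cbm cw by exact: cbm_real.
pose J := (tidx t d * tidx t d)%type.
pose phi (j : J) (W : T) := conjc (rho (W : U) j.2 j.1).
pose psi (j : J) (V : T) := coefpq X j.1 j.2 (V : U).
have cphi j : cbm (phi j) by apply: cbm_conj; exact: cbm_tens.
have cpsi j : cbm (psi j) by exact: cbm_coefpq.
have hsum (V W : U) : ((h (umul (uinv W) V))%:C)%C = \sum_j phi j W * psi j V.
  by rewrite -hX coefn_umul coefn_fmul rho_inv pair_big.
(* h(W^-1 V) is a finite sum of products of a function of W and one of V, so the averages over nu
   and mu may be exchanged. *)
have sw := cE_swap mu nu ccw cphi cpsi.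
have swL : cintegral mu (fun V => cw V * cintegral nu (fun W => \sum_j phi j W * psi j V)) =
    ((ER mu (fun V => \1_B V * F V))%:C)%C.
  rewrite -cE_real; congr (cintegral mu); apply/funext => V; rewrite [RHS]rmorphM; congr (_ * _).
  rewrite -[RHS]/(((ER nu (fun W : T => h (umul (uinv W) V)))%:C)%C) -cE_real.
  by congr (cintegral nu); apply/funext => W; rewrite hsum.
have GE W : cintegral mu (fun V => cw V * \sum_j phi j W * psi j V) = ((G W)%:C)%C.
  rewrite -cE_real; congr (cintegral mu); apply/funext => V; by rewrite -hsum rmorphM.
have swR : cintegral nu (fun W => cintegral mu (fun V => cw V * \sum_j phi j W * psi j V)) =
    ((ER nu G)%:C)%C.
  by rewrite -cE_real; congr (cintegral nu); apply/funext => W; rewrite GE.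
have swap : ER mu (fun V => \1_B V * F V) = ER nu G.
  by move: sw; rewrite swL swR => -[].
have bG : bm (G : T -> R).
  have : cbm (fun W : T => \sum_j cintegral mu (fun V => cw V * psi j V) * phi j W).
    by apply: cbm_sum => j; apply: (cbmM _ (cphi j)); exact: cbm_cst.
  case=> b _; move: b; congr bm; apply/funext => W.
  suff -> : \sum_j cintegral mu (fun V => cw V * psi j V) * phi j W = ((G W)%:C)%C by [].
  rewrite -GE (_ : (fun V => _) = fun V => \sum_j phi j W * (cw V * psi j V)); last first.
    by apply/funext => V; rewrite big_distrr /=; apply: eq_bigr => j _; ring.
  rewrite cE_sum => [|j]; last by apply: (cbmM _ (cbmM ccw (cpsi j))); exact: cbm_cst.
  by apply: eq_bigr => j _; rewrite (cEZ mu (phi j W) (cbmM ccw (cpsi j))) mulrC.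
(* For W outside the null set [nearset] and V in B, W^-1 V lies in the tail, where h <= E + x^N;
   invariance turns the integral of the translated tail into [tailmom]. *)
have GU : ER nu G <= E * v + tailmom mu N (eps - r).
  apply: (ER_le_ae bG (nearset_measurable U0 eps) (nearset_null Hno)) => W nW.
  pose tl (V : U) := \1_(tailset (d := d) (eps - r)) V * @xfun R d V ^+ N.
  have btl : bm (tl : T -> R).
    by apply: bmM bx; apply: bm_indic; exact: tailset_measurable.
  have btl' := bm_umul (uinv W) btl.
  have bhW := bm_umul (uinv W) bh.
  rewrite -vB -[tailmom _ _ _]/(ER mu tl) -(haar_ER (uinv W) mu_haar btl) -(ERZ mu E bB) -(ERD mu (bmZ E bB) btl').
  apply: ER_le; [exact: (bmM bB bhW)|exact: (bmD (bmZ E bB) btl')|].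
  move=> V; rewrite indicE; have [BV|BV] := pselect (B V); last first.
    rewrite (memNset BV) mul0r mulr0 add0r; apply: mulr_ge0; first by rewrite indicE.
    by apply: exprn_ge0; exact: xfun_ge0.
  rewrite (mem_set BV) mul1r mulr1 /tl indicE mem_set ?mul1r; last exact: tail_of_far nW BV.
  by have := hq (umul (uinv W) V); rewrite ler_norml => /andP[_]; lra.
(* E v + v m / 4 - (m - E) v is at most - v m / 2, as E <= m/8. *)
have I1 : ER mu (fun V => \1_B V * (F V - ER mu h)) <= - (v * m / 2).
  have -> : ER mu (fun V => \1_B V * (F V - ER mu h)) = ER nu G - ER mu h * v.
    rewrite -swap -vB -(ERZ mu (ER mu h) bB) -(ERB mu (bmM bB bF') (bmZ (ER mu h) bB)).
    by congr ER; apply/funext => V; ring.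
  have : (m - E) * v <= ER mu h * v by rewrite ler_wpM2r.
  have : E * v <= m / 8 * v by rewrite ler_wpM2r.
  move: GU Tm; nra.
have vm0 : 0 <= v * m by rewrite mulr_ge0.
have I2 : (v * m / 2) ^+ 2 <= v * (delta ^+ 2 * (2 * m)).
  apply: le_trans CS; rewrite -[X in _ <= X]sqrrN; apply: lerXn2r; rewrite ?nnegrE.
  - by rewrite divr_ge0.
  - by move: I1; lra.
  - by move: I1; lra.
move: vm0; rewrite le_eqVlt => /predU1P[<-|vm0]; first by rewrite mulr_ge0 ?sqr_ge0.
rewrite -(ler_pM2l vm0).
move: I2; rewrite exprMn; have -> : (2^-1 : R) ^+ 2 = 4^-1 by rewrite exprVn -natrX.
nra.
Qed.

End Core.

(** * Numerical estimates *)

Section Numerics.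
Variable R : realType.

Lemma sin_le_id (x : R) : 0 <= x -> sin x <= x.
Proof.
move=> x0.
have H1 y : y \in `]0, x[ -> is_derive y 1 sin (cos y) by move=> _; exact: is_derive_sin.
have H2 : {within `[0, x], continuous sin}.
  by apply: continuous_subspaceT => y; exact: continuous_sin.
have [c _] := MVT_segment x0 H1 H2.
by rewrite sin0 !subr0 => ->; rewrite ler_piMl // cos_le1.
Qed.

(** s = sin(pi/6) satisfies 3 s - 4 s^3 = 1, that is (s + 1)(2 s - 1)^2 = 0, so s = 1/2; and sin x
    <= x. *)
Lemma pi_ge3 : 3 <= pi :> R.
Proof.
pose a : R := pi / 6; pose s := sin a.
have p0 := pi_gt0 R.
have s0 : 0 < s by apply: sin_gt0_pihalf; rewrite /a; apply/andP; split; lra.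
have e : 3 * s - 4 * s ^+ 3 = 1.
  rewrite -[RHS](sin_pihalf R) (_ : pi / 2 = a + (a + a)); last by rewrite /a; field.
  rewrite sinD sinD cosD -/s; have := cos2Dsin2 a; rewrite -/s.
  move: (cos a) => c h; have -> : s * (c * c - s * s) + c * (s * c + c * s) = s * (3 * (c ^+ 2) - s ^+ 2) by ring.
  by rewrite (_ : c ^+ 2 = 1 - s ^+ 2); [ring|lra].
have h : (s + 1) * (2 * s - 1) ^+ 2 = 0.
  rewrite (_ : _ * _ = 4 * s ^+ 3 - 3 * s + 1); [lra|ring].
have s12 : 2 * s - 1 = 0.
  by apply/eqP; move/eqP: h; rewrite mulf_eq0 sqrf_eq0 => /orP[/eqP|//]; lra.
have := @sin_le_id a; rewrite -/s => h2.
have : s <= a by apply: h2; rewrite /a; lra.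
rewrite /a; lra.
Qed.

(** Yields l >= 37/10, as exp l >= 90 / eps >= 45. The exponent is 74 steps of 1/20, reached by
    repeated squaring (74 = 64 + 8 + 2) with rounded fractions. *)
Lemma expR_37_10 : expR (37 / 10) <= 45 :> R.
Proof.
have a0 : expR (1 / 20) <= 20 / 19 :> R.
  apply: le_trans (expR_le_inv _) _; first lra.
  by rewrite (_ : (1 - 1 / 20)^-1 = 20 / 19); [|field].
have -> : 37 / 10 = 74%:R * (1 / 20) :> R by field.
rewrite expRM_natl; have := expR_gt0 (1 / 20 : R); move: (expR _) a0 => x x1 x0.
have sq (a b c : R) : 0 <= a -> a <= b -> b ^+ 2 <= c -> a ^+ 2 <= c.
  by move=> a0 ab bc; apply: le_trans bc; apply: lerXn2r; rewrite ?nnegrE //; lra.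
have p n : 0 <= x ^+ n by rewrite exprn_ge0 // ltW.
have s1 : x ^+ 2 <= 41 / 37 by apply: (sq _ _ _ (ltW x0) x1); lra.
have s2 : x ^+ 4 <= 70 / 57.
  by rewrite (exprM x 2 2); apply: (sq _ _ _ (p _) s1); lra.
have s3 : x ^+ 8 <= 92 / 61.
  by rewrite (exprM x 4 2); apply: (sq _ _ _ (p _) s2); lra.
have s4 : x ^+ 16 <= 91 / 40.
  by rewrite (exprM x 8 2); apply: (sq _ _ _ (p _) s3); lra.
have s5 : x ^+ 32 <= 88 / 17.
  by rewrite (exprM x 16 2); apply: (sq _ _ _ (p _) s4); lra.
have s6 : x ^+ 64 <= 134 / 5.
  by rewrite (exprM x 32 2); apply: (sq _ _ _ (p _) s5); lra.
have -> : x ^+ 74 = x ^+ 64 * (x ^+ 8 * x ^+ 2) by rewrite -!exprD.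
apply: le_trans (_ : 134 / 5 * (92 / 61 * (41 / 37)) <= _); last lra.
have h1 : x ^+ 8 * x ^+ 2 <= 92 / 61 * (41 / 37) by exact: ler_pM (p 8%N) (p 2%N) s3 s1.
exact: ler_pM (p 64%N) (mulr_ge0 (p 8%N) (p 2%N)) s6 h1.
Qed.

End Numerics.

Lemma pow13 (R : realType) : 61 <= (18 / 13 : R) ^+ 13.
Proof.
have a2 : 19 / 10 <= (18 / 13 : R) ^+ 2 by lra.
have a4 : 18 / 5 <= (18 / 13 : R) ^+ 4.
  by rewrite (exprM _ 2 2); move: (_ ^+ 2) a2 => x a2; nra.
have a8 : 64 / 5 <= (18 / 13 : R) ^+ 8.
  by rewrite (exprM _ 4 2); move: (_ ^+ 4) a4 => x a4; nra.
have -> : (18 / 13 : R) ^+ 13 = (18 / 13) ^+ 8 * ((18 / 13) ^+ 4 * (18 / 13)).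
  by rewrite -exprSr -exprD.
by move: (_ ^+ 8) (_ ^+ 4) a4 a8 => x z a4 a8; nra.
Qed.

(** * Parameters and margins for eps < 2 *)

Section Choices.
Variables (R : realType) (d : nat) (eps : R).
Hypotheses (d2 : (2 <= d)%N) (eps0 : 0 < eps) (eps2 : eps < 2).

Let D : R := d%:R.
Let l : R := ln (6 * Cconst R / eps).
Let X0 : R := D ^+ 3 * l / eps ^+ 2.
(** Inverse width of the peak of x^N: the radius D / sqrt(2 N) is of order 1 / S. *)
Let S : R := Num.sqrt D * Num.sqrt l / eps.
Let n := (d ^ 2)%N.

(* The exponent N of the test function x^N. *)
Definition xpow : nat := (Num.truncn (19 / 6 * X0)).+1.

Lemma D_ge2 : 2 <= D. Proof. by rewrite ler_nat. Qed.

Lemma expRl : expR l = 6 * Cconst R / eps.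
Proof. by rewrite lnK // posrE !mulr_gt0 ?invr_gt0 ?pi_gt0. Qed.

Lemma expRl_ge : 90 / eps <= expR l.
Proof.
rewrite expRl ler_pM2r ?invr_gt0 // /Cconst; have := pi_ge3 R; lra.
Qed.

Lemma l_ge : 37 / 10 <= l.
Proof.
rewrite -ler_expR; apply: (le_trans (expR_37_10 R)); apply: le_trans expRl_ge.
by rewrite ler_pdivlMr //; move: eps2; lra.
Qed.

Lemma l_gt0 : 0 < l. Proof. by apply: lt_le_trans l_ge; lra. Qed.

Lemma e2_gt0 : 0 < eps ^+ 2. Proof. by rewrite exprn_gt0. Qed.

Lemma e2_lt4 : eps ^+ 2 <= 4. Proof. by move: (eps) eps0 eps2 => e *; nra. Qed.

Lemma X0_ge : 37 / 20 * D ^+ 2 <= X0.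
Proof.
rewrite /X0 ler_pdivlMr ?e2_gt0 //.
have D2 := D_ge2; have ll := l_ge; have e := e2_lt4; have ep := e2_gt0.
have Dp : 0 <= D ^+ 2 by rewrite sqr_ge0.
apply: le_trans (_ : 37 / 20 * D ^+ 2 * 4 <= _).
  by rewrite ler_wpM2l // mulr_ge0.
have -> : D ^+ 3 * l = D ^+ 2 * (D * l) by ring.
rewrite (_ : _ * 4 = D ^+ 2 * (37 / 5)); last by field.
rewrite ler_wpM2l //; nra.
Qed.

Lemma xpow_gt : 19 / 6 * X0 < xpow%:R.
Proof. exact: truncnS_gt. Qed.

Lemma xpow_le : xpow%:R <= 10 / 3 * X0.
Proof.
have x := X0_ge; have D2 := D_ge2.
(* X0 >= 6 suffices: the gap X0 / 6 between 10/3 and 19/6 then absorbs the rounding up by 1. *)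
have X7 : 37 / 5 <= X0 by nra.
have : (Num.truncn (19 / 6 * X0))%:R <= 19 / 6 * X0 by rewrite truncn_le; lra.
by rewrite /xpow -natr1; lra.
Qed.

Lemma xpow_gt0 : (0 < xpow)%N. Proof. by []. Qed.

Let y : R := D ^+ 2 / (4 * xpow%:R).

Lemma y_le : y <= 1 / 23.
Proof.
have NR : 0 < xpow%:R :> R by rewrite ltr0n.
rewrite /y ler_pdivrMr ?mulr_gt0 //.
have := xpow_gt; have := X0_ge; have : 0 <= D ^+ 2 by exact: sqr_ge0.
move: (xpow%:R) X0 (D ^+ 2) => a b c; lra.
Qed.

Lemma y_ge0 : 0 <= y. Proof. by rewrite divr_ge0 ?sqr_ge0 ?mulr_ge0. Qed.

Lemma nE : n%:R = D ^+ 2. Proof. by rewrite /n natrX. Qed.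

(** 2 N y = n / 2, so the power is close to exp(-n/2). The factor 23/22 is the loss in 1 - y >=
    exp(-(23/22) y), valid for y <= 1/23, and 25/46 is a rational below exp(-23/44). *)
Lemma pow1y : (25 / 46) ^+ n <= (1 - y) ^+ (2 * xpow).
Proof.
have y0 := y_ge0; have y1 := y_le.
have NR : 0 < xpow%:R :> R by rewrite ltr0n.
have h : expR (- (23 / 22 * y)) <= 1 - y.
  rewrite expRN; apply: le_trans (_ : (1 + 23 / 22 * y)^-1 <= _).
    rewrite lef_pV2 ?posrE ?expR_gt0 //; last by lra.
    exact: expR_ge1Dx.
  rewrite -[X in X <= _]mul1r ler_pdivrMr; nra.
apply: le_trans (_ : expR (- (23 / 22 * y)) ^+ (2 * xpow) <= _); last first.
  by apply: lerXn2r; rewrite ?nnegrE ?expR_ge0 // subr_ge0; lra.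
have -> : expR (- (23 / 22 * y)) ^+ (2 * xpow) = expR (- (23 / 44)) ^+ n.
  rewrite -!expRM_natl nE natrM; congr expR; rewrite /y; field; rewrite gt_eqF //.
apply: lerXn2r; rewrite ?nnegrE ?expR_ge0 //.
have -> : - (23 / 44) = 2%:R * (- (23 / 88)) :> R by field.
rewrite expRM_natl; apply: le_trans (_ : (1 - 23 / 88) ^+ 2 <= _); first by lra.
apply: lerXn2r; rewrite ?nnegrE ?expR_ge0 //; first by lra.
exact: expR_ge1Dx.
Qed.

Lemma S2E : S ^+ 2 = D * l / eps ^+ 2.
Proof.
rewrite /S !exprMn exprVn !sqr_sqrtr //; first exact: ltW l_gt0.
Qed.

Lemma S_gt0 : 0 < S.
Proof.
by rewrite divr_gt0 // mulr_gt0 // sqrtr_gt0 ?l_gt0 //; have := D_ge2; lra.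
Qed.

Lemma S_ge : 3 <= 23 / 10 * S.
Proof.
have Sp := S_gt0.
have : 37 / 20 <= S ^+ 2.
  rewrite S2E ler_pdivlMr ?e2_gt0 //.
  by have := D_ge2; have := l_ge; have := e2_lt4; have := e2_gt0; nra.
nra.
Qed.

Variable mu : probability (Umeas R d) R.
Hypothesis mu_haar : is_haar mu.

Lemma d_gt0 : (0 < d)%N. Proof. exact: leq_trans d2. Qed.

Lemma xmom_ge : ((25 / 46) / (23 * S)) ^+ n <= xmom mu xpow.
Proof.
have NR : 0 < xpow%:R :> R by rewrite ltr0n.
have D0 : 0 < D by have := D_ge2; lra.
have sN : 0 < Num.sqrt (2 * xpow%:R) :> R by rewrite sqrtr_gt0 mulr_gt0.
have sN2 : Num.sqrt (2 * xpow%:R) ^+ 2 = 2 * xpow%:R :> R by rewrite sqr_sqrtr // mulr_ge0.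
(* Chosen so that r^2 / 2 = y: the loss on this ball is the power bounded by [pow1y]. *)
pose r := D / Num.sqrt (2 * xpow%:R).
have r0 : 0 < r by rewrite divr_gt0.
have r2 : r ^+ 2 = 2 * y.
  by rewrite /r expr_div_n sN2 /y; field; rewrite gt_eqF.
pose k := (Num.truncn (8 / r + 2)).+1.
have kgt : 8 / r + 2 < k%:R by exact: truncnS_gt.
have p8 : 0 < 8 / r by rewrite divr_gt0.
have kle : k%:R <= 8 / r + 3.
  have : (Num.truncn (8 / r + 2))%:R <= 8 / r + 2 by rewrite truncn_le; lra.
  by rewrite /k -natr1; lra.
(* 23 = 207/10 + 23/10, the second part paying for the rounding of k by [S_ge]. *)
have r8 : 8 / r <= 207 / 10 * S.
  have Sp := S_gt0.
  have q0 : 0 <= 207 / 10 * S by rewrite mulr_ge0 // ltW.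
  rewrite -(ler_pXn2r (_ : 0 < 2)%N) ?nnegrE ?(ltW p8) ?q0 //.
  rewrite expr_div_n r2 exprMn S2E /y.
  have := xpow_le; rewrite /X0 => hN.
  have -> : 8 ^+ 2 / (2 * (D ^+ 2 / (4 * xpow%:R))) = 128 * xpow%:R / D ^+ 2.
    by field; rewrite !gt_eqF // exprn_gt0.
  rewrite ler_pdivrMr ?exprn_gt0 //.
  apply: le_trans (_ : 128 * (10 / 3 * (D ^+ 3 * l / eps ^+ 2)) <= _).
    by rewrite ler_pM2l.
  have -> : (207 / 10) ^+ 2 * (D * l / eps ^+ 2) * D ^+ 2 = (207 / 10) ^+ 2 * (D ^+ 3 * l / eps ^+ 2).
    by ring.
  have : 0 <= D ^+ 3 * l / eps ^+ 2.
    by rewrite divr_ge0 ?(ltW e2_gt0) // mulr_ge0 ?(ltW l_gt0) // exprn_ge0 // ltW.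
  lra.
have kS : k%:R <= 23 * S.
  by apply: (le_trans kle); have := S_ge; move: r8; move: (8 / r) S => a b; lra.
have k0 : 0 < k%:R :> R by rewrite ltr0n.
have r22 : r ^+ 2 <= 2 by rewrite r2; have := y_le; lra.
apply: le_trans (xmom_lower mu_haar d_gt0 xpow r0 r22 kgt).
rewrite r2 (_ : 1 - 2 * y / 2 = 1 - y); last by field.
rewrite -/n expr_div_n; apply: ler_pM; rewrite ?invr_ge0 ?exprn_ge0 //.
- by have := S_gt0; lra.
- exact: pow1y.
- rewrite lef_pV2 ?posrE ?exprn_gt0 //; last by have := S_gt0; lra.
  by apply: lerXn2r; rewrite ?nnegrE ?(ltW k0) //; have := S_gt0; lra.
Qed.

Let v := fine (mu (uball (uone R d) (eps / 6))).

(** 54 = 48 + 6: 8 / (eps/6) = 48 / eps, and 6 / eps >= 3 covers the shift and rounding of k. *)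
Lemma haar_ball_ge : (eps / 54) ^+ n <= v.
Proof.
have r0 : 0 < eps / 6 by rewrite divr_gt0.
pose k := (Num.truncn (8 / (eps / 6) + 2)).+1.
have kgt : 8 / (eps / 6) + 2 < k%:R by exact: truncnS_gt.
have p8 : 0 < 8 / (eps / 6) by rewrite divr_gt0.
have kle : k%:R <= 54 / eps.
  have : (Num.truncn (8 / (eps / 6) + 2))%:R <= 8 / (eps / 6) + 2 by rewrite truncn_le; lra.
  have e8 : 8 / (eps / 6) = 48 / eps by field; rewrite gt_eqF.
  have : 3 <= 6 / eps by rewrite ler_pdivlMr //; move: eps2; lra.
  rewrite /k -natr1 e8.
  have -> : 54 / eps = 48 / eps + 6 / eps by field; rewrite gt_eqF.
  lra.
have k0 : 0 < k%:R :> R by rewrite ltr0n.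
apply: le_trans (haar_ball mu_haar d_gt0 r0 kgt).
have p54 : 0 < 54 / eps by rewrite divr_gt0.
have -> : (eps / 54) ^+ n = ((54 / eps) ^+ n)^-1 by rewrite -exprVn invf_div.
rewrite lef_pV2 ?posrE ?(exprn_gt0 _ p54) ?(exprn_gt0 _ k0) //.
by apply: lerXn2r; rewrite ?nnegrE ?(ltW k0) ?(ltW p54).
Qed.

Lemma n_ge4 : (4 <= n)%N.
Proof. by rewrite /n -[4%N]/(2 ^ 2)%N leq_exp2r. Qed.

(** The coefficient 19/6 of N is spent here: 7/8 * 19/6 * (5/6)^2 exceeds 19/10. *)
Lemma tail_exp : expR (- (7 / 8 * xpow%:R * (eps - eps / 6) ^+ 2 / D)) <=
  expR (- (19 / 10 * l)) ^+ n.
Proof.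
have D0 : 0 < D by have := D_ge2; lra.
have c0 : 19 / 10 <= 7 / 8 * (19 / 6) * (5 / 6) ^+ 2 :> R by lra.
rewrite -expRM_natl nE ler_expR mulrN lerN2.
apply: le_trans (_ : 7 / 8 * (19 / 6 * X0) * (eps - eps / 6) ^+ 2 / D <= _); last first.
  rewrite ler_pM2r ?invr_gt0 // ler_wpM2r ?sqr_ge0 // ler_pM2l //.
  exact: ltW xpow_gt.
have -> : 7 / 8 * (19 / 6 * X0) * (eps - eps / 6) ^+ 2 / D =
    7 / 8 * (19 / 6) * (5 / 6) ^+ 2 * (D ^+ 2 * l).
  by rewrite /X0; field; rewrite !gt_eqF.
have -> : D ^+ 2 * (19 / 10 * l) = 19 / 10 * (D ^+ 2 * l) by ring.
by rewrite ler_wpM2r // mulr_ge0 ?sqr_ge0 // ltW // l_gt0.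
Qed.

(** One l gives exp(-l) <= eps/90; the other 9/10 l is at least 13/4, and exp(-13/4) <= (5/4)^-13 <=
    1/18. *)
Lemma expl_le : expR (- (19 / 10 * l)) <= eps / 90 * (1 / 18).
Proof.
have h18 : 18 <= (1 + 1 / 4) ^+ 13 :> R by rewrite !exprS expr0; lra.
have l1 : 13%:R * (1 / 4) <= 9 / 10 * l by have := l_ge; lra.
have -> : - (19 / 10 * l) = - l + - (9 / 10 * l) by field.
rewrite expRD; apply: ler_pM; rewrite ?expR_ge0 //.
  rewrite expRN -[eps / 90]invrK lef_pV2 ?posrE ?expR_gt0 ?invr_gt0 ?divr_gt0 //.
  by rewrite invf_div; exact: expRl_ge.
apply: le_trans (_ : expR (- (13%:R * (1 / 4))) <= _); first by rewrite ler_expR lerN2.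
rewrite expRN expRM_natl [1 / 18]div1r lef_pV2 ?posrE ?exprn_gt0 ?expR_gt0 //.
apply: (le_trans h18).
by apply: lerXn2r; rewrite ?nnegrE ?expR_ge0 ?expR_ge1Dx //.
Qed.

(** The share of one of the n coordinates in the tail estimate; the spare factor 3/2, raised to the
    power n >= 4, covers the division by 4. *)
Lemma tail_const : expR (- (19 / 10 * l)) * (53 / 5) * (3 / 2) <= eps / 54 * (25 / 46).
Proof.
have h := expl_le; have e0 := eps0.
apply: le_trans (_ : eps / 90 * (1 / 18) * (53 / 5) * (3 / 2) <= _).
  by rewrite !ler_pM2r.
by move: (eps) e0 => e e0; lra.
Qed.

Lemma n_pow4 : 4 <= (3 / 2) ^+ n :> R.
Proof.
apply: le_trans (_ : (3 / 2) ^+ 4 <= _); first by rewrite !exprS expr0; lra.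
by apply: ler_weXn2l; [lra|exact: n_ge4].
Qed.

Lemma tailmom_small : tailmom mu xpow (eps - eps / 6) <= v * xmom mu xpow / 4.
Proof.
have y1 : y < 1 by apply: le_lt_trans y_le _; lra.
have m0 : 0 <= xmom mu xpow by apply: ER_ge0 => V; rewrite exprn_ge0 // xfun_ge0.
have T0 : 0 <= tailmom mu xpow (eps - eps / 6).
  apply: ER_ge0 => V; apply: mulr_ge0; first by rewrite indicE.
  by apply: exprn_ge0; exact: xfun_ge0.
have k0 : 0 < (25 / 46) ^+ n :> R by rewrite exprn_gt0.
have ee := expR_ge0 (- (19 / 10 * l)).
apply: le_trans (_ : (eps / 54) ^+ n * xmom mu xpow / 4 <= _); last first.
  by rewrite ler_pM2r ?invr_gt0 // ler_wpM2r // haar_ball_ge.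
(* Multiplying by (25/46)^n <= (1 - y)^(2 N) brings in the left-hand side of [tailmom_le]. *)
rewrite -(ler_pM2r k0).
apply: le_trans (_ : tailmom mu xpow (eps - eps / 6) * (1 - y) ^+ (2 * xpow) <= _).
  by rewrite ler_wpM2l // pow1y.
apply: (le_trans (tailmom_le mu_haar d_gt0 (eps - eps / 6) xpow_gt0 y1)).
apply: le_trans (_ : expR (- (19 / 10 * l)) ^+ n * (53 / 5) ^+ n * xmom mu xpow <= _).
  rewrite ler_wpM2r // ler_wpM2r ?tail_exp // exprn_ge0 //.
rewrite [X in _ <= X](_ : _ = ((eps / 54) ^+ n * (25 / 46) ^+ n / 4) * xmom mu xpow); last first.
  by move: (_ ^+ n) (_ ^+ n) => a b; field.
rewrite ler_wpM2r // ler_pdivlMr // -!exprMn.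
apply: le_trans (_ : (expR (- (19 / 10 * l)) * (53 / 5)) ^+ n * (3 / 2) ^+ n <= _).
  by rewrite ler_wpM2l ?n_pow4 // exprn_ge0 // mulr_ge0.
rewrite -exprMn; apply: lerXn2r; rewrite ?nnegrE; last exact: tail_const.
  by rewrite !mulr_ge0.
by rewrite mulr_ge0 // divr_ge0 // ltW.
Qed.

(** Everything is compared with h = sqrt Q, Q = (D / eps) sqrt l. From t^2 / N >= (15/2) n log Q,
    where 15/2 = 25 / (10/3), the error is at most 2 h^(-15 n), while S <= (5/7) h^2 gives m >= (c /
    h^2)^n. What remains is h^13 >= 61, the factor 16 being absorbed by 2^n. *)
Lemma truncation_small (t : nat) : 5 * (D `^ (5 / 2)) / eps * tau eps d <= t%:R ->
  2 * expR (- (t%:R ^+ 2 / xpow%:R)) <= xmom mu xpow / 8.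
Proof.
move=> ht.
have NR : 0 < xpow%:R :> R by rewrite ltr0n.
have D2 := D_ge2; have D0 : 0 < D by lra.
have l0 := l_gt0; have Sp := S_gt0.
pose sl := Num.sqrt l.
have sl0 : 0 < sl by rewrite sqrtr_gt0.
have sl2 : sl ^+ 2 = l by rewrite sqr_sqrtr // ltW.
pose Q := D / eps * sl.
have sl1 : 48 / 25 <= sl by have := l_ge; rewrite -sl2; nra.
have Q1 : 48 / 25 <= Q.
  have : 1 <= D / eps by rewrite ler_pdivlMr // mul1r; move: eps2; lra.
  rewrite /Q; nra.
pose Y := ln Q.
have Y0 : 0 <= Y by rewrite ln_ge0 //; lra.
pose h := expR (Y / 2).
have hp : 0 < h by exact: expR_gt0.
have h2 : h ^+ 2 = Q.
  rewrite /h -expRM_natl (_ : 2%:R * (Y / 2) = Y); last by field.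
  by rewrite lnK // posrE; lra.
have h1 : 18 / 13 <= h by rewrite -h2 in Q1; nra.
have tau2 : l * Y <= tau eps d ^+ 2.
  rewrite /tau -/l -/sl -/D -/Q -/Y exprMn sl2 sqr_sqrtr; last by rewrite addr_ge0 // mulr_ge0 // ltW.
  by rewrite ler_pM2l // lerDr mulr_ge0 // ltW.
have tau0 : 0 <= tau eps d by rewrite /tau mulr_ge0 ?sqrtr_ge0.
move: (tau eps d) tau2 tau0 ht => ta tau2 tau0 ht.
have D52 : (D `^ (5 / 2)) ^+ 2 = D ^+ 5.
  rewrite -powR_mulrn ?powR_ge0 // -powRrM (_ : 5 / 2 * 2%:R = 5%:R); last by field.
  by rewrite powR_mulrn // ltW.
have t2 : 15 / 2 * n%:R * Y <= t%:R ^+ 2 / xpow%:R.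
  rewrite ler_pdivlMr // nE.
  apply: le_trans (_ : (5 * (D `^ (5 / 2)) / eps * ta) ^+ 2 <= _); last first.
    by apply: lerXn2r; rewrite ?nnegrE ?mulr_ge0 ?powR_ge0 ?invr_ge0 ?(ltW eps0).
  rewrite !exprMn D52 exprVn.
  apply: le_trans (_ : 15 / 2 * D ^+ 2 * Y * (10 / 3 * X0) <= _).
    by rewrite ler_wpM2l ?xpow_le // !mulr_ge0 ?sqr_ge0.
  apply: le_trans (_ : 5 ^+ 2 * D ^+ 5 / eps ^+ 2 * (l * Y) <= _).
    rewrite le_eqVlt; apply/orP; left; apply/eqP; rewrite /X0; field; rewrite gt_eqF //.
  apply: ler_wpM2l tau2; apply: divr_ge0 (ltW e2_gt0); apply: mulr_ge0; first exact: sqr_ge0.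
  by apply: exprn_ge0; exact: ltW.
have E1 : expR (- (t%:R ^+ 2 / xpow%:R)) <= (h ^- 15) ^+ n.
  have -> : h ^- 15 = expR (- (15 / 2 * Y)).
    rewrite expRN /h -expRM_natl; congr (expR _)^-1; by field.
  rewrite -expRM_natl ler_expR mulrN lerN2; lra.
have f16 : 16 <= 2 ^+ n :> R.
  rewrite -natrX ler_nat -[16%N]/(2 ^ 4)%N leq_exp2l //; exact: n_ge4.
apply: le_trans (_ : ((25 / 46) / (23 * S)) ^+ n / 8 <= _); last first.
  by rewrite ler_pM2r ?invr_gt0 // xmom_ge.
rewrite ler_pdivlMr //.
apply: le_trans (_ : 2 ^+ n * (h ^- 15) ^+ n <= _).
  apply: le_trans (_ : 16 * (h ^- 15) ^+ n <= _); first by lra.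
  by rewrite ler_wpM2r // exprn_ge0 // invr_ge0 exprn_ge0 // ltW.
have h15 : 0 < h ^+ 15 by rewrite exprn_gt0.
have a0 : 0 <= 2 * h ^- 15 by rewrite mulr_ge0 // invr_ge0 ltW.
have S23 : 0 < 23 * S by rewrite mulr_gt0.
have b0 : 0 <= 25 / 46 / (23 * S) by rewrite divr_ge0 // ltW.
rewrite -exprMn; apply: lerXn2r; rewrite ?nnegrE //.
rewrite ler_pdivlMr // mulrAC ler_pdivrMr //.
have SQ : 7 / 5 * S <= h ^+ 2.
  have sd : 7 / 5 <= Num.sqrt D.
    rewrite -(ler_pXn2r (_ : 0 < 2)%N) ?nnegrE ?sqrtr_ge0 //.
    by rewrite sqr_sqrtr ?(ltW D0) //; lra.
  have -> : h ^+ 2 = Num.sqrt D * S.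
    rewrite h2 /Q /S -/sl -{1}(sqr_sqrtr (ltW D0)) expr2; ring.
  by rewrite ler_pM2r.
have h13 : 61 <= h ^+ 13.
  apply: le_trans (_ : (18 / 13) ^+ 13 <= _); last by apply: lerXn2r; rewrite ?nnegrE ?(ltW hp).
  exact: pow13.
have -> : h ^+ 15 = h ^+ 13 * h ^+ 2 by rewrite -exprD.
have hh : 61 * h ^+ 2 <= h ^+ 13 * h ^+ 2 by rewrite ler_wpM2r // sqr_ge0.
move: (h ^+ 13 * h ^+ 2) (h ^+ 2) hh SQ => a b hh SQ.
lra.
Qed.

(** delta^2 is bounded by a power B^(n - 1), v m from below by A^n, and rho = A / B >= 1. Of the n -
    1 factors rho, three are kept to make up for the extra factor A: A rho^3 is a constant times l
    D^4 / eps, which exceeds 8 / 32^2 = 1/128. *)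
Lemma delta_small (delta : R) : 0 <= delta ->
  delta <= 1 / 32 * (eps `^ (3 / 2) /
       (4 * Cconst R * Num.sqrt (ln (6 * Cconst R / eps)) * d%:R)) ^+ (d ^ 2 - 1) ->
  8 * delta ^+ 2 < v * xmom mu xpow.
Proof.
rewrite -/l -/D -/n; set sl := Num.sqrt l; set beta := (X in X ^+ (n - 1)) => de0 de.
have D2 := D_ge2; have D0 : 0 < D by lra.
have l0 := l_gt0; have Sp := S_gt0; have l1 := l_ge.
have sl0 : 0 < sl by rewrite sqrtr_gt0.
have sl2 : sl ^+ 2 = l by rewrite sqr_sqrtr // ltW.
pose sd := Num.sqrt D.
have sd0 : 0 < sd by rewrite sqrtr_gt0.
have sd2 : sd ^+ 2 = D by rewrite sqr_sqrtr // ltW.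
have p3 := pi_ge3 R.
pose B := eps ^+ 3 / (60 ^+ 2 * l * D ^+ 2).
have B0 : 0 < B by rewrite divr_gt0 ?mulr_gt0 ?exprn_gt0.
have E3 : (eps `^ (3 / 2)) ^+ 2 = eps ^+ 3.
  rewrite -powR_mulrn ?powR_ge0 // -powRrM (_ : 3 / 2 * 2%:R = 3%:R); last by field.
  by rewrite powR_mulrn // ltW.
have c0 : 60 <= 4 * Cconst R by rewrite /Cconst; lra.
have bB : beta ^+ 2 <= B.
  rewrite /beta exprMn exprVn E3 ler_pM2l ?exprn_gt0 // lef_pV2 ?posrE ?mulr_gt0 ?exprn_gt0 ?mulr_gt0 //; try lra.
  rewrite !exprMn sl2 -/D ler_pM2r ?exprn_gt0 // ler_pM2r //.
  rewrite -exprMn; move: (4 * Cconst R) c0 => c c0; nra.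
have b0 : 0 <= beta.
  by rewrite divr_ge0 ?powR_ge0 // !mulr_ge0 ?(ltW sl0) ?(ltW D0) //; lra.
have dB : delta ^+ 2 <= (1 / 32) ^+ 2 * B ^+ (n - 1).
  apply: le_trans (_ : (1 / 32 * beta ^+ (n - 1)) ^+ 2 <= _).
    by apply: lerXn2r; rewrite ?nnegrE ?mulr_ge0 ?exprn_ge0.
  rewrite exprMn -exprM mulnC exprM.
  by rewrite ler_pM2l // lerXn2r // nnegrE ?sqr_ge0 ?(ltW B0).
pose A := eps / 54 * ((25 / 46) / (23 * S)).
have S23 : 0 < 23 * S by rewrite mulr_gt0.
have b1 : 0 < 25 / 46 / (23 * S) by rewrite divr_gt0.
have e54 : 0 < eps / 54 by rewrite divr_gt0.
have A0 : 0 < A by rewrite mulr_gt0.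
have Av : A ^+ n <= v * xmom mu xpow.
  rewrite exprMn; apply: ler_pM haar_ball_ge xmom_ge; apply: exprn_ge0; exact: ltW.
apply: lt_le_trans Av.
have AE : A = 25 / (46 * 54 * 23) * eps ^+ 2 / (sd * sl).
  rewrite /A /S -/sd -/sl; field; by rewrite !gt_eqF.
pose rho := A / B.
have rhoE : rho = 60 ^+ 2 * (25 / (46 * 54 * 23)) * (sl * D * sd / eps).
  rewrite /rho AE /B -sl2 -sd2; field; by rewrite !gt_eqF.
have n1 : n = (n - 1).+1 by rewrite subn1 prednK // (leq_trans _ n_ge4).
have rho1 : 1 <= rho.
  rewrite rhoE.
  have : 2 <= D * sd / eps * 2.
    rewrite ler_pMl // ler_pdivlMr // mul1r; have : 1 <= sd by nra.
    by move: eps2; nra.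
  have : 19 / 10 <= sl by nra.
  rewrite (_ : sl * D * sd / eps = sl * (D * sd / eps)); last by ring.
  move: (D * sd / eps) => z; nra.
rewrite [X in _ < _ ^+ X]n1 [A ^+ _.+1]exprS.
have -> : A ^+ (n - 1) = rho ^+ (n - 1) * B ^+ (n - 1).
  by rewrite -exprMn /rho divfK // gt_eqF.
have rn : rho ^+ 3 <= rho ^+ (n - 1).
  by apply: ler_weXn2l => //; rewrite -[3%N]/(4 - 1)%N leq_sub2r // n_ge4.
have Bn : 0 < B ^+ (n - 1) by rewrite exprn_gt0.
apply: le_lt_trans (_ : 1 / 128 * B ^+ (n - 1) < _); first by lra.
rewrite mulrA ltr_pM2r //.
apply: lt_le_trans (_ : A * rho ^+ 3 <= _); last by rewrite ler_pM2l.
have -> : A * rho ^+ 3 = (25 / (46 * 54 * 23)) ^+ 4 * 60 ^+ 6 * (l * D ^+ 4 / eps).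
  have -> : l * D ^+ 4 = sl ^+ 2 * (D ^+ 3 * sd ^+ 2) by rewrite sl2 sd2; ring.
  rewrite AE rhoE; field; by rewrite !gt_eqF.
have z1 : 29 <= l * D ^+ 4 / eps.
  rewrite ler_pdivlMr //.
  have d4 : 16 <= D ^+ 4.
    have D4 : 4 <= D ^+ 2 by move: D2; rewrite expr2; move: D => a D2; nra.
    by rewrite (exprM D 2 2); move: D4; move: (D ^+ 2) => a D4; nra.
  have : 16 * (37 / 10) <= l * D ^+ 4 by rewrite mulrC ler_pM //; lra.
  by move: eps2; lra.
move: (l * D ^+ 4 / eps) z1 => z z1.
lra.
Qed.

End Choices.

(** * Conclusion *)

Lemma msupport_neq0 (R : realType) (d : nat) (nu : probability (Umeas R d) R) :
  exists V, msupport nu V.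
Proof.
apply: contrapT => noV.
(* With empty support every point has a null ball around it, and a countable cover would make the
   whole group null. *)
have : nu setT = 0%E.
  apply: null_cover; last exact: measurableT.
  move=> V _; have : ~ msupport nu V by move=> sV; apply: noV; exists V.
  rewrite /msupport /= => /existsNP[r /not_implyP[r0 /negP hr]]; exists r => //.
  by apply/eqP; rewrite eq_le measure_ge0 andbT leNgt.
by rewrite probability_setT => /eqP; rewrite onee_eq0.
Qed.

Lemma Dchan_le2 (R : realType) (d : nat) (U V : unitary R d) :
  Dchan (val U) (val V) <= 2.
Proof.
apply: (le_trans (@Dchan_le R d (val U) (val V) 0 _)).
  by rewrite lexx mulr_gt0 ?pi_gt0.
apply: (le_trans (mx_opnormD _ _)); rewrite mx_opnormN.
have h (W : unitary R d) : mx_opnorm (val W) <= 1 by exact/opnorm_unit/uP.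
by apply: (@le_trans _ _ (1 + 1)); rewrite ?lerD ?(le_trans (cis_opnorm _ _)).
Qed.

Theorem theorem3 (R : realType) (d t : nat) (eps delta : R)
    (mu nu : probability (Umeas R d) R) :
  (2 <= d)%N -> 0 < eps -> is_haar mu ->
  5 * (d%:R `^ (5 / 2)) / eps * tau eps d <= t%:R ->
  delta <= 1 / 32 * (eps `^ (3 / 2) /
       (4 * Cconst R * Num.sqrt (ln (6 * Cconst R / eps)) * d%:R)) ^+ (d ^ 2 - 1) ->
  approx_expander t nu mu delta ->
  is_eps_net (msupport nu) eps.
Proof.
move=> d2 eps0 haar ht hdelta hexp U.
(* Channels are at distance at most 2, so for eps >= 2 any point of the support will do; the
   estimates for eps < 2 rest on l >= 37/10. *)
have [eps2|eps2] := ltP eps 2; last first.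
  have [V sV] := msupport_neq0 nu.
  by exists V => //; exact: le_trans (Dchan_le2 U V) eps2.
apply: contrapT => noV.
have delta0 : 0 <= delta := le_trans (opnorm_ge0 _) hexp.
have r0 : 0 < eps / 6 by rewrite divr_gt0.
have reps : eps / 6 <= eps by rewrite ler_pdivrMr //; lra.
have := net_bound haar (ltnW d2) (xpow_gt0 d eps) r0 reps hexp noV
  (truncation_small d2 eps0 eps2 haar ht) (tailmom_small d2 eps0 eps2 haar).
by rewrite leNgt (delta_small d2 eps0 eps2 haar delta0 hdelta).
Qed.
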